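(* Let $P$ be a TRAP, $Q$ a unitary TRAP and $\theta:P\to Q$ a TRAP morphism. There exists a unique unitary TRAP morphism $\Theta:\mathrm{uPGr}(P)\to Q$ extending $\theta$, i.e. such that $\Theta\circ\iota'=\theta$, where $\mathrm{uPGr}(P)$ is the unitary TRAP and $\iota':P\to\mathrm{uPGr}(P)$ the injective TRAP morphism described in the context.
   Context: Notation: $\mathbb{N}_0=\{0,1,2,\dots\}$, $[k]=\{1,\dots,k\}$, $\mathfrak S_k$ is the symmetric group on $[k]$. TRAP. A TRAP is a family $P=(P(k,l))_{k,l\ge 0}$ of sets with: (1) for all $k,l\in\mathbb N_0$, a left action of $\mathfrak S_l$ and a right action of $\mathfrak S_k$ on $P(k,l)$ which commute (this is called an $\mathfrak S\times\mathfrak S^{op}$-module). (2) Maps $*:P(k,l)\times P(k',l')\to P(k+k',l+l')$ (horizontal concatenation) such that: $*$ is associative; there is $I_0\in P(0,0)$ with $I_0*p=p*I_0=p$; $(\sigma\cdot p\cdot\tau)*(\sigma'\cdot p'\cdot\tau')=(\sigma\otimes\sigma')\cdot(p*p')\cdot(\tau\otimes\tau')$, where for $\alpha\in\mathfrak S_m,\beta\in\mathfrak S_n$, $(\alpha\otimes\beta)(i)=\alpha(i)$ if $i\le m$ and $\beta(i-m)+m$ if $i>m$; and $c_{l,l'}\cdot(p*p')=(p'*p)\cdot c_{k,k'}$ for $p\in P(k,l)$, $p'\in P(k',l')$, where $c_{m,n}\in\mathfrak S_{m+n}$, $c_{m,n}(i)=i+n$ if $i\le m$ and $i-m$ if $i>m$.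 (3) For $k,l\ge1$, $i\in[k]$, $j\in[l]$, maps $t_{i,j}:P(k,l)\to P(k-1,l-1)$ (partial trace maps) such that: (a) for $k,l\ge2$, $i\in[k]$, $j\in[l]$, $i'\in[k-1]$, $j'\in[l-1]$: $t_{i',j'}\circ t_{i,j}$ equals $t_{i-1,j-1}\circ t_{i',j'}$ if $i'<i,j'<j$; $t_{i,j-1}\circ t_{i'+1,j'}$ if $i'\ge i,j'<j$; $t_{i-1,j}\circ t_{i',j'+1}$ if $i'<i,j'\ge j$; $t_{i,j}\circ t_{i'+1,j'+1}$ if $i'\ge i,j'\ge j$. (b) $t_{i,j}(\sigma\cdot p\cdot\tau)=\sigma_j\cdot t_{\tau(i),\sigma^{-1}(j)}(p)\cdot\tau_{\tau(i)}$, where for $\alpha\in\mathfrak S_n$ and $q\in[n]$, $\alpha_q\in\mathfrak S_{n-1}$ is the permutation whose word is obtained from the word $\alpha(1)\dots\alpha(n)$ by deleting the letter $q$ and subtracting $1$ from all letters $>q$. (c) for $p\in P(k,l)$, $p'\in P(k',l')$ ($k,l,k',l'\ge0$), $i\in[k+k']$, $j\in[l+l']$: $t_{i,j}(p*p')=t_{i,j}(p)*p'$ if $i\le k,j\le l$, and $t_{i,j}(p*p')=p*t_{i-k,j-l}(p')$ if $i>k,j>l$. The TRAP is unitary if there is $I\in P(1,1)$ such that for all $k,l\ge0$ and $p\in P(k,l)$: $t_{1,j}(I*p)=(1,2,\dots,j-1)\cdot p$ for $2\le j\le l+1$; $t_{i,1}(I*p)=p\cdot(1,2,\dots,i-1)^{-1}$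 for $2\le i\le k+1$; $t_{k+1,j}(p*I)=(j,j+1,\dots,l)^{-1}\cdot p$ for $1\le j\le l$; $t_{i,l+1}(p*I)=p\cdot(i,i+1,\dots,k)$ for $1\le i\le k$ (here $(a,\dots,b)$ denotes a cycle). A morphism of TRAPs $\phi:P\to Q$ is a family of maps $P(k,l)\to Q(k,l)$ commuting with the symmetric group actions, with $\phi(I_0)=I_0$, $\phi(p*q)=\phi(p)*\phi(q)$ and $\phi\circ t_{i,j}=t_{i,j}\circ\phi$. Between unitary TRAPs it is unitary if it maps the unit to the unit. Graphs. A graph $G$ consists of finite (possibly empty) sets $V(G)$ (vertices), $E(G)$ (internal edges), $I(G)$ (input edges), $O(G)$ (output edges), $IO(G)$ (input-output edges), $L(G)$ (loops, i.e. edges with no endpoints), a source map $s:E(G)\sqcup O(G)\to V(G)$, a target map $t:E(G)\sqcup I(G)\to V(G)$, and bijections $\alpha:I(G)\sqcup IO(G)\to[i(G)]$, $\beta:O(G)\sqcup IO(G)\to[o(G)]$, where $i(G)=|I(G)|+|IO(G)|$, $o(G)=|O(G)|+|IO(G)|$. The incoming (outgoing) edges of a vertex $v$ are the elements of $t^{-1}(v)$ (of $s^{-1}(v)$), their number is $i(v)$ (resp. $o(v)$). It is corolla ordered if for each vertex $v$ the incoming edges and the outgoing edges are each totally ordered. For a family of sets $X=(X(k,l))_{k,l\ge0}$, it is $X$-decorated if it has a map $d_G$ on $V(G)$ with $d_G(v)\in X(i(v),o(v))$. It is solar if $IO(G)=L(G)=\emptyset$. Isomorphisms are families of bijections between the six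 sets respecting $s,t,\alpha,\beta$, orders and decorations. $\mathrm{CGr}(X)(k,l)$ is the set of isomorphism classes of $X$-decorated corolla ordered graphs with $i(G)=k$, $o(G)=l$, and $\mathrm{solCGr}(X)(k,l)$ the subset of solar ones. TRAP structure. For $\tau\in\mathfrak S_l$, $\sigma\in\mathfrak S_k$, $\tau\cdot G\cdot\sigma$ is $G$ with $\alpha,\beta$ replaced by $\sigma^{-1}\circ\alpha$, $\tau\circ\beta$. $G*G'$ is the disjoint union, the input (output) labels of $G'$ being shifted by $i(G)$ (by $o(G)$); $I_0$ is the empty graph. For $t_{i,j}(G)$: let $e=\alpha^{-1}(i)$, $f=\beta^{-1}(j)$; remove $e$ and $f$ and add one new edge $g$: if $e\in I(G),f\in O(G)$, $g$ is internal with source $s(f)$ and target $t(e)$; if $e\in IO(G),f\in O(G)$, $g$ is an output edge with source $s(f)$ and output label $\beta(e)$; if $e\in I(G),f\in IO(G)$, $g$ is an input edge with target $t(e)$ and input label $\alpha(f)$; if $e\ne f$ are both in $IO(G)$, $g$ is an input-output edge with input label $\alpha(f)$ and output label $\beta(e)$; if $e=f\in IO(G)$, $g$ is a loop. Then all input labels $>i$ and output labels $>j$ are decreased by $1$; $g$ takes the position of $f$ among outgoing edges of $s(f)$ and of $e$ among incoming edges of $t(e)$. With this, $\mathrm{CGr}(X)$ is a unitary TRAP with unit the vertexless graph $I$ with a single input-output edge, and $\mathrm{solCGr}(X)$ is a sub-TRAP. The TRAP $\mathrm{uPGr}(P)$. For a TRAP $P$ and $p\in P(k,l)$, $\iota(p)$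 is the graph with one vertex decorated by $p$, with $k$ input edges and $l$ output edges ordered at the vertex according to their indices. $\Phi:\mathrm{solCGr}(P)\to P$ is the unique TRAP morphism with $\Phi(\iota(p))=p$ for all $p\in P$. The solar part $\mathrm{sol}(G)$ of $G\in\mathrm{CGr}(P)$ is obtained by deleting all loops and input-output edges and relabelling the remaining inputs, and the remaining outputs, by consecutive integers in the order-preserving way. For $G,G'\in\mathrm{CGr}(P)(k,l)$, $G\sim G'$ if and only if $\Phi(\mathrm{sol}(G))=\Phi(\mathrm{sol}(G'))$ (in particular the solar parts have the same numbers of inputs and outputs), $G$ and $G'$ have the same set of pairs $(\alpha(e),\beta(e))$, $e\in IO$, and the same number of loops. $\mathrm{uPGr}(P)=\mathrm{CGr}(P)/\sim$ with the induced unitary TRAP structure, and $\iota':P\to\mathrm{uPGr}(P)$ sends $p$ to the class of $\iota(p)$; it is an injective TRAP morphism through which $P$ is identified with a sub-TRAP of $\mathrm{uPGr}(P)$. *)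

(* Defs.v *)
(* The sets [k] are the ordinals 'I_k, so every index is one less
   than in the 1-based notation.  MathComp's product of permutations is
   (s * t) x = t (s x); the composition "s after t" is written pcomp s t. *)
From mathcomp Require Import all_boot all_fingroup.
From mathcomp Require Import boolp zify.

Set Implicit Arguments.
Unset Strict Implicit.
Unset Printing Implicit Defensive.

Definition sum_map (A A' B B' : Type) (f : A -> A') (g : B -> B')
    (x : A + B) : A' + B' :=
  match x with inl a => inl (f a) | inr b => inr (g b) end.

Lemma sum_map_bij (A A' B B' : Type) (f : A -> A') (g : B -> B') :
  bijective f -> bijective g -> bijective (sum_map f g).
Proof.
move=> [f' fK f'K] [g' gK g'K]; exists (sum_map f' g') => -[x|x] /=;
  by rewrite ?fK ?gK ?f'K ?g'K.
Qed.

Lemma inj_surj_bij (A B : finType) (f : A -> B) :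
  injective f -> (forall y, exists x, f x = y) -> bijective f.
Proof.
move=> fI fS; have fC y : y \in codom f.
  by have [x <-] := fS y; apply: codom_f.
by exists (fun y => iinv (fC y)) => [x|y]; [apply: fI|]; rewrite f_iinv.
Qed.

Lemma bij_codom (A B : finType) (f : A -> B) :
  bijective f -> forall y, y \in codom f.
Proof. by move=> [g _ gK] y; rewrite -[y]gK; apply: codom_f. Qed.

Definition bij_inv (A B : finType) (f : A -> B) (fB : bijective f) (y : B) : A :=
  iinv (bij_codom fB y).

Lemma bij_invK (A B : finType) (f : A -> B) (fB : bijective f) (y : B) :
  f (bij_inv fB y) = y.
Proof. exact: f_iinv. Qed.

(* The labelling lab \o h, which avoids the label i, with all labels greater
   than i decreased by one: lab (h x) = lift i (relabel _ x). *)
Definition relabel (A A' : finType) n (lab : A -> 'I_n.+1) (i : 'I_n.+1)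
    (h : A' -> A) (avoid : forall x, i != lab (h x)) (x : A') : 'I_n :=
  s2val (unlift_some (avoid x)).

Lemma relabelE (A A' : finType) n (lab : A -> 'I_n.+1) i (h : A' -> A)
    (avoid : forall x, i != lab (h x)) (x : A') :
  lift i (relabel avoid x) = lab (h x).
Proof. by rewrite /relabel; case: unlift_some => y /= ->. Qed.

Lemma relabel_inj (A A' : finType) n (lab : A -> 'I_n.+1) i (h : A' -> A)
    (avoid : forall x, i != lab (h x)) :
  injective lab -> injective h -> injective (relabel avoid).
Proof.
by move=> labI hI x y /(congr1 (lift i)); rewrite !relabelE => /labI /hI.
Qed.

Lemma relabel_bij (A A' : finType) n (lab : A -> 'I_n.+1) i (h : A' -> A)
    (avoid : forall x, i != lab (h x)) :
  bijective lab -> injective h ->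
  (forall y, i != lab y -> exists x, h x = y) ->
  bijective (relabel avoid).
Proof.
move=> labB hI hS; apply: inj_surj_bij.
  by apply: relabel_inj => //; apply: bij_inj.
have [g labK gK] := labB => y.
have [|x hx] := hS (g (lift i y)); first by rewrite gK neq_lift.
by exists x; apply: (@lift_inj _ i); rewrite relabelE hx gK.
Qed.

Definition pcomp n (s t : 'S_n) : 'S_n := (t * s)%g.

Lemma perm_bij n (s : 'S_n) : bijective s.
Proof. exact: Bijective (permK s) (permKV s). Qed.

Lemma perm_del_avoid n (s : 'S_n.+1) (q : 'I_n.+1) (x : 'I_n) :
  q != s (lift (s^-1 q)%g x).
Proof.
by rewrite -(inj_eq (@perm_inj _ (s^-1)%g)) permK; apply: neq_lift.
Qed.

(* The word of s with the letter q (a value of s, at position s^-1 q) deleted. *)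
Definition perm_del n (s : 'S_n.+1) (q : 'I_n.+1) : 'S_n :=
  perm (relabel_inj (avoid := @perm_del_avoid n s q)
          (@perm_inj _ s) (@lift_inj _ _)).

Lemma unsplit_bij m n : bijective (@unsplit m n).
Proof. by exists (@split m n); [apply: unsplitK | apply: splitK]. Qed.

Lemma split_bij m n : bijective (@split m n).
Proof. by exists (@unsplit m n); [apply: splitK | apply: unsplitK]. Qed.

Definition ptensor_fun m n (s : 'S_m) (t : 'S_n) (x : 'I_(m + n)) : 'I_(m + n) :=
  unsplit (sum_map s t (split x)).

Lemma ptensor_inj m n (s : 'S_m) (t : 'S_n) : injective (ptensor_fun s t).
Proof.
exact: (bij_inj (bij_comp (@unsplit_bij m n)
         (bij_comp (sum_map_bij (perm_bij s) (perm_bij t)) (@split_bij m n)))).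
Qed.

Definition ptensor m n (s : 'S_m) (t : 'S_n) : 'S_(m + n) :=
  perm (@ptensor_inj m n s t).

Definition pswap_fun m n (x : 'I_(m + n)) : 'I_(m + n) :=
  cast_ord (addnC n m)
    match split x with inl i => rshift n i | inr i => lshift m i end.

Lemma pswap_inj m n : injective (@pswap_fun m n).
Proof.
move=> x y; rewrite /pswap_fun => /cast_ord_inj.
case: (splitP x) => i xi; case: (splitP y) => j yj.
- by move=> /rshift_inj ij; apply: ord_inj; rewrite xi yj ij.
- by move=> /eqP; rewrite eq_rlshift.
- by move=> /eqP; rewrite eq_lrshift.
- by move=> /lshift_inj ij; apply: ord_inj; rewrite xi yj ij.
Qed.

(* c_{m,n}: i |-> i + n on the first m letters, i |-> i - m on the last n. *)
Definition pswap m n : 'S_(m + n) := perm (@pswap_inj m n).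

Definition pcyc_fun n (a b : nat) (x : 'I_n) : nat :=
  if a <= b < n then
    if x == b :> nat then a else if a <= x < b then x.+1 else x
  else x.

Lemma pcyc_lt n a b (x : 'I_n) : pcyc_fun a b x < n.
Proof. by rewrite /pcyc_fun; have := ltn_ord x; do !case: ifP; lia. Qed.

Lemma pcyc_inj n a b : injective (fun x : 'I_n => Ordinal (pcyc_lt a b x)).
Proof.
move=> x y /(congr1 val) /=; rewrite /pcyc_fun => E; apply: ord_inj.
by move: E; do !case: ifP; lia.
Qed.

(* The cycle (a, a + 1, ..., b) of 0-based letters, a <= b < n; the identity if
   these inequalities fail. *)
Definition pcyc n (a b : nat) : 'S_n := perm (@pcyc_inj n a b).

Record trap_ops := TrapOps {
  tcar :> nat -> nat -> Type;
  lact : forall k l, 'S_l -> tcar k l -> tcar k l;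
  ract : forall k l, tcar k l -> 'S_k -> tcar k l;
  hunit : tcar 0 0;
  hcat : forall k l k' l', tcar k l -> tcar k' l' -> tcar (k + k') (l + l');
  ptr : forall k l, 'I_k.+1 -> 'I_l.+1 -> tcar k.+1 l.+1 -> tcar k l
}.
Arguments lact {t k l}.
Arguments ract {t k l}.
Arguments hunit {t}.
Arguments hcat {t k l k' l'}.
Arguments ptr {t k l}.

Definition tcast (P : nat -> nat -> Type) k k' l l' (ek : k = k') (el : l = l')
    (p : P k l) : P k' l' :=
  match ek in _ = m, el in _ = n return P m n with erefl, erefl => p end.

Record bimodule_axioms (P : trap_ops) : Prop := {
  lact1 : forall k l (p : P k l), lact 1%g p = p;
  lactM : forall k l (s t : 'S_l) (p : P k l),
    lact (pcomp s t) p = lact s (lact t p);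
  ract1 : forall k l (p : P k l), ract p 1%g = p;
  ractM : forall k l (p : P k l) (s t : 'S_k),
    ract p (pcomp s t) = ract (ract p s) t;
  lractA : forall k l (s : 'S_l) (p : P k l) (t : 'S_k),
    lact s (ract p t) = ract (lact s p) t
}.

Record hcat_axioms (P : trap_ops) : Prop := {
  hcatA : forall k l k' l' k'' l''
      (p : P k l) (p' : P k' l') (p'' : P k'' l''),
    hcat p (hcat p' p'')
    = tcast (esym (addnA k k' k'')) (esym (addnA l l' l''))
        (hcat (hcat p p') p'');
  hcat1p : forall k l (p : P k l), hcat hunit p = p;
  hcatp1 : forall k l (p : P k l),
    tcast (addn0 k) (addn0 l) (hcat p hunit) = p;
  hcat_act : forall k l k' l' (s : 'S_l) (p : P k l) (t : 'S_k)
      (s' : 'S_l') (p' : P k' l') (t' : 'S_k'),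
    hcat (lact s (ract p t)) (lact s' (ract p' t'))
    = lact (ptensor s s') (ract (hcat p p') (ptensor t t'));
  hcatC : forall k l k' l' (p : P k l) (p' : P k' l'),
    lact (pswap l l') (hcat p p')
    = ract (tcast (addnC k' k) (addnC l' l) (hcat p' p)) (pswap k k')
}.

Record ptr_axioms (P : trap_ops) : Prop := {
  ptr_ptr_lt_lt : forall k l (i : 'I_k.+2) (j : 'I_l.+2) (i' : 'I_k.+1)
      (j' : 'I_l.+1) (p : P k.+2 l.+2), i' < i -> j' < j ->
    ptr i' j' (ptr i j p)
    = ptr (inord i.-1) (inord j.-1) (ptr (inord i') (inord j') p);
  ptr_ptr_ge_lt : forall k l (i : 'I_k.+2) (j : 'I_l.+2) (i' : 'I_k.+1)
      (j' : 'I_l.+1) (p : P k.+2 l.+2), i <= i' -> j' < j ->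
    ptr i' j' (ptr i j p)
    = ptr (inord i) (inord j.-1) (ptr (inord i'.+1) (inord j') p);
  ptr_ptr_lt_ge : forall k l (i : 'I_k.+2) (j : 'I_l.+2) (i' : 'I_k.+1)
      (j' : 'I_l.+1) (p : P k.+2 l.+2), i' < i -> j <= j' ->
    ptr i' j' (ptr i j p)
    = ptr (inord i.-1) (inord j) (ptr (inord i') (inord j'.+1) p);
  ptr_ptr_ge_ge : forall k l (i : 'I_k.+2) (j : 'I_l.+2) (i' : 'I_k.+1)
      (j' : 'I_l.+1) (p : P k.+2 l.+2), i <= i' -> j <= j' ->
    ptr i' j' (ptr i j p)
    = ptr (inord i) (inord j) (ptr (inord i'.+1) (inord j'.+1) p);
  ptr_act : forall k l (i : 'I_k.+1) (j : 'I_l.+1) (s : 'S_l.+1)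
      (p : P k.+1 l.+1) (t : 'S_k.+1),
    ptr i j (lact s (ract p t))
    = lact (perm_del s j)
        (ract (ptr (t i) ((s^-1)%g j) p) (perm_del t (t i)));
  ptr_hcatl : forall k l k' l' (i : 'I_k.+1) (j : 'I_l.+1)
      (p : P k.+1 l.+1) (p' : P k' l'),
    ptr (lshift k' i : 'I_(k + k').+1) (lshift l' j : 'I_(l + l').+1) (hcat p p')
    = hcat (ptr i j p) p';
  ptr_hcatr : forall k l k' l' (i : 'I_k'.+1) (j : 'I_l'.+1)
      (p : P k l) (p' : P k'.+1 l'.+1),
    ptr (cast_ord (addnS k k') (rshift k i)) (cast_ord (addnS l l') (rshift l j))
      (tcast (addnS k k') (addnS l l') (hcat p p'))
    = hcat p (ptr i j p')
}.

Record trap_axioms (P : trap_ops) : Prop := {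
  trap_bimodule : bimodule_axioms P;
  trap_hcat : hcat_axioms P;
  trap_ptr : ptr_axioms P
}.

Record trap := Trap { trap_str :> trap_ops; trap_ax : trap_axioms trap_str }.

Record utrap_ops := UTrapOps { utrap_base :> trap_ops; tunit : utrap_base 1 1 }.
Arguments tunit {u}.

(* With 0-based indices, t_{1,j}(I * p) = (1, ..., j - 1) . p becomes
   ptr 0 j (I * p) = pcyc 0 (j - 1) . p, and similarly for the other three. *)
Record unit_axioms (P : utrap_ops) : Prop := {
  ptr_unitl_out : forall k l (p : P k l) (j : 'I_l.+1), 0 < j ->
    ptr (ord0 : 'I_k.+1) j (hcat tunit p) = lact (pcyc l 0 j.-1) p;
  ptr_unitl_in : forall k l (p : P k l) (i : 'I_k.+1), 0 < i ->
    ptr i (ord0 : 'I_l.+1) (hcat tunit p) = ract p (pcyc k 0 i.-1)^-1%g;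
  ptr_unitr_out : forall k l (p : P k l) (j : 'I_l.+1), j < l ->
    ptr (ord_max : 'I_k.+1) j (tcast (addn1 k) (addn1 l) (hcat p tunit))
    = lact (pcyc l j l.-1)^-1%g p;
  ptr_unitr_in : forall k l (p : P k l) (i : 'I_k.+1), i < k ->
    ptr i (ord_max : 'I_l.+1) (tcast (addn1 k) (addn1 l) (hcat p tunit))
    = ract p (pcyc k i k.-1)
}.

Record utrap := UTrap {
  utrap_str :> utrap_ops;
  utrap_ax : trap_axioms utrap_str;
  utrap_unit : unit_axioms utrap_str
}.

Record trap_morphism (P Q : trap_ops) (f : forall k l, P k l -> Q k l) : Prop := {
  morph_lact : forall k l (s : 'S_l) (p : P k l),
    f k l (lact s p) = lact s (f k l p);
  morph_ract : forall k l (p : P k l) (t : 'S_k),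
    f k l (ract p t) = ract (f k l p) t;
  morph_hunit : f 0 0 hunit = hunit;
  morph_hcat : forall k l k' l' (p : P k l) (p' : P k' l'),
    f (k + k') (l + l') (hcat p p') = hcat (f k l p) (f k' l' p');
  morph_ptr : forall k l (i : 'I_k.+1) (j : 'I_l.+1) (p : P k.+1 l.+1),
    f k l (ptr i j p) = ptr i j (f k.+1 l.+1 p)
}.

Record utrap_morphism (P Q : utrap_ops) (f : forall k l, P k l -> Q k l) : Prop := {
  utrap_morph : trap_morphism f;
  morph_tunit : f 1 1 tunit = tunit
}.

(* The incoming edges of a vertex v form a totally ordered set with ain v
   elements, i.e. a set in bijection with 'I_(ain v).  The target map and the
   orders on its fibres are thus encoded together as a bijection tgt from the
   internal and input edges onto the incoming ports {v : V & 'I_(ain v)}: the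
   first component is the target, the second one the position among the
   incoming edges of that vertex.  Likewise for src, the internal and output
   edges, and the outgoing ports.  The bijectivity of the labellings ilab
   (alpha) and olab (beta) forces k = |I| + |IO| and l = |O| + |IO|. *)
Record graph (X : nat -> nat -> Type) (k l : nat) := Graph {
  gV : finType;
  gE : finType;
  gI : finType;
  gO : finType;
  gIO : finType;
  gL : finType;
  ain : gV -> nat;
  aout : gV -> nat;
  dec : forall v, X (ain v) (aout v);
  tgt : gE + gI -> {v : gV & 'I_(ain v)};
  src : gE + gO -> {v : gV & 'I_(aout v)};
  ilab : gI + gIO -> 'I_k;
  olab : gO + gIO -> 'I_l;
  tgt_bij : bijective tgt;
  src_bij : bijective src;
  ilab_bij : bijective ilab;
  olab_bij : bijective olab
}.
Arguments Graph {X k l gV gE gI gO gIO} gL {ain aout} dec tgt src ilab olab.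
Arguments gV {X k l}.
Arguments gE {X k l}.
Arguments gI {X k l}.
Arguments gO {X k l}.
Arguments gIO {X k l}.
Arguments gL {X k l}.
Arguments ain {X k l}.
Arguments aout {X k l}.
Arguments dec {X k l}.
Arguments tgt {X k l}.
Arguments src {X k l}.
Arguments ilab {X k l}.
Arguments olab {X k l}.
Arguments tgt_bij {X k l}.
Arguments src_bij {X k l}.
Arguments ilab_bij {X k l}.
Arguments olab_bij {X k l}.

Definition tdec X k l (G : graph X k l) (v : gV G) : {a : nat * nat & X a.1 a.2} :=
  existT (fun a => X a.1 a.2) (ain G v, aout G v) (dec G v).

Definition port (V : Type) (a : V -> nat) (x : {v : V & 'I_(a v)}) : V * nat :=
  (tag x, nat_of_ord (tagged x)).

Record graph_iso X k l (G H : graph X k l) := GraphIso {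
  isoV : gV G -> gV H;
  isoE : gE G -> gE H;
  isoI : gI G -> gI H;
  isoO : gO G -> gO H;
  isoIO : gIO G -> gIO H;
  isoL : gL G -> gL H;
  isoV_bij : bijective isoV;
  isoE_bij : bijective isoE;
  isoI_bij : bijective isoI;
  isoO_bij : bijective isoO;
  isoIO_bij : bijective isoIO;
  isoL_bij : bijective isoL;
  iso_dec : forall v, tdec (isoV v) = tdec v;
  iso_tgt : forall x, port (tgt H (sum_map isoE isoI x))
                      = (isoV (port (tgt G x)).1, (port (tgt G x)).2);
  iso_src : forall x, port (src H (sum_map isoE isoO x))
                      = (isoV (port (src G x)).1, (port (src G x)).2);
  iso_ilab : forall x, ilab H (sum_map isoI isoIO x) = ilab G x;
  iso_olab : forall x, olab H (sum_map isoO isoIO x) = olab G x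
}.

Definition isomorphic X k l (G H : graph X k l) : Prop := inhabited (graph_iso G H).

Lemma isomorphic_refl X k l (G : graph X k l) : isomorphic G G.
Proof.
have idB T : bijective (@id T) by exists id.
have sid A B (x : A + B) : sum_map id id x = x by case: x.
by split; apply: (GraphIso (isoV := id) (isoE := id) (isoI := id) (isoO := id)
  (isoIO := id) (isoL := id)) => // x; rewrite sid //; case: port.
Qed.

(* The quotients of mathcomp.boot.generic_quotient do not apply: a type of
   graphs quantifies over finTypes, and is too large to be a choiceType. *)
Definition quot (T : Type) (R : T -> T -> Prop) : Type :=
  {A : T -> Prop | exists x, A = R x}.

Definition cls T (R : T -> T -> Prop) (x : T) : quot R :=
  exist _ (R x) (ex_intro _ x erefl).

Definition rep T (R : T -> T -> Prop) (a : quot R) : T := sval (cid (svalP a)).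

Lemma repK T (R : T -> T -> Prop) (a : quot R) : cls R (rep a) = a.
Proof. by case: a => A h; apply: eq_exist; rewrite /rep; case: cid => x /= ->. Qed.

Lemma rep_cls T (R : T -> T -> Prop) (x : T) : (forall y, R y y) -> R x (rep (cls R x)).
Proof. by move=> Rr; have /(congr1 sval) /= <- := repK (cls R x). Qed.

Definition glact X k l (s : 'S_l) (G : graph X k l) : graph X k l :=
  Graph (gL G) (dec G) (tgt G) (src G) (ilab G) (s \o olab G)
    (tgt_bij G) (src_bij G) (ilab_bij G) (bij_comp (perm_bij s) (olab_bij G)).

Definition gract X k l (G : graph X k l) (s : 'S_k) : graph X k l :=
  Graph (gL G) (dec G) (tgt G) (src G) ((s^-1)%g \o ilab G) (olab G)
    (tgt_bij G) (src_bij G) (bij_comp (perm_bij s^-1) (ilab_bij G)) (olab_bij G).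

Lemma void_bij (T : Type) (f : void + void -> T) : (T -> False) -> bijective f.
Proof. by move=> T0; exists (fun x => False_rect _ (T0 x)) => [[]|x] //; case: (T0 x). Qed.

Lemma ord0_false : 'I_0 -> False.
Proof. by case. Qed.

Lemma void_port_false (a : void -> nat) : {v : void & 'I_(a v)} -> False.
Proof. by case. Qed.

Definition void_map T (x : void + void) : T :=
  match x with inl y | inr y => match y with end end.

Definition gempty X : graph X 0 0 :=
  @Graph X 0 0 void void void void void void
    (fun _ => 0) (fun _ => 0) (fun v => match v with end)
    (@void_map _) (@void_map _) (@void_map _) (@void_map _)
    (void_bij _ (@void_port_false _)) (void_bij _ (@void_port_false _))
    (void_bij _ ord0_false) (void_bij _ ord0_false).

Definition unit_lab (x : void + unit) : 'I_1 := ord0.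

Lemma unit_lab_bij : bijective unit_lab.
Proof. by exists (fun _ => inr tt) => [[|[]]|x] //; rewrite [x]ord1. Qed.

Definition gunit X : graph X 1 1 :=
  @Graph X 1 1 void void void void unit void
    (fun _ => 0) (fun _ => 0) (fun v => match v with end)
    (@void_map _) (@void_map _) unit_lab unit_lab
    (void_bij _ (@void_port_false _)) (void_bij _ (@void_port_false _))
    unit_lab_bij unit_lab_bij.

Section DisjointUnion.

Definition sum_fun (V V' : Type) T (a : V -> T) (a' : V' -> T) (v : V + V') : T :=
  match v with inl v => a v | inr v => a' v end.

Definition swap_sum (A B A' B' : Type) (x : (A + A') + (B + B')) :
    (A + B) + (A' + B') :=
  match x with
  | inl (inl a) => inl (inl a)
  | inl (inr a) => inr (inl a)
  | inr (inl b) => inl (inr b)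
  | inr (inr b) => inr (inr b)
  end.

Lemma swap_sum_bij A B A' B' : bijective (@swap_sum A B A' B').
Proof. by exists (@swap_sum A A' B B') => -[[]|[]]. Qed.

Definition sum_port (V V' : Type) (a : V -> nat) (a' : V' -> nat)
    (x : {v : V & 'I_(a v)} + {v : V' & 'I_(a' v)}) :
    {v : V + V' & 'I_(sum_fun a a' v)} :=
  match x with
  | inl y => existT (fun v => 'I_(sum_fun a a' v)) (inl (tag y)) (tagged y)
  | inr y => existT (fun v => 'I_(sum_fun a a' v)) (inr (tag y)) (tagged y)
  end.

Lemma sum_port_bij V V' a a' : bijective (@sum_port V V' a a').
Proof.
exists (fun x : {v : V + V' & 'I_(sum_fun a a' v)} =>
  match x with
  | existT (inl v) p => inl (existT (fun v => 'I_(a v)) v p)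
  | existT (inr v) p => inr (existT (fun v => 'I_(a' v)) v p)
  end) => [[[v p]|[v p]]|[[v|v] p]] //.
Qed.

Variables (X : nat -> nat -> Type) (k l k' l' : nat).
Variables (G : graph X k l) (H : graph X k' l').

Definition disj_dec (v : gV G + gV H) :
    X (sum_fun (ain G) (ain H) v) (sum_fun (aout G) (aout H) v) :=
  match v with inl v => dec G v | inr v => dec H v end.

Definition disj_union : graph X (k + k') (l + l') :=
  @Graph X (k + k') (l + l')
    (gV G + gV H)%type (gE G + gE H)%type (gI G + gI H)%type (gO G + gO H)%type
    (gIO G + gIO H)%type (gL G + gL H)%type
    (sum_fun (ain G) (ain H)) (sum_fun (aout G) (aout H)) disj_dec
    (@sum_port _ _ _ _ \o (sum_map (tgt G) (tgt H) \o @swap_sum _ _ _ _))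
    (@sum_port _ _ _ _ \o (sum_map (src G) (src H) \o @swap_sum _ _ _ _))
    (@unsplit k k' \o (sum_map (ilab G) (ilab H) \o @swap_sum _ _ _ _))
    (@unsplit l l' \o (sum_map (olab G) (olab H) \o @swap_sum _ _ _ _))
    (bij_comp (@sum_port_bij _ _ _ _)
      (bij_comp (sum_map_bij (tgt_bij G) (tgt_bij H)) (@swap_sum_bij _ _ _ _)))
    (bij_comp (@sum_port_bij _ _ _ _)
      (bij_comp (sum_map_bij (src_bij G) (src_bij H)) (@swap_sum_bij _ _ _ _)))
    (bij_comp (@unsplit_bij _ _)
      (bij_comp (sum_map_bij (ilab_bij G) (ilab_bij H)) (@swap_sum_bij _ _ _ _)))
    (bij_comp (@unsplit_bij _ _)
      (bij_comp (sum_map_bij (olab_bij G) (olab_bij H)) (@swap_sum_bij _ _ _ _))).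

End DisjointUnion.

Section PartialTrace.

Definition drop_l (A : eqType) (B : Type) (a : A)
    (x : {x : A | x != a} + B) : A + B := sum_map val id x.

Definition drop_r (A : Type) (B : eqType) (b : B)
    (x : A + {x : B | x != b}) : A + B := sum_map id val x.

Definition absorb (A : Type) (B : eqType) (b : B)
    (x : option A + {x : B | x != b}) : A + B :=
  match x with
  | inl None => inr b
  | inl (Some a) => inl a
  | inr y => inr (val y)
  end.

Definition redirect (A : eqType) (y z x : A) : A := if x == y then z else x.

Lemma drop_l_inj A B a : injective (@drop_l A B a).
Proof. by move=> [x|x] [y|y] //= [] => [/val_inj|] ->. Qed.

Lemma drop_r_inj A B b : injective (@drop_r A B b).
Proof. by move=> [x|x] [y|y] //= [] => [|/val_inj] ->. Qed.

Lemma drop_l_neq (A B : eqType) (a : A) (x : {x : A | x != a} + B) :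
  drop_l x != inl a.
Proof. by case: x => // x; exact: valP x. Qed.

Lemma drop_r_neq (A B : eqType) (b : B) (x : A + {x : B | x != b}) :
  drop_r x != inr b.
Proof. by case: x => // x; exact: valP x. Qed.

Lemma drop_l_surj (A B : eqType) (a : A) (y : A + B) :
  y != inl a -> exists x : {x : A | x != a} + B, drop_l x = y.
Proof. by case: y => [y ya|y _]; [exists (inl (exist _ y ya)) | exists (inr y)]. Qed.

Lemma drop_r_surj (A B : eqType) (b : B) (y : A + B) :
  y != inr b -> exists x : A + {x : B | x != b}, drop_r x = y.
Proof. by case: y => [y _|y yb]; [exists (inl y) | exists (inr (exist _ y yb))]. Qed.

Lemma absorb_bij (A B : finType) (b : B) : bijective (@absorb A B b).
Proof.
apply: inj_surj_bij => [[[x|]|x] [[y|]|y]|[y|y]] //=.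
- by move=> [->].
- by case=> e; case/eqP: (valP y).
- by case=> e; case/eqP: (valP x).
- by move=> [/val_inj ->].
- by exists (inl (Some y)).
- have [->|yb] := eqVneq y b; first by exists (inl None).
  by exists (inr (exist _ y yb)).
Qed.

Lemma inj_avoid (A B C : eqType) (lab : A -> B) (h : C -> A) y i :
  injective lab -> lab y = i -> (forall x, h x != y) -> forall x, i != lab (h x).
Proof. by move=> labI <- hy x; rewrite (inj_eq labI) eq_sym. Qed.

Lemma redirect_drop_neq (A B : eqType) (b : B) (y : A + B) :
  y != inr b -> forall x : A + {x : B | x != b},
  redirect y (inr b) (drop_r x) != y.
Proof. by move=> yb x; rewrite /redirect; case: ifPn => // _; rewrite eq_sym. Qed.

Lemma redirect_drop_inj (A B : eqType) (b : B) (y : A + B) :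
  injective (fun x : A + {x : B | x != b} => redirect y (inr b) (drop_r x)).
Proof.
move=> x x' /=; rewrite /redirect; have xb := drop_r_neq x; have x'b := drop_r_neq x'.
case: eqP => [xy|_]; case: eqP => [x'y|_] e; apply: drop_r_inj.
- by rewrite xy x'y.
- by rewrite -e eqxx in x'b.
- by rewrite e eqxx in xb.
- exact: e.
Qed.

Lemma redirect_drop_surj (A B : eqType) (b : B) (y z : A + B) :
  y != inr b -> z != y ->
  exists x : A + {x : B | x != b}, redirect y (inr b) (drop_r x) = z.
Proof.
move=> yb zy; have [->|zb] := eqVneq z (inr b).
  by have [x xy] := drop_r_surj yb; exists x; rewrite xy /redirect eqxx.
by have [x xz] := drop_r_surj zb; exists x; rewrite xz /redirect (negPf zy).
Qed.

Section RelabelAt.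
Variables (A A' : finType) (n : nat) (lab : A -> 'I_n.+1) (i : 'I_n.+1) (y : A).
Variables (labB : bijective lab) (laby : lab y = i).
Variables (h : A' -> A) (hy : forall x, h x != y).

Definition relabel_at : A' -> 'I_n :=
  relabel (inj_avoid (bij_inj labB) laby hy).

Lemma relabel_at_bij : injective h ->
  (forall z, z != y -> exists x, h x = z) -> bijective relabel_at.
Proof.
move=> hI hS; apply: relabel_bij => // z iz; apply: hS.
by apply: contraNneq iz => ->; rewrite laby.
Qed.
End RelabelAt.

Variables (X : nat -> nat -> Type) (k l : nat) (G : graph X k.+1 l.+1).
Variables (i : 'I_k.+1) (j : 'I_l.+1).

(* In the four cases below, the new edge g is represented as follows.
   - e input edge, f output edge: g is the new element None of option (gE G).
   - e input edge, f input-output edge: g is e, now with the input label of f.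
   - e input-output edge, f <> e output or input-output edge: g is f, now with
     the output label of e.
   - e = f input-output edge: g is the new element None of option (gL G). *)
Section InputOutput.
Variables (e : gI G) (f : gO G) (ei : ilab G (inl e) = i) (fj : olab G (inl f) = j).

Definition tr_input_output : graph X k l :=
  @Graph X k l (gV G) (option (gE G)) {x : gI G | x != e} {x : gO G | x != f}
    (gIO G) (gL G) (ain G) (aout G) (dec G)
    (tgt G \o @absorb _ _ e) (src G \o @absorb _ _ f)
    (relabel_at (ilab_bij G) ei (@drop_l_neq _ _ e))
    (relabel_at (olab_bij G) fj (@drop_l_neq _ _ f))
    (bij_comp (tgt_bij G) (@absorb_bij _ _ e))
    (bij_comp (src_bij G) (@absorb_bij _ _ f))
    (relabel_at_bij _ _ _ (@drop_l_inj _ _ e) (@drop_l_surj _ _ e))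
    (relabel_at_bij _ _ _ (@drop_l_inj _ _ f) (@drop_l_surj _ _ f)).
End InputOutput.

Section InputIO.
Variables (e : gI G) (f : gIO G) (ei : ilab G (inl e) = i) (fj : olab G (inr f) = j).

Definition tr_input_io : graph X k l :=
  @Graph X k l (gV G) (gE G) (gI G) (gO G) {x : gIO G | x != f} (gL G)
    (ain G) (aout G) (dec G) (tgt G) (src G)
    (relabel_at (ilab_bij G) ei
      (@redirect_drop_neq _ _ f (inl e) erefl))
    (relabel_at (olab_bij G) fj (@drop_r_neq _ _ f))
    (tgt_bij G) (src_bij G)
    (relabel_at_bij _ _ _ (@redirect_drop_inj _ _ f (inl e))
      (fun z => @redirect_drop_surj _ _ f (inl e) z erefl))
    (relabel_at_bij _ _ _ (@drop_r_inj _ _ f) (@drop_r_surj _ _ f)).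
End InputIO.

Section IOOther.
Variables (e : gIO G) (f : gO G + gIO G) (fe : f != inr e).
Variables (ei : ilab G (inr e) = i) (fj : olab G f = j).

Definition tr_io_other : graph X k l :=
  @Graph X k l (gV G) (gE G) (gI G) (gO G) {x : gIO G | x != e} (gL G)
    (ain G) (aout G) (dec G) (tgt G) (src G)
    (relabel_at (ilab_bij G) ei (@drop_r_neq _ _ e))
    (relabel_at (olab_bij G) fj (redirect_drop_neq fe))
    (tgt_bij G) (src_bij G)
    (relabel_at_bij _ _ _ (@drop_r_inj _ _ e) (@drop_r_surj _ _ e))
    (relabel_at_bij _ _ _ (@redirect_drop_inj _ _ e f)
      (fun z => @redirect_drop_surj _ _ e f z fe)).
End IOOther.

Section IOSame.
Variables (e : gIO G) (ei : ilab G (inr e) = i) (ej : olab G (inr e) = j).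

Definition tr_io_same : graph X k l :=
  @Graph X k l (gV G) (gE G) (gI G) (gO G) {x : gIO G | x != e} (option (gL G))
    (ain G) (aout G) (dec G) (tgt G) (src G)
    (relabel_at (ilab_bij G) ei (@drop_r_neq _ _ e))
    (relabel_at (olab_bij G) ej (@drop_r_neq _ _ e))
    (tgt_bij G) (src_bij G)
    (relabel_at_bij _ _ _ (@drop_r_inj _ _ e) (@drop_r_surj _ _ e))
    (relabel_at_bij _ _ _ (@drop_r_inj _ _ e) (@drop_r_surj _ _ e)).
End IOSame.

Definition gtr_at (e : gI G + gIO G) (f : gO G + gIO G) :
    ilab G e = i -> olab G f = j -> graph X k l :=
  match e, f return ilab G e = i -> olab G f = j -> graph X k l with
  | inl e, inl f => fun ei fj => tr_input_output ei fj
  | inl e, inr f => fun ei fj => tr_input_io ei fj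
  | inr e, f => fun ei fj =>
      match eqVneq f (inr e) with
      | EqNotNeq fe => tr_io_same ei (etrans (congr1 (olab G) (esym fe)) fj)
      | NeqNotEq fe => tr_io_other fe ei fj
      end
  end.

Definition gtr : graph X k l :=
  gtr_at (bij_invK (ilab_bij G) i) (bij_invK (olab_bij G) j).

End PartialTrace.

Definition solar X k l (G : graph X k l) : Prop :=
  (gIO G -> False) /\ (gL G -> False).

Definition CGr (X : nat -> nat -> Type) (k l : nat) : Type :=
  quot (@isomorphic X k l).

Definition gcls X k l (G : graph X k l) : CGr X k l := cls (@isomorphic X k l) G.

(* The operations are induced from graphs to isomorphism classes through
   representatives. *)
Definition CGr_trap (X : nat -> nat -> Type) : trap_ops := {|
  tcar := CGr X;
  lact k l s x := gcls (glact s (rep x));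
  ract k l x s := gcls (gract (rep x) s);
  hunit := gcls (gempty X);
  hcat k l k' l' x y := gcls (disj_union (rep x) (rep y));
  ptr k l i j x := gcls (gtr (rep x) i j)
|}.

Definition CGr_utrap (X : nat -> nat -> Type) : utrap_ops :=
  {| utrap_base := CGr_trap X; tunit := gcls (gunit X) |}.

Definition solar_cls X k l (x : CGr X k l) : Prop :=
  exists2 G, solar G & gcls G = x.

Lemma solar_rep X k l (x : CGr X k l) : solar_cls x -> solar (rep x).
Proof.
move=> [G [noIO noL] <-].
have [F] := rep_cls G (@isomorphic_refl X k l).
split=> e; [case: (isoIO_bij F) => f _ _ | case: (isoL_bij F) => f _ _].
  exact: noIO (f e).
exact: noL (f e).
Qed.

Lemma solar_lact X k l (s : 'S_l) (x : CGr_trap X k l) :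
  solar_cls x -> solar_cls (lact s x).
Proof. by move=> /solar_rep xs; exists (glact s (rep x)). Qed.

Lemma solar_ract X k l (x : CGr_trap X k l) (s : 'S_k) :
  solar_cls x -> solar_cls (ract x s).
Proof. by move=> /solar_rep xs; exists (gract (rep x) s). Qed.

Lemma solar_hunit X : solar_cls (hunit : CGr_trap X 0 0).
Proof. by exists (gempty X); first by split; case. Qed.

Lemma solar_hcat X k l k' l' (x : CGr_trap X k l) (y : CGr_trap X k' l') :
  solar_cls x -> solar_cls y -> solar_cls (hcat x y).
Proof.
move=> /solar_rep [x1 x2] /solar_rep [y1 y2].
by exists (disj_union (rep x) (rep y)) => //; split; case.
Qed.

Lemma solar_ptr X k l (i : 'I_k.+1) (j : 'I_l.+1) (x : CGr_trap X k.+1 l.+1) :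
  solar_cls x -> solar_cls (ptr i j x).
Proof.
move=> /solar_rep [x1 x2]; exists (gtr (rep x) i j) => //; rewrite /gtr.
move: (bij_inv (ilab_bij _) _) (bij_inv (olab_bij _) _) (bij_invK _ _) (bij_invK _ _).
by case=> [e|/x1//]; case=> [f|/x1//] ei fj.
Qed.

Definition solCGr_trap (X : nat -> nat -> Type) : trap_ops := {|
  tcar k l := {x : CGr_trap X k l | solar_cls x};
  lact k l s x := exist _ (lact s (sval x)) (solar_lact s (svalP x));
  ract k l x s := exist _ (ract (sval x) s) (solar_ract s (svalP x));
  hunit := exist _ hunit (solar_hunit X);
  hcat k l k' l' x y :=
    exist _ (hcat (sval x) (sval y)) (solar_hcat (svalP x) (svalP y));
  ptr k l i j x := exist _ (ptr i j (sval x)) (solar_ptr i j (svalP x))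
|}.

Definition corolla_port n (x : void + 'I_n) : {v : unit & 'I_n} :=
  match x with
  | inl y => match y with end
  | inr i => existT (fun _ : unit => 'I_n) tt i
  end.

Lemma corolla_port_bij n : bijective (@corolla_port n).
Proof. by exists (fun x : {v : unit & 'I_n} => inr (tagged x)) => [[[]|]|[[] i]]. Qed.

Definition corolla_lab n (x : 'I_n + void) : 'I_n :=
  match x with inl i => i | inr y => match y with end end.

Lemma corolla_lab_bij n : bijective (@corolla_lab n).
Proof. by exists inl => [[|[]]|]. Qed.

Definition iota_graph (X : nat -> nat -> Type) k l (p : X k l) : graph X k l :=
  @Graph X k l unit void 'I_k 'I_l void void
    (fun _ => k) (fun _ => l) (fun _ => p)
    (@corolla_port k) (@corolla_port l) (@corolla_lab k) (@corolla_lab l)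
    (@corolla_port_bij k) (@corolla_port_bij l)
    (@corolla_lab_bij k) (@corolla_lab_bij l).

Lemma solar_iota (X : nat -> nat -> Type) k l (p : X k l) :
  solar_cls (gcls (iota_graph p)).
Proof. by exists (iota_graph p). Qed.

Definition siota (X : nat -> nat -> Type) k l (p : X k l) : solCGr_trap X k l :=
  exist _ (gcls (iota_graph p)) (solar_iota p).

Section SolarPart.

Lemma rank_lt (A : finType) (f : A -> nat) (x : A) :
  #|[pred y | f y < f x]| < #|A|.
Proof.
by apply: proper_card; apply/properP; split; [apply/subsetP|exists x; rewrite ?inE ?ltnn].
Qed.

Definition rank (A : finType) (f : A -> nat) (x : A) : 'I_#|A| :=
  Ordinal (rank_lt f x).

Lemma rank_bij (A : finType) (f : A -> nat) : injective f -> bijective (rank f).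
Proof.
have lt_rank x y : f x < f y -> rank f x < rank f y.
  move=> xy; apply: proper_card; apply/properP; split.
    by apply/subsetP => z; rewrite !inE => zx; apply: ltn_trans xy.
  by exists x; rewrite !inE ?ltnn.
move=> fI; apply: inj_card_bij; last by rewrite card_ord.
move=> x y /(congr1 val) /= xy; apply: fI.
by case: (ltngtP (f x) (f y)) => // /lt_rank /=; rewrite xy ltnn.
Qed.

(* Order-preserving relabelling of A by consecutive integers. *)
Definition rank_lab (A : finType) (f : A -> nat) (x : A + void) : 'I_#|A| :=
  match x with inl a => rank f a | inr y => match y with end end.

Lemma rank_lab_bij (A : finType) (f : A -> nat) :
  injective f -> bijective (rank_lab f).
Proof.
by case/rank_bij => g fK gK; exists (inl \o g) => [[x|[]]|x] /=; rewrite ?fK ?gK.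
Qed.

Variables (X : nat -> nat -> Type) (k l : nat) (G : graph X k l).

Definition in_lab (x : gI G) : nat := ilab G (inl x).
Definition out_lab (x : gO G) : nat := olab G (inl x).

Lemma in_lab_inj : injective in_lab.
Proof. by move=> x y /ord_inj /(bij_inj (ilab_bij G)) []. Qed.

Lemma out_lab_inj : injective out_lab.
Proof. by move=> x y /ord_inj /(bij_inj (olab_bij G)) []. Qed.

Definition gsol : graph X #|gI G| #|gO G| :=
  @Graph X _ _ (gV G) (gE G) (gI G) (gO G) void void
    (ain G) (aout G) (dec G) (tgt G) (src G)
    (rank_lab in_lab) (rank_lab out_lab)
    (tgt_bij G) (src_bij G) (rank_lab_bij in_lab_inj) (rank_lab_bij out_lab_inj).

Lemma solar_gsol : solar_cls (gcls gsol).
Proof. by exists gsol. Qed.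

Definition gio_pairs : {set 'I_k * 'I_l} :=
  [set (ilab G (inr e), olab G (inr e)) | e : gIO G].

End SolarPart.

Definition sol_in X k l (x : CGr X k l) : nat := #|gI (rep x)|.
Definition sol_out X k l (x : CGr X k l) : nat := #|gO (rep x)|.

Definition sol X k l (x : CGr X k l) : solCGr_trap X (sol_in x) (sol_out x) :=
  exist _ (gcls (gsol (rep x))) (solar_gsol (rep x)).

Definition io_pairs X k l (x : CGr X k l) : {set 'I_k * 'I_l} := gio_pairs (rep x).

Definition nloops X k l (x : CGr X k l) : nat := #|gL (rep x)|.

Definition is_evaluation (P : trap)
    (Phi : forall k l, solCGr_trap P k l -> P k l) : Prop :=
  trap_morphism Phi /\ forall k l (p : P k l), Phi k l (siota p) = p.

(* Phi x, where Phi is the unique TRAP morphism from solCGr(P) to P with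
   Phi (iota p) = p for all p.  The option type only serves to write this
   description before the existence of Phi has been established: the value None
   is never taken. *)
Definition evaluation (P : trap) k l (x : solCGr_trap P k l) : option (P k l) :=
  match pselect (exists Phi, @is_evaluation P Phi) with
  | left exPhi => Some (sval (cid exPhi) k l x)
  | right _ => None
  end.

Definition tevaluation (P : trap) k l (x : solCGr_trap P k l) :
    {a : nat * nat & option (P a.1 a.2)} :=
  existT (fun a => option (P a.1 a.2)) (k, l) (evaluation x).

Definition same_pattern (P : trap) k l (x y : CGr P k l) : Prop :=
  [/\ tevaluation (sol x) = tevaluation (sol y),
      io_pairs x = io_pairs y & nloops x = nloops y].

Definition uPGr (P : trap) (k l : nat) : Type := quot (@same_pattern P k l).

Definition pcls (P : trap) k l (x : CGr_utrap P k l) : uPGr P k l :=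
  cls (@same_pattern P k l) x.

Definition prep (P : trap) k l (a : uPGr P k l) : CGr_utrap P k l := rep a.

Definition uPGr_trap (P : trap) : trap_ops := {|
  tcar := uPGr P;
  lact k l s a := pcls (lact s (prep a));
  ract k l a s := pcls (ract (prep a) s);
  hunit := pcls hunit;
  hcat k l k' l' a b := pcls (hcat (prep a) (prep b));
  ptr k l i j a := pcls (ptr i j (prep a))
|}.

Definition uPGr_utrap (P : trap) : utrap_ops :=
  {| utrap_base := uPGr_trap P; tunit := pcls tunit |}.

Definition iota' (P : trap) k l (p : P k l) : uPGr_utrap P k l :=
  pcls (gcls (iota_graph p)).

(* Main.v *)
Require Import Defs.
From mathcomp Require Import all_boot all_fingroup.
From HB Require Import structures.
From mathcomp Require Import boolp zify.
From Stdlib Require Import Eqdep_dec.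
Import Defs.

(** An element of P k l carries a fixed order of its inputs and outputs, whereas
    the vertices and edges of a graph come in no order.  So elements are
    considered together with a name for each input and each output, modulo
    simultaneous permutation of positions and names; the classes form the type
    [wiring P A B], where A and B are the types of names.  There the TRAP axioms
    become simpler: concatenation is a commutative monoid law [wmul] (the axiom
    on the permutations c makes it commutative), and tracing the output named b
    into the input named a is an operation [wtr a b].  Any two traces commute
    ([wtrC]), and a trace only concerns the factor in which its names occur
    ([wtr_mul]).  The TRAP itself embeds by using positions as names ([emb]).

    A graph is then evaluated without choosing any order: multiply the
    decorations of the vertices, each port bearing as its name the edge attached
    to it, and trace each internal edge ([core], [solW]).  On solar graphs this
    is compatible with the TRAP operations and gives the evaluation Phi
    ([phi_evaluation]).  It is the only one, because every solar graph arises from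
    corollas: cut its internal edges, then split off its vertices ([solar_ind],
    [evaluation_unique]).

    In a unitary TRAP, let moreover an input-output edge have as value the unit,
    and a loop the trace of the unit ([evW]).  The unit axioms say that a trace
    against the unit is a renaming ([wtr_unit_in], [wtr_unit_out]), and renaming
    is what a partial trace does to a graph at an input-output edge.  Hence the
    evaluation [ev theta] is a unitary TRAP morphism on CGr(P) ([evW_gtr]).

    It remains to see that the equivalence defining uPGr(P) is respected.  Let the
    pattern [pat G] consist of the value of the solar part of G under its original
    labels, the set of input-output edges, and the number of loops.  The order of
    the labels of the solar part is determined by the labels of the input-output
    edges, so two graphs are equivalent exactly when their patterns are equal
    ([same_patternP]).  As [ev theta G] depends on the pattern only ([ev_pat]), it
    induces the required morphism ([extension]).  Moreover the pattern of the
    result of an operation depends only on the patterns of the operands, so the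
    operations of uPGr(P) may be computed on arbitrary graphs ([up_glact], ...,
    [up_gtr]).  A solar graph has the pattern of a single corolla; splitting off
    units and traces of units, one obtains from corollas every class, which gives
    uniqueness ([extension_unique]). *)

Set Implicit Arguments.
Unset Strict Implicit.
Unset Printing Implicit Defensive.

(** * Elements with named inputs and outputs *)

Definition catf (A : Type) m n (f : 'I_m -> A) (g : 'I_n -> A) (i : 'I_(m + n)) : A :=
  sum_fun f g (split i).

Lemma catf_lshift (A : Type) m n (f : 'I_m -> A) (g : 'I_n -> A) i :
  catf f g (lshift n i) = f i.
Proof. by rewrite /catf (unsplitK (inl i)). Qed.

Lemma catf_rshift (A : Type) m n (f : 'I_m -> A) (g : 'I_n -> A) i :
  catf f g (rshift m i) = g i.
Proof. by rewrite /catf (unsplitK (inr i)). Qed.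

Lemma eq_catf (A : Type) m n (h : 'I_(m + n) -> A)
    (f : 'I_m -> A) (g : 'I_n -> A) :
  (forall i, h (lshift n i) = f i) -> (forall i, h (rshift m i) = g i) ->
  h = catf f g.
Proof.
by move=> hf hg; apply/funext => i; rewrite -[i]splitK /catf unsplitK; case: split.
Qed.

Section Occurrences.
Variable A : eqType.

Definition occ n (f : 'I_n -> A) (a : A) : nat := \sum_(i < n) (f i == a).

Lemma occ_perm n (f : 'I_n -> A) (s : 'S_n) a : occ (f \o s) a = occ f a.
Proof. by rewrite /occ [RHS](reindex_inj (@perm_inj _ s)). Qed.

Lemma occ_catf m n (f : 'I_m -> A) (g : 'I_n -> A) a :
  occ (catf f g) a = occ f a + occ g a.
Proof.
rewrite /occ big_split_ord /=; congr (_ + _); apply: eq_bigr => i _.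
  by rewrite catf_lshift.
by rewrite catf_rshift.
Qed.

Lemma occ_lift n (f : 'I_n.+1 -> A) i a :
  occ f a = (f i == a) + occ (f \o lift i) a.
Proof. by rewrite /occ (bigD1_ord i). Qed.

Lemma occ_gt0P n (f : 'I_n -> A) a : reflect (exists i, f i = a) (0 < occ f a).
Proof.
rewrite lt0n /occ sum_nat_eq0; apply: (iffP forallPn) => /= [[i]|[i <-]].
  by rewrite eqb0 negbK => /eqP; exists i.
by exists i; rewrite eqxx.
Qed.

Lemma occ1_inj n (f : 'I_n -> A) i i' : occ f (f i) = 1 -> f i' = f i -> i' = i.
Proof.
case: n f i i' => [|n] f i i'; first by case: i.
rewrite (occ_lift _ i) eqxx add1n => -[occ0] fi.
case: (unliftP i i') => [x def_i'|//].
suff : 0 < occ (f \o lift i) (f i) by rewrite occ0.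
by apply/occ_gt0P; exists x => /=; rewrite -def_i'.
Qed.

End Occurrences.

Lemma comp_catf (A B : Type) m n (f : 'I_m -> A) (g : 'I_n -> A) (h : A -> B) :
  h \o catf f g = catf (h \o f) (h \o g).
Proof. by apply: eq_catf => i /=; rewrite ?catf_lshift ?catf_rshift. Qed.

Lemma ptensor_lshift m n (s : 'S_m) (t : 'S_n) i :
  ptensor s t (lshift n i) = lshift n (s i).
Proof. by rewrite permE /ptensor_fun (unsplitK (inl i)). Qed.

Lemma ptensor_rshift m n (s : 'S_m) (t : 'S_n) i :
  ptensor s t (rshift m i) = rshift m (t i).
Proof. by rewrite permE /ptensor_fun (unsplitK (inr i)). Qed.

Lemma catf_perm (A : Type) m n (f : 'I_m -> A) (g : 'I_n -> A) (s : 'S_m) (t : 'S_n) :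
  catf f g \o ptensor s t = catf (f \o s) (g \o t).
Proof.
apply: eq_catf => i /=; first by rewrite ptensor_lshift catf_lshift.
by rewrite ptensor_rshift catf_rshift.
Qed.

Lemma ptensorV m n (s : 'S_m) (t : 'S_n) : ((ptensor s t)^-1 = ptensor s^-1 t^-1)%g.
Proof.
apply/permP => i; apply: (@perm_inj _ (ptensor s t)); rewrite permKV.
rewrite -[i]splitK; case: (split i) => j /=.
  by rewrite !ptensor_lshift permKV.
by rewrite !ptensor_rshift permKV.
Qed.

Section Named.
Variable P : trap.

Let bim := trap_bimodule (trap_ax P).
Let hax := trap_hcat (trap_ax P).

(** Names may repeat: this keeps renaming and concatenation total; only the
    trace asks for names that occur once. *)
Record named (A B : Type) := Named {
  nk : nat;
  nl : nat;
  nval : P nk nl;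
  nin : 'I_nk -> A;
  nout : 'I_nl -> B
}.
Arguments nin {A B} n _.
Arguments nout {A B} n _.

(** The input i of [ract p t] is the input t i of p, and the output j of [lact s p]
    is the output s^-1 j of p; names follow their input or output. *)
Definition nact A B (x : named A B) (s : 'S_(nl x)) (t : 'S_(nk x)) : named A B :=
  Named (lact s (ract (nval x) t)) (nin x \o t) (nout x \o (s^-1)%g).
Arguments nact {A B} x s t.

Definition nequiv A B (x y : named A B) : Prop := exists s t, y = nact x s t.

Lemma nact1 A B (x : named A B) : nact x 1%g 1%g = x.
Proof.
case: x => k l p f g; rewrite /nact /= invg1.
by rewrite (lact1 bim) (ract1 bim); congr Named; apply/funext => i /=; rewrite perm1.
Qed.

Lemma nequiv_refl A B (x : named A B) : nequiv x x.
Proof. by exists 1%g, 1%g; rewrite nact1. Qed.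

Lemma nact_nact A B (x : named A B) (s s' : 'S_(nl x)) (t t' : 'S_(nk x)) :
  nact (nact x s t) s' t' = nact x (pcomp s' s) (pcomp t t').
Proof.
rewrite /nact /= (lactM bim) (ractM bim) -!(lractA bim); congr Named.
  by apply/funext => i /=; rewrite permM.
by apply/funext => i /=; rewrite invMg permM.
Qed.

Lemma nequiv_sym A B (x y : named A B) : nequiv x y -> nequiv y x.
Proof.
move=> [s [t ->]]; exists (s^-1)%g, (t^-1)%g.
by rewrite nact_nact /pcomp mulgV mulVg nact1.
Qed.

Lemma nequiv_trans A B (x y z : named A B) : nequiv x y -> nequiv y z -> nequiv x z.
Proof.
move=> [s [t ->]] [s' [t' ->]]; rewrite nact_nact.
by exists (pcomp s' s), (pcomp t t').
Qed.

(** Coinvariants of the symmetric groups: elements with named inputs and outputs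
    whose positions are forgotten. *)
Definition wiring (A B : Type) : Type := quot (@nequiv A B).

Definition wcls A B (x : named A B) : wiring A B := cls (@nequiv A B) x.

Definition wof A B k l (p : P k l) (f : 'I_k -> A) (g : 'I_l -> B) : wiring A B :=
  wcls (Named p f g).

Lemma eq_wcls A B (x y : named A B) : nequiv x y -> wcls x = wcls y.
Proof.
move=> xy; apply: eq_exist; apply/funext => z; apply/propext.
by split; apply: nequiv_trans => //; apply: nequiv_sym.
Qed.

Lemma wcls_inj A B (x y : named A B) : wcls x = wcls y -> nequiv x y.
Proof. by move=> /(congr1 sval) /= ->; apply: nequiv_refl. Qed.

Lemma rep_wcls A B (x : named A B) : nequiv x (rep (wcls x)).
Proof. by apply: rep_cls => y; apply: nequiv_refl. Qed.

Lemma wofP A B (w : wiring A B) : exists k l (p : P k l) f g, w = wof p f g.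
Proof.
rewrite -[w]repK; case: (rep w) => k l p f g.
by exists k, l, p, f, g.
Qed.

Lemma wof_act A B k l (s : 'S_l) (p : P k l) (t : 'S_k) (f : 'I_k -> A) (g : 'I_l -> B) :
  wof (lact s (ract p t)) (f \o t) g = wof p f (g \o s).
Proof.
symmetry; apply: eq_wcls; exists s, t; rewrite /nact /=; congr Named.
by apply/funext => i /=; rewrite permKV.
Qed.

Lemma wof_lact A B k l (s : 'S_l) (p : P k l) (f : 'I_k -> A) (g : 'I_l -> B) :
  wof (lact s p) f g = wof p f (g \o s).
Proof.
rewrite -(wof_act s p 1%g) (ract1 bim); congr wof.
by apply/funext => i /=; rewrite perm1.
Qed.

Lemma wof_ract A B k l (p : P k l) (t : 'S_k) (f : 'I_k -> A) (g : 'I_l -> B) :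
  wof (ract p t) (f \o t) g = wof p f g.
Proof.
rewrite -[ract p t](lact1 bim) wof_act; congr wof.
by apply/funext => i /=; rewrite perm1.
Qed.

Lemma wof_tcast A B k l k' l' (ek : k = k') (el : l = l') (p : P k l)
    (f : 'I_k' -> A) (g : 'I_l' -> B) :
  wof (tcast ek el p) f g = wof p (f \o cast_ord ek) (g \o cast_ord el).
Proof.
by case: k' / ek f; case: l' / el g => f g /=; congr wof; apply/funext => i /=;
  rewrite cast_ord_id.
Qed.

(** The indices are natural numbers, whose equality is decidable; hence equal records have
    equal components without any axiom on proofs of equality. *)
Lemma Named_inj A B k l (p p' : P k l) (f f' : 'I_k -> A) (g g' : 'I_l -> B) :
  Named p f g = Named p' f' g' -> [/\ p = p', f = f' & g = g'].
Proof.
have natdec (x y : nat) : {x = y} + {x <> y} by case: (eqVneq x y) => [|/eqP]; [left|right].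
case=> e1 e2 e3; split; last 2 first.
- exact: (inj_pair2_eq_dec _ natdec _ _ _ _ e2).
- exact: (inj_pair2_eq_dec _ natdec _ _ _ _ e3).
exact: (inj_pair2_eq_dec _ natdec _ _ _ _ (inj_pair2_eq_dec _ natdec _ _ _ _ e1)).
Qed.

Lemma wof_inj A B k l (p p' : P k l) (f f' : 'I_k -> A) (g g' : 'I_l -> B) :
  wof p f g = wof p' f' g' ->
  exists s t, [/\ p' = lact s (ract p t), f' = f \o t & g' = g \o (s^-1)%g].
Proof. by move=> /wcls_inj [s [t /Named_inj[]]]; exists s, t. Qed.

Lemma wof_dim A B k l (p : P k l) k' l' (p' : P k' l') (f : 'I_k -> A) f' (g : 'I_l -> B) g' :
  wof p f g = wof p' f' g' -> k = k' /\ l = l'.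
Proof.
move=> /wcls_inj [s [t E]]; split.
  by have := congr1 (@nk A B) E.
by have := congr1 (@nl A B) E.
Qed.

Definition nren A B A' B' (h : A -> A') (h' : B -> B') (x : named A B) : named A' B' :=
  Named (nval x) (h \o nin x) (h' \o nout x).

Definition wren A B A' B' (h : A -> A') (h' : B -> B') (w : wiring A B) : wiring A' B' :=
  wcls (nren h h' (rep w)).

Lemma wrenE A B A' B' (h : A -> A') (h' : B -> B') k l (p : P k l) f g :
  wren h h' (wof p f g) = wof p (h \o f) (h' \o g).
Proof.
rewrite /wren; symmetry; apply: eq_wcls.
by have [s [t ->]] := rep_wcls (Named p f g); exists s, t.
Qed.

Lemma wren_comp A B A' B' A'' B'' (h : A -> A') (h' : B -> B') (e : A' -> A'')
    (e' : B' -> B'') (w : wiring A B) :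
  wren e e' (wren h h' w) = wren (e \o h) (e' \o h') w.
Proof. by have [k [l [p [f [g ->]]]]] := wofP w; rewrite !wrenE. Qed.

Lemma wren_id A B (w : wiring A B) : wren id id w = w.
Proof. by have [k [l [p [f [g ->]]]]] := wofP w; rewrite !wrenE. Qed.

Section Alg.
Variables A B : Type.
Implicit Types w : wiring A B.

Definition no_name (C : Type) (i : 'I_0) : C := match ord0_false i with end.

Lemma no_nameE (C : Type) (f : 'I_0 -> C) : f = @no_name C.
Proof. by apply/funext => -[]. Qed.

Definition wone : wiring A B := wof (hunit : P 0 0) (@no_name A) (@no_name B).

Definition nmul (x y : named A B) : named A B :=
  Named (hcat (nval x) (nval y)) (catf (nin x) (nin y)) (catf (nout x) (nout y)).

Definition wmul (w w' : wiring A B) : wiring A B := wcls (nmul (rep w) (rep w')).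

(** The product does not depend on representatives because concatenation is
    equivariant for tensor products of permutations. *)
Lemma wmulE k l (p : P k l) f g k' l' (p' : P k' l') f' g' :
  wmul (wof p f g) (wof p' f' g') = wof (hcat p p') (catf f f') (catf g g').
Proof.
rewrite /wmul; symmetry; apply: eq_wcls.
have [s [t ->]] := rep_wcls (Named p f g).
have [s' [t' ->]] := rep_wcls (Named p' f' g').
exists (ptensor s s'), (ptensor t t').
by rewrite /nact /nmul /= (hcat_act hax) catf_perm ptensorV catf_perm.
Qed.

(** Commutativity holds because the permutations c of the symmetry axiom are
    absorbed by the relabelling. *)
Lemma wmulC : commutative wmul.
Proof.
move=> w w'; have [k [l [p [f [g ->]]]]] := wofP w.
have [k' [l' [p' [f' [g' ->]]]]] := wofP w'; rewrite !wmulE.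
have E : catf f f' = (catf f' f \o cast_ord (addnC k k')) \o pswap k k'.
  symmetry; apply: eq_catf => i /=; rewrite permE /pswap_fun.
    rewrite (unsplitK (inl i)); set j := cast_ord _ _.
    by rewrite (_ : j = rshift k' i) ?catf_rshift //; apply: val_inj.
  rewrite (unsplitK (inr i)); set j := cast_ord _ _.
  by rewrite (_ : j = lshift k i) ?catf_lshift //; apply: val_inj.
have E' : catf g g' = (catf g' g \o cast_ord (addnC l l')) \o pswap l l'.
  symmetry; apply: eq_catf => i /=; rewrite permE /pswap_fun.
    rewrite (unsplitK (inl i)); set j := cast_ord _ _.
    by rewrite (_ : j = rshift l' i) ?catf_rshift //; apply: val_inj.
  rewrite (unsplitK (inr i)); set j := cast_ord _ _.
  by rewrite (_ : j = lshift l i) ?catf_lshift //; apply: val_inj.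
rewrite E' -wof_lact (hcatC hax) E wof_ract wof_tcast; congr wof;
  by apply/funext => i /=; congr catf; apply: val_inj.
Qed.

Lemma wmul1w : left_id wone wmul.
Proof.
move=> w; have [k [l [p [f [g ->]]]]] := wofP w; rewrite wmulE (hcat1p hax).
congr wof; symmetry; apply: eq_catf => i; try by case: i.
  by congr f; apply: val_inj.
by congr g; apply: val_inj.
Qed.

Lemma wmulA : associative wmul.
Proof.
move=> w w' w''; have [k [l [p [f [g ->]]]]] := wofP w.
have [k' [l' [p' [f' [g' ->]]]]] := wofP w'.
have [k'' [l'' [p'' [f'' [g'' ->]]]]] := wofP w''.
have E (C : Type) m m' m'' (c : 'I_m -> C) (c' : 'I_m' -> C) (c'' : 'I_m'' -> C) :
    catf c (catf c' c'') \o cast_ord (esym (addnA m m' m'')) = catf (catf c c') c''.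
  apply: eq_catf => i /=; last first.
    rewrite (_ : cast_ord _ _ = rshift m (rshift m' i)) ?catf_rshift //.
    by apply: val_inj; rewrite /= addnA.
  rewrite -[i]splitK; case: (split i) => j /=.
    by rewrite (_ : cast_ord _ _ = lshift _ j) ?catf_lshift //; apply: val_inj.
  rewrite (_ : cast_ord _ _ = rshift m (lshift m'' j)) ?catf_lshift ?catf_rshift ?catf_lshift //.
  exact: val_inj.
rewrite !wmulE (hcatA hax) wof_tcast; congr wof; apply: E.
Qed.

End Alg.
End Named.

Arguments nval {P A B}.
Arguments nact {P A B} x s t.
Arguments nin {P A B}.
Arguments nout {P A B}.
Arguments wone {P A B}.
Arguments wmul {P A B}.

HB.instance Definition _ (P : trap) (A B : Type) :=
  Monoid.isComLaw.Build (wiring P A B) wone wmul (@wmulA P A B) (@wmulC P A B)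
    (@wmul1w P A B).

Lemma wmulACA P A B : @interchange (wiring P A B) wmul wmul.
Proof. exact: Monoid.mulmACA. Qed.


(** * Renaming, counting names, and tracing *)

Lemma occ_ren (A : finType) (B : eqType) n (f : 'I_n -> A) (h : A -> B) b :
  occ (h \o f) b = \sum_(a : A) occ f a * (h a == b).
Proof.
rewrite /occ; under [RHS]eq_bigr => a _ do rewrite big_distrl.
rewrite exchange_big /=; apply: eq_bigr => i _.
rewrite (bigD1 (f i)) //= eqxx mul1n big1 ?addn0 // => a /negPf.
by rewrite eq_sym => ->.
Qed.

Lemma occ_inj (A B : eqType) n (f : 'I_n -> A) (h : A -> B) a :
  injective h -> occ (h \o f) (h a) = occ f a.
Proof. by move=> hI; apply: eq_bigr => i _; rewrite /= (inj_eq hI). Qed.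

Lemma perm_delE n (s : 'S_n.+1) q x :
  lift q (perm_del s q x) = s (lift (s^-1 q)%g x).
Proof. by rewrite permE relabelE. Qed.

Section Traces.
Variable P : trap.

Let tax := trap_ptr (trap_ax P).

Section Ren.
Variables (A B A' B' : Type) (h : A -> A') (h' : B -> B').

Lemma wren1 : wren h h' wone = wone :> wiring P A' B'.
Proof. by rewrite wrenE; congr wof; apply: no_nameE. Qed.

Lemma wren_mul : {morph @wren P A B A' B' h h' : w w' / wmul w w'}.
Proof.
move=> w w'; have [k [l [p [f [g ->]]]]] := wofP w.
have [k' [l' [p' [f' [g' ->]]]]] := wofP w'.
by rewrite wmulE !wrenE wmulE !comp_catf.
Qed.

Lemma wren_prod (I : Type) (r : seq I) (Q : pred I) (F : I -> wiring P A B) :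
  wren h h' (\big[wmul/wone]_(i <- r | Q i) F i)
  = \big[wmul/wone]_(i <- r | Q i) wren h h' (F i).
Proof. exact: (big_morph _ wren_mul wren1). Qed.

End Ren.

Section Names.
Variables A B : eqType.
Implicit Types (w : wiring P A B) (a : A) (b : B) (x : named P A B).

Definition in_occ w a : nat := occ (nin (rep w)) a.
Definition out_occ w b : nat := occ (nout (rep w)) b.

Lemma in_occE k l (p : P k l) (f : 'I_k -> A) (g : 'I_l -> B) a :
  in_occ (wof p f g) a = occ f a.
Proof.
rewrite /in_occ; have [s [t ->]] := rep_wcls (Named p f g).
exact: occ_perm.
Qed.

Lemma out_occE k l (p : P k l) (f : 'I_k -> A) (g : 'I_l -> B) b :
  out_occ (wof p f g) b = occ g b.
Proof.
rewrite /out_occ; have [s [t ->]] := rep_wcls (Named p f g).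
exact: occ_perm.
Qed.

Lemma in_occ1 a : in_occ wone a = 0.
Proof. by rewrite in_occE /occ big_ord0. Qed.

Lemma out_occ1 b : out_occ wone b = 0.
Proof. by rewrite out_occE /occ big_ord0. Qed.

Lemma in_occ_mul w w' a : in_occ (wmul w w') a = in_occ w a + in_occ w' a.
Proof.
have [k [l [p [f [g ->]]]]] := wofP w; have [k' [l' [p' [f' [g' ->]]]]] := wofP w'.
by rewrite wmulE !in_occE occ_catf.
Qed.

Lemma out_occ_mul w w' b : out_occ (wmul w w') b = out_occ w b + out_occ w' b.
Proof.
have [k [l [p [f [g ->]]]]] := wofP w; have [k' [l' [p' [f' [g' ->]]]]] := wofP w'.
by rewrite wmulE !out_occE occ_catf.
Qed.

Lemma in_occ_prod (I : Type) (r : seq I) (Q : pred I) (F : I -> wiring P A B) a :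
  in_occ (\big[wmul/wone]_(i <- r | Q i) F i) a = \sum_(i <- r | Q i) in_occ (F i) a.
Proof. by apply: (big_morph (in_occ^~ a)) => [w w'|]; rewrite ?in_occ_mul ?in_occ1. Qed.

Lemma out_occ_prod (I : Type) (r : seq I) (Q : pred I) (F : I -> wiring P A B) b :
  out_occ (\big[wmul/wone]_(i <- r | Q i) F i) b = \sum_(i <- r | Q i) out_occ (F i) b.
Proof. by apply: (big_morph (out_occ^~ b)) => [w w'|]; rewrite ?out_occ_mul ?out_occ1. Qed.

(** The trace of the output named b into the input named a.  Outside of the case
    where both names occur exactly once the value is the unit of the product, on
    which again no trace is defined; with this convention traces commute without
    any hypothesis. *)
Definition ntr a b x : named P A B :=
  let none : named P A B := Named hunit (@no_name A) (@no_name B) in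
  if (occ (nin x) a == 1) && (occ (nout x) b == 1) then
    match x with Named k l p f g =>
      match k, l return P k l -> ('I_k -> A) -> ('I_l -> B) -> named P A B with
      | k.+1, l.+1 => fun p f g =>
        match [pick i | f i == a], [pick j | g j == b] with
        | Some i, Some j => Named (ptr i j p) (f \o lift i) (g \o lift j)
        | _, _ => none
        end
      | _, _ => fun _ _ _ => none
      end p f g
    end
  else Named hunit (@no_name A) (@no_name B).

Lemma ntrE k l (p : P k.+1 l.+1) (f : 'I_k.+1 -> A) (g : 'I_l.+1 -> B) i j :
  occ f (f i) = 1 -> occ g (g j) = 1 ->
  ntr (f i) (g j) (Named p f g) = Named (ptr i j p) (f \o lift i) (g \o lift j).
Proof.
move=> fi gj; rewrite /ntr /= fi gj eqxx /=.
case: pickP => [i' /eqP /(occ1_inj fi) -> | /(_ i)]; last by rewrite eqxx.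
case: pickP => [j' /eqP /(occ1_inj gj) -> // | /(_ j)]; by rewrite eqxx.
Qed.

Variant once_spec a b : named P A B -> Type :=
  OnceSpec k l (p : P k.+1 l.+1) f g i j & a = f i & b = g j &
    occ f (f i) = 1 & occ g (g j) = 1 : once_spec a b (Named p f g).

(** Positions of names that occur once; in particular there is at least one input
    and one output, so that the indices are successors. *)
Lemma onceP a b x : occ (nin x) a = 1 -> occ (nout x) b = 1 -> once_spec a b x.
Proof.
case: x => k l p f g /= fa gb.
have [i fi] : {i | f i = a} by apply: cid; apply/occ_gt0P; rewrite fa.
have [j gj] : {j | g j = b} by apply: cid; apply/occ_gt0P; rewrite gb.
case: k p f fa i fi => [|k] p f fa i fi; first by case: i {fi}.
case: l p g gb j gj => [|l] p g gb j gj; first by case: j {gj}.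
by apply: (@OnceSpec _ _ k l p f g i j); rewrite ?fi ?gj.
Qed.

Definition wtr a b w : wiring P A B := wcls (ntr a b (rep w)).

(** The trace passes to classes: this is the equivariance axiom of partial traces. *)
Lemma ntr_nequiv a b x y : nequiv x y -> nequiv (ntr a b x) (ntr a b y).
Proof.
move=> [s [t ->]].
have E1 : occ (nin (nact x s t)) a = occ (nin x) a by apply: occ_perm.
have E2 : occ (nout (nact x s t)) b = occ (nout x) b by apply: occ_perm.
case: (boolP ((occ (nin x) a == 1) && (occ (nout x) b == 1))); last first.
  by rewrite /ntr E1 E2 => /negPf ->; apply: nequiv_refl.
case/andP=> /eqP xa /eqP xb; rewrite xa in E1; rewrite xb in E2.
move: (onceP xa xb) => H; clear xa xb.
case: H s t E1 E2 => k l p f g i j -> -> fi gj s t /=.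
move=> E1 E2; rewrite ntrE //.
have E : ntr (f i) (g j) (nact (Named p f g) s t) =
    ntr ((f \o t) (t^-1%g i)) ((g \o (s^-1)%g) (s j)) (nact (Named p f g) s t).
  by rewrite /= permK permKV.
rewrite E ntrE /= ?permK ?permKV // (ptr_act tax) permK permKV.
exists (perm_del s (s j)), (perm_del t i); rewrite /nact /=.
congr Named; apply/funext => n /=.
  by rewrite perm_delE.
congr g; apply: (@perm_inj _ s); rewrite permKV.
by rewrite -[n in LHS](permKV (perm_del s (s j))) perm_delE permK.
Qed.

Lemma wtrE k l (p : P k.+1 l.+1) (f : 'I_k.+1 -> A) (g : 'I_l.+1 -> B) i j :
  occ f (f i) = 1 -> occ g (g j) = 1 ->
  wtr (f i) (g j) (wof p f g) = wof (ptr i j p) (f \o lift i) (g \o lift j).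
Proof.
move=> fi gj; rewrite /wof -(ntrE p fi gj); symmetry; apply: eq_wcls.
exact/ntr_nequiv/rep_wcls.
Qed.

Definition once a b w : bool := (in_occ w a == 1) && (out_occ w b == 1).

Lemma wtr_not_once a b w : ~~ once a b w -> wtr a b w = wone.
Proof. by rewrite /once /wtr /ntr => /negPf ->. Qed.

Variant wonce_spec a b : wiring P A B -> Type :=
  WOnceSpec k l (p : P k.+1 l.+1) f g i j of a = f i & b = g j &
    occ f (f i) = 1 & occ g (g j) = 1 : wonce_spec a b (wof p f g).

Lemma wonceP a b w : once a b w -> wonce_spec a b w.
Proof.
rewrite -[w]repK /once -/(wcls _); case: (rep w) => k l p f g.
rewrite in_occE out_occE => /andP[/eqP fa /eqP gb].
case: (@onceP a b (Named p f g) fa gb) => k' l' p' f' g' i j.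
exact: WOnceSpec.
Qed.

Lemma in_occ_tr a b w c : once a b w -> in_occ w c = (a == c) + in_occ (wtr a b w) c.
Proof.
case/wonceP=> k l p f g i j -> -> fi gj.
by rewrite wtrE // !in_occE (occ_lift _ i).
Qed.

Lemma out_occ_tr a b w c : once a b w -> out_occ w c = (b == c) + out_occ (wtr a b w) c.
Proof.
case/wonceP=> k l p f g i j -> -> fi gj.
by rewrite wtrE // !out_occE (occ_lift _ j).
Qed.

(** The axiom on the trace of a concatenation, for the first factor; the second one is
    covered by commutativity. *)
Lemma wtr_mul a b w w' : once a b w -> in_occ w' a = 0 -> out_occ w' b = 0 ->
  wtr a b (wmul w w') = wmul (wtr a b w) w'.
Proof.
case/wonceP=> k l p f g i j -> -> fi gj.
have [k' [l' [p' [f' [g' ->]]]]] := wofP w'; rewrite in_occE out_occE => f'i g'j.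
rewrite wtrE // !wmulE.
pose F : 'I_(k + k').+1 -> A := @catf A k.+1 k' f f'.
pose G : 'I_(l + l').+1 -> B := @catf B l.+1 l' g g'.
pose i1 : 'I_(k + k').+1 := @lshift k.+1 k' i.
pose j1 : 'I_(l + l').+1 := @lshift l.+1 l' j.
have Fi : F i1 = f i by apply: catf_lshift.
have Gj : G j1 = g j by apply: catf_lshift.
have oF : occ F (F i1) = 1 by rewrite Fi; have := occ_catf f f' (f i); rewrite fi f'i.
have oG : occ G (G j1) = 1 by rewrite Gj; have := occ_catf g g' (g j); rewrite gj g'j.
have := @wtrE (k + k') (l + l') (hcat p p') F G i1 j1 oF oG.
rewrite Fi Gj (ptr_hcatl tax) => ->; congr wof.
  apply: eq_catf => n; rewrite /F /=.
    rewrite (_ : lift i1 _ = @lshift k.+1 k' (lift i n)) ?catf_lshift //.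
    exact: val_inj.
  rewrite (_ : lift i1 _ = @rshift k.+1 k' n) ?catf_rshift //.
  by apply: val_inj; rewrite /= /bump; have := ltn_ord i; lia.
apply: eq_catf => n; rewrite /G /=.
  rewrite (_ : lift j1 _ = @lshift l.+1 l' (lift j n)) ?catf_lshift //.
  exact: val_inj.
rewrite (_ : lift j1 _ = @rshift l.+1 l' n) ?catf_rshift //.
by apply: val_inj; rewrite /= /bump; have := ltn_ord j; lia.
Qed.

(** Reduces the exchange of two traces to fixed positions. *)
Lemma wof_front2 k l (p : P k.+2 l.+2) (f : 'I_k.+2 -> A) (g : 'I_l.+2 -> B) i i' j j' :
  i != i' -> j != j' ->
  exists p' f' g', wof p f g = wof (p' : P k.+2 l.+2) f' g' /\
    [/\ f' ord0 = f i, f' (lift ord0 ord0) = f i',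
        g' ord0 = g j & g' (lift ord0 ord0) = g j'].
Proof.
have E n (i1 i2 : 'I_n.+2) : i1 != i2 ->
    exists s : 'S_n.+2, s ord0 = i1 /\ s (lift ord0 ord0) = i2.
  move=> i12; exists (tperm (lift ord0 ord0) (tperm ord0 i1 i2) * tperm ord0 i1)%g.
  have c0 : tperm ord0 i1 i2 != ord0.
    by rewrite -(inj_eq (@perm_inj _ (tperm ord0 i1))) tpermK tpermL eq_sym.
  by rewrite !permM (tpermD _ c0) // tpermL [tperm (lift _ _) _ _]tpermL tpermK.
move=> /E[t [t0 t1]] /E[s [s0 s1]].
exists (lact (s^-1)%g (ract p t)), (f \o t), (g \o s).
split; last by rewrite /= t0 t1 s0 s1.
by rewrite wof_act; congr wof; apply/funext => n /=; rewrite permKV.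
Qed.

Lemma wof_front_in k l (p : P k l) (f : 'I_k -> A)
    (g : 'I_l -> B) a : 0 < occ f a ->
  exists k' (p' : P k'.+1 l) f', wof p f g = wof p' f' g /\ f' ord0 = a.
Proof.
move=> /occ_gt0P[i]; case: k p f i => [|k] p f i; first by case: i.
exists k, (ract p (tperm ord0 i)), (f \o tperm ord0 i).
by rewrite wof_ract /= tpermL.
Qed.

Lemma wof_front_out k l (p : P k l) (f : 'I_k -> A)
    (g : 'I_l -> B) b : 0 < occ g b ->
  exists l' (p' : P k l'.+1) g', wof p f g = wof p' f g' /\ g' ord0 = b.
Proof.
move=> /occ_gt0P[j]; case: l p g j => [|l] p g j; first by case: j.
exists l, (lact (tperm ord0 j) p), (g \o tperm ord0 j).
rewrite wof_lact /= tpermL; split=> //; congr wof; apply/funext => i /=.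
by rewrite tpermK.
Qed.

Lemma wtr_one a b : wtr a b wone = wone.
Proof. by rewrite wtr_not_once // /once in_occ1. Qed.

(** Once the names concerned are at the positions 0 and 1, this is the single case
    of the exchange axiom where all indices are 0; the other cases of that axiom
    differ from it by permutations.  If a name is shared by the two traces, or does
    not occur exactly once, both sides are trivial. *)
Lemma wtrC a b a' b' w : wtr a b (wtr a' b' w) = wtr a' b' (wtr a b w).
Proof.
have onceD c d c' d' v : once c d v ->
    once c' d' (wtr c d v) = [&& c != c', d != d' & once c' d' v].
  move=> ov; have := ov; rewrite /once (in_occ_tr c' ov) (out_occ_tr d' ov).
  rewrite (in_occ_tr c ov) (out_occ_tr d ov) !eqxx !add1n !eqSS.
  move=> /andP[/eqP v0 /eqP v0'].
  case: (eqVneq c c') v0 => [<- -> //|_ _]; case: (eqVneq d d') v0' => [<- ->|_ _] //.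
  by rewrite andbF.
case: (boolP (once a b w)) => [ow|now]; case: (boolP (once a' b' w)) => [ow'|now'].
- case: (boolP ((a == a') || (b == b'))) => [same|].
    have nosame : (a != a') && (b != b') = false by rewrite -negb_or same.
   
    have nosame' : (a' != a) && (b' != b) = false by rewrite ![_ == a]eq_sym ![_ == b]eq_sym.
    rewrite (@wtr_not_once a b (wtr a' b' w)) 1?(@wtr_not_once a' b' (wtr a b w)) //.
      by rewrite onceD // andbA nosame.
    by rewrite onceD // andbA nosame'.
  rewrite negb_or => /andP[aa' bb'].
  case/wonceP: ow ow' aa' bb' => k l p f g i j -> -> fi gj /andP[].
  rewrite in_occE out_occE => /eqP fa' /eqP gb'.
  have [i' fi'] : exists i', f i' = a' by apply/occ_gt0P; rewrite fa'.
  have [j' gj'] : exists j', g j' = b' by apply/occ_gt0P; rewrite gb'.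
  rewrite -fi' -gj' in fa' gb' *.
  case: k p f i fi i' fi' fa' => [|k] p f i fi i' fi' fa'.
    by rewrite (ord1 i) (ord1 i') eqxx.
  case: l p g j gj j' gj' gb' => [|l] p g j gj j' gj' gb'.
    by rewrite (ord1 j) (ord1 j') eqxx.
  move=> fii' gjj'.
  have ii' : i != i' by apply: contraNneq fii' => ->.
  have jj' : j != j' by apply: contraNneq gjj' => ->.
  have [q [f' [g' [E [f0 f1 g0 g1]]]]] := wof_front2 p f g ii' jj'.
  have of' c : occ f' c = occ f c by rewrite -(in_occE q f' g') -E in_occE.
  have og' c : occ g' c = occ g c by rewrite -(out_occE q f' g') -E out_occE.
  set z1 := lift ord0 ord0 in f1 g1.
  have l0 n : lift (lift ord0 ord0) (ord0 : 'I_n.+1) = ord0 :> 'I_n.+2 by apply: val_inj.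
  have R1 : wtr (f i') (g j') (wof q f' g')
      = wof (ptr (lift ord0 ord0) (lift ord0 ord0) q) (f' \o lift z1) (g' \o lift (lift ord0 ord0)).
    by rewrite -f1 -g1 wtrE ?of' ?og' // ?f1 ?g1.
  have R2 : wtr (f i) (g j) (wof q f' g')
      = wof (ptr ord0 ord0 q) (f' \o lift ord0) (g' \o lift ord0).
    by rewrite -f0 -g0 wtrE ?of' ?og' // ?f0 ?g0.
  have F0 : f i = (f' \o lift z1) ord0 by rewrite /= l0 f0.
  have G0 : g j = (g' \o lift (lift ord0 ord0)) ord0 by rewrite /= l0 g0.
  have F1 : f i' = (f' \o lift ord0) ord0 by rewrite -f1.
  have G1 : g j' = (g' \o lift ord0) ord0 by rewrite -g1.
  have R3 (r : P k.+1 l.+1) : wtr (f i) (g j) (wof r (f' \o lift z1) (g' \o lift (lift ord0 ord0)))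
      = wof (ptr ord0 ord0 r) (f' \o lift z1 \o lift ord0) (g' \o lift (lift ord0 ord0) \o lift ord0).
    rewrite F0 G0 wtrE //.
      have := occ_lift f' z1 (f i).
      by rewrite of' fi f1 eq_sym (negPf fii') add0n -F0 => <-.
    have := occ_lift g' (lift ord0 ord0) (g j).
    by rewrite og' gj g1 eq_sym (negPf gjj') add0n -G0 => <-.
  have R4 (r : P k.+1 l.+1) : wtr (f i') (g j') (wof r (f' \o lift ord0) (g' \o lift ord0))
      = wof (ptr ord0 ord0 r) (f' \o lift ord0 \o lift ord0) (g' \o lift ord0 \o lift ord0).
    rewrite F1 G1 wtrE //.
      have := occ_lift f' ord0 (f i').
      by rewrite of' fa' f0 (negPf fii') add0n -F1 => <-.
    have := occ_lift g' ord0 (g j').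
    by rewrite og' gb' g0 (negPf gjj') add0n -G1 => <-.
  rewrite E R1 R2 R3 R4.
  (* Both sides are now iterated traces of the same element at positions 0 and 1. *)
  rewrite [in RHS](ptr_ptr_ge_ge tax) //.
  have i0 n : inord (ord0 : 'I_n.+1) = ord0 :> 'I_n.+1 by apply: val_inj; rewrite /= inordK.
  have i1 n : inord (ord0 : 'I_n.+1).+1 = lift ord0 ord0 :> 'I_n.+2.
    by apply: val_inj; rewrite /= inordK.
  rewrite !i0 !i1; congr wof; apply/funext => n /=; congr (_ _); apply: val_inj; rewrite /= /bump; lia.
- rewrite (wtr_not_once now') wtr_one wtr_not_once // onceD // (negPf now') !andbF //.
- rewrite (wtr_not_once now) wtr_one wtr_not_once // onceD // (negPf now) !andbF //.
- by rewrite (wtr_not_once now) (wtr_not_once now') !wtr_one.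
Qed.

End Names.
End Traces.

(** * Families of traces; the embedding of a TRAP *)

Section RenTrace.
Variable P : trap.

Lemma eq_wren (A B : eqType) (A' B' : Type) (h e : A -> A') (h' e' : B -> B')
    (w : wiring P A B) :
  (forall a, 0 < in_occ w a -> h a = e a) -> (forall b, 0 < out_occ w b -> h' b = e' b) ->
  wren h h' w = wren e e' w.
Proof.
have [k [l [p [f [g ->]]]]] := wofP w => he he'; rewrite !wrenE.
congr wof; apply/funext => i /=.
  by apply: he; rewrite in_occE; apply/occ_gt0P; exists i.
by apply: he'; rewrite out_occE; apply/occ_gt0P; exists i.
Qed.

Section Ren.
Variables (A B A' B' : eqType) (h : A -> A') (h' : B -> B').
Implicit Type w : wiring P A B.

Lemma in_occ_ren0 w c : (forall a, h a = c -> in_occ w a = 0) -> in_occ (wren h h' w) c = 0.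
Proof.
have [k [l [p [f [g ->]]]]] := wofP w => h0; apply/eqP.
rewrite wrenE in_occE -leqn0 leqNgt; apply/negP => /occ_gt0P[i hi].
by have := h0 _ hi; apply/eqP; rewrite in_occE -lt0n; apply/occ_gt0P; exists i.
Qed.

Lemma out_occ_ren0 w c : (forall b, h' b = c -> out_occ w b = 0) -> out_occ (wren h h' w) c = 0.
Proof.
have [k [l [p [f [g ->]]]]] := wofP w => h0; apply/eqP.
rewrite wrenE out_occE -leqn0 leqNgt; apply/negP => /occ_gt0P[i hi].
by have := h0 _ hi; apply/eqP; rewrite out_occE -lt0n; apply/occ_gt0P; exists i.
Qed.

Lemma in_occ_ren_inj w a : injective h -> in_occ (wren h h' w) (h a) = in_occ w a.
Proof.
by have [k [l [p [f [g ->]]]]] := wofP w => hI; rewrite wrenE !in_occE occ_inj.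
Qed.

Lemma out_occ_ren_inj w b : injective h' -> out_occ (wren h h' w) (h' b) = out_occ w b.
Proof.
by have [k [l [p [f [g ->]]]]] := wofP w => hI; rewrite wrenE !out_occE occ_inj.
Qed.

(** Here h and h' may identify other names; it suffices that the names traced out
    remain unique. *)
Lemma wtr_ren w a b : once a b w -> once (h a) (h' b) (wren h h' w) ->
  wtr (h a) (h' b) (wren h h' w) = wren h h' (wtr a b w).
Proof.
case/wonceP=> k l p f g i j -> -> fi gj.
rewrite /once wrenE in_occE out_occE => /andP[/eqP hi /eqP hj].
have hfi : h (f i) = (h \o f) i by [].
have hgj : h' (g j) = (h' \o g) j by [].
by rewrite hfi hgj !wtrE // wrenE.
Qed.

Lemma wtr_ren_inj w a b : injective h -> injective h' ->
  wtr (h a) (h' b) (wren h h' w) = wren h h' (wtr a b w).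
Proof.
move=> hI h'I; have E : once (h a) (h' b) (wren h h' w) = once a b w.
  by rewrite /once in_occ_ren_inj // out_occ_ren_inj.
case: (boolP (once a b w)) => ow; first by rewrite wtr_ren // E.
by rewrite (wtr_not_once ow) wtr_not_once ?E // wren1.
Qed.

End Ren.

Lemma in_occ_ren (A : finType) (B A' B' : eqType) (h : A -> A') (h' : B -> B')
    (w : wiring P A B) c : in_occ (wren h h' w) c = \sum_(a : A) in_occ w a * (h a == c).
Proof.
have [k [l [p [f [g ->]]]]] := wofP w; rewrite wrenE in_occE occ_ren.
by apply: eq_bigr => a _; rewrite in_occE.
Qed.

Lemma out_occ_ren (A : eqType) (B : finType) (A' B' : eqType)
    (h : A -> A') (h' : B -> B') (w : wiring P A B) c :
  out_occ (wren h h' w) c = \sum_(b : B) out_occ w b * (h' b == c).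
Proof.
have [k [l [p [f [g ->]]]]] := wofP w; rewrite wrenE out_occE occ_ren.
by apply: eq_bigr => a _; rewrite out_occE.
Qed.

Section Traces.
Variables A B : eqType.
Implicit Types (w : wiring P A B) (r : seq (A * B)).

Definition wtrs r w : wiring P A B := foldr (fun ab => wtr ab.1 ab.2) w r.

Lemma wtrs_cat r r' w : wtrs (r ++ r') w = wtrs r (wtrs r' w).
Proof. exact: foldr_cat. Qed.

Lemma wtr_wtrs a b r w : wtr a b (wtrs r w) = wtrs r (wtr a b w).
Proof. by elim: r => //= ab r IH; rewrite wtrC IH. Qed.

(** Traces commute, so a family of traces does not depend on its order. *)
Lemma wtrs_perm r r' w : perm_eq r r' -> wtrs r w = wtrs r' w.
Proof.
move=> rr'; apply/(catCA_perm_subst (F := wtrs^~ w)): r r' rr' => r1 r2 r3.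
rewrite !wtrs_cat; elim: r1 (wtrs r3 w) => //= ab r1 IH v.
by rewrite IH wtr_wtrs.
Qed.

(** The condition under which all traces of the list are effective, in any order. *)
Definition traceable r w : bool :=
  [&& uniq (unzip1 r), uniq (unzip2 r) & all (fun ab => once ab.1 ab.2 w) r].

Lemma traceable_cons a b r w : traceable ((a, b) :: r) w ->
  [/\ traceable r w, a \notin unzip1 r, b \notin unzip2 r & once a b w].
Proof. by rewrite /traceable /= => /and3P[/andP[-> ->] /andP[-> ->] /andP[-> ->]]. Qed.

(** Each trace removes its own two names and no others. *)
Lemma count_trs r w : traceable r w ->
  (forall c, in_occ w c = (c \in unzip1 r) + in_occ (wtrs r w) c) /\
  (forall c, out_occ w c = (c \in unzip2 r) + out_occ (wtrs r w) c).
Proof.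
elim: r => [|[a b] r IH] //= /traceable_cons[/IH [iw ow] ar br /andP[/eqP aw /eqP bw]].
have o : once a b (wtrs r w).
  rewrite /once; have := iw a; rewrite aw (negPf ar) add0n => <-.
  by have := ow b; rewrite bw (negPf br) add0n => <-.
split=> c; rewrite inE.
  rewrite iw (in_occ_tr c o) addnA [a == c]eq_sym; congr (_ + _).
  by case: eqVneq => [->|_]; rewrite ?(negPf ar) ?addn0.
rewrite ow (out_occ_tr c o) addnA [b == c]eq_sym; congr (_ + _).
by case: eqVneq => [->|_]; rewrite ?(negPf br) ?addn0.
Qed.

Lemma once_trs a b r w : traceable ((a, b) :: r) w -> once a b (wtrs r w).
Proof.
case/traceable_cons=> /count_trs[iw ow] ar br /andP[/eqP aw /eqP bw].
rewrite /once; have := iw a; rewrite aw (negPf ar) add0n => <-.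
by have := ow b; rewrite bw (negPf br) add0n => <-.
Qed.

Lemma wtrs_mul r w w' : traceable r w ->
  {in r, forall ab, in_occ w' ab.1 = 0 /\ out_occ w' ab.2 = 0} ->
  wtrs r (wmul w w') = wmul (wtrs r w) w'.
Proof.
elim: r => [|[a b] r IH] //= rw w'0.
have [rw' _ _ _] := traceable_cons rw.
have [aw' bw'] := w'0 _ (mem_head _ _).
rewrite IH // => [|ab abr]; last by apply: w'0; rewrite inE abr orbT.
by rewrite wtr_mul // once_trs.
Qed.

End Traces.

Lemma wtrs_ren (A B A' B' : eqType) (h : A -> A') (h' : B -> B') r (w : wiring P A B) :
  injective h -> injective h' ->
  wtrs [seq (h ab.1, h' ab.2) | ab <- r] (wren h h' w) = wren h h' (wtrs r w).
Proof. by move=> hI h'I; elim: r => //= ab r ->; rewrite wtr_ren_inj. Qed.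

End RenTrace.

Section Embedding.
Variable P : trap.
Let bim := trap_bimodule (trap_ax P).

Definition emb k l (p : P k l) : wiring P nat nat := wof p (@nat_of_ord k) (@nat_of_ord l).

Lemma occ_val k x : occ (@nat_of_ord k) x = (x < k).
Proof.
case: ltnP => [xk|kx].
  rewrite /occ (bigD1 (Ordinal xk)) //= eqxx big1 // => i.
  by rewrite -val_eqE /= => /negPf ->.
by rewrite /occ big1 // => i _; apply/eqP; rewrite eqb0; apply: contraTneq (ltn_ord i) => ->; lia.
Qed.

(** Distinct names rule out a nontrivial relabelling. *)
Lemma emb_inj k l : injective (@emb k l).
Proof.
move=> p p' /wof_inj [s [t [-> /esym ft /esym gs]]].
have -> : t = 1%g.
  by apply/permP => i; apply: val_inj; rewrite perm1; apply: (congr1 (@^~ i) ft).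
have -> : s = 1%g.
  apply: invg_inj; rewrite invg1; apply/permP => i; apply: val_inj; rewrite perm1.
  exact: (congr1 (@^~ i) gs).
by rewrite (lact1 bim) (ract1 bim).
Qed.

Lemma emb_sig_inj k l (p : P k l) k' l' (p' : P k' l') : emb p = emb p' ->
  existT (fun a => P a.1 a.2) (k, l) p = existT (fun a => P a.1 a.2) (k', l') p'.
Proof.
move=> pp'; have [ek el] := wof_dim pp'.
by case: k' / ek p' pp'; case: l' / el => p' /emb_inj ->.
Qed.

(** Such names are a permutation of the positions, which can be absorbed. *)
Lemma embP k l (w : wiring P nat nat) : (forall x, in_occ w x = (x < k)) ->
  (forall x, out_occ w x = (x < l)) -> exists p : P k l, w = emb p.
Proof.
have [k' [l' [p [f [g ->]]]]] := wofP w => wi wo.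
have bij n n' (u : 'I_n' -> nat) : (forall x, occ u x = (x < n)) ->
    exists e : n' = n, exists t : 'S_n, u = @nat_of_ord n \o t \o cast_ord e.
  move=> ou; have ult i : u i < n by rewrite -[_ < n]lt0b -ou; apply/occ_gt0P; exists i.
  pose v i := Ordinal (ult i).
  have vI : injective v.
    move=> i i' /(congr1 val) /= ii'; apply: (@occ1_inj _ _ u) => //.
    by rewrite ou ult.
  have vS y : exists x, v x = y.
    have /occ_gt0P[x ux] : 0 < occ u y by rewrite ou ltn_ord.
    by exists x; apply: val_inj.
  have e : n' = n.
    by rewrite -(card_ord n') -(card_ord n); apply: (bij_eq_card (inj_surj_bij vI vS)).
  have vE i : u i = v i by [].
  clearbody v; exists e; case: n / e v vI vE {ou ult vS} => v vI vE.
  by exists (perm vI); apply/funext => i /=; rewrite permE cast_ord_id vE.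
have {wi}[ek [t ->]] := bij _ _ f (fun x => etrans (esym (in_occE p f g x)) (wi x)).
have {wo}[el [s ->]] := bij _ _ g (fun x => etrans (esym (out_occE p f g x)) (wo x)).
have := wof_tcast ek el p (@nat_of_ord k \o t) (@nat_of_ord l \o s).
move=> E; rewrite -E -(wof_lact s) /emb.
exists (ract (lact s (tcast ek el p)) (t^-1)%g).
by rewrite -[RHS](wof_ract _ t) -(ractM bim) /pcomp mulgV (ract1 bim).
Qed.

End Embedding.

(** * The embedding and the TRAP operations; the unit *)

Section EmbOps.
Variable P : trap.

Lemma emb_hunit : emb (hunit : P 0 0) = wone.
Proof. by congr wof; apply: no_nameE. Qed.

(** The renaming h is only prescribed on positions that occur. *)
Lemma emb_lact k l (s : 'S_l) (p : P k l) (h : nat -> nat) :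
  (forall i, h (nat_of_ord i) = s i) -> emb (lact s p) = wren id h (emb p).
Proof.
by move=> hs; rewrite /emb wof_lact wrenE; congr wof; apply/funext => i /=; rewrite hs.
Qed.

Lemma emb_ract k l (p : P k l) (t : 'S_k) (h : nat -> nat) :
  (forall i, h (nat_of_ord i) = (t^-1)%g i) -> emb (ract p t) = wren h id (emb p).
Proof.
move=> ht; rewrite /emb wrenE -(wof_ract p t); congr wof.
by apply/funext => i /=; rewrite ht permK.
Qed.

Lemma emb_hcat k l k' l' (p : P k l) (p' : P k' l') :
  emb (hcat p p') = wmul (emb p) (wren (addn k) (addn l) (emb p')).
Proof.
by rewrite /emb wrenE wmulE; congr wof; apply: eq_catf.
Qed.

(** After the trace of i and j, the higher positions move down by one; [unbump]
    does this on names. *)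
Lemma emb_ptr k l (i : 'I_k.+1) (j : 'I_l.+1) (p : P k.+1 l.+1) :
  emb (ptr i j p) = wren (unbump i) (unbump j) (wtr (nat_of_ord i) (nat_of_ord j) (emb p)).
Proof.
rewrite /emb wtrE ?occ_val ?ltn_ord // wrenE.
by congr wof; apply/funext => n /=; rewrite bumpK.
Qed.

End EmbOps.

Section Map.
Variables (P Q : trap) (f : forall k l, P k l -> Q k l).
Hypothesis fM : trap_morphism f.

Definition wmap A B (w : wiring P A B) : wiring Q A B :=
  let x := rep w in wof (f (nval x)) (nin x) (nout x).

Lemma wmapE A B k l (p : P k l) (a : 'I_k -> A) (b : 'I_l -> B) :
  wmap (wof p a b) = wof (f p) a b.
Proof.
rewrite /wmap; have [s [t ->]] := rep_wcls (Named p a b); rewrite /=.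
rewrite (morph_lact fM) (morph_ract fM) wof_act.
by congr wof; apply/funext => i /=; rewrite permK.
Qed.

Lemma wmap1 A B : wmap wone = wone :> wiring Q A B.
Proof. by rewrite wmapE (morph_hunit fM). Qed.

Lemma wmap_mul A B (w w' : wiring P A B) : wmap (wmul w w') = wmul (wmap w) (wmap w').
Proof.
have [k [l [p [a [b ->]]]]] := wofP w; have [k' [l' [p' [a' [b' ->]]]]] := wofP w'.
by rewrite wmulE !wmapE wmulE (morph_hcat fM).
Qed.

Lemma wmap_prod A B (I : Type) (r : seq I) (D : pred I) (F : I -> wiring P A B) :
  wmap (\big[wmul/wone]_(i <- r | D i) F i)
  = \big[wmul/wone]_(i <- r | D i) wmap (F i).
Proof. exact: (big_morph _ (@wmap_mul A B) (@wmap1 A B)). Qed.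

Lemma wmap_ren A B A' B' (h : A -> A') (h' : B -> B') (w : wiring P A B) :
  wmap (wren h h' w) = wren h h' (wmap w).
Proof.
by have [k [l [p [a [b ->]]]]] := wofP w; rewrite wrenE !wmapE wrenE.
Qed.

Lemma wmap_tr (A B : eqType) a b (w : wiring P A B) : wmap (wtr a b w) = wtr a b (wmap w).
Proof.
have onceE : once a b (wmap w) = once a b w.
  have [k [l [p [n [n' ->]]]]] := wofP w.
  by rewrite wmapE /once !in_occE !out_occE.
case: (boolP (once a b w)) => ow; last first.
  by rewrite (wtr_not_once ow) wmap1 wtr_not_once // onceE.
case/wonceP: ow => k l p n n' i j -> -> ni n'j.
by rewrite wtrE // !wmapE wtrE // (morph_ptr fM).
Qed.

Lemma wmap_trs (A B : eqType) r (w : wiring P A B) : wmap (wtrs r w) = wtrs r (wmap w).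
Proof. by elim: r => //= ab r IH; rewrite wmap_tr IH. Qed.

End Map.

Definition utrap_trap (Q : utrap) : trap := Trap (utrap_ax Q).

Lemma pcyc00 n : pcyc n 0 0 = 1%g.
Proof.
apply/permP => i; rewrite permE perm1; apply: val_inj; rewrite /= /pcyc_fun /=.
by case: ifP => // _; case: eqP => // ->.
Qed.

Section Unit.
Variable Q : utrap.
Let ua := utrap_unit Q.

Definition wunit (A B : Type) (a : A) (b : B) : wiring (utrap_trap Q) A B :=
  wof (tunit : utrap_trap Q 1 1) (fun _ => a) (fun _ => b).

Lemma wren_unit A B A' B' (h : A -> A') (h' : B -> B') a b :
  wren h h' (wunit a b) = wunit (h a) (h' b).
Proof. by rewrite wrenE. Qed.

Lemma in_occ_unit (A B : eqType) (a : A) (b : B) c : in_occ (wunit a b) c = (a == c).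
Proof. by rewrite in_occE /occ big_ord_recl big_ord0 addn0. Qed.

Lemma out_occ_unit (A B : eqType) (a : A) (b : B) c : out_occ (wunit a b) c = (b == c).
Proof. by rewrite out_occE /occ big_ord_recl big_ord0 addn0. Qed.

(** Tracing the input a into the output of a unit replaces a by the name c of the
    input of that unit.  With the input a moved to the front, this is the unit axiom
    in the case where the cycle is trivial; the other cases differ from it by
    permutations. *)
Lemma wtr_unit_in (A B : eqType) (a c : A) (b : B) w :
  in_occ w a = 1 -> out_occ w b = 0 -> a != c ->
  wtr a b (wmul (wunit c b) w) = wren (fun x => if x == a then c else x) id w.
Proof.
have [k [l [p [f [g ->]]]]] := wofP w; rewrite in_occE out_occE => fa gb ac.
have [|k' [p' [f' [E f'0]]]] := wof_front_in p g (a := a) (f := f); first by rewrite fa.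
have f'a : occ f' a = 1 by rewrite -(in_occE p' f' g) -E in_occE.
rewrite E {E fa p f} wmulE wrenE -f'0.
(* In the product the unit is at position 0, hence the input named a at position 1. *)
pose F : 'I_k'.+2 -> A := @catf A 1 k'.+1 (fun _ => c) f'.
pose G : 'I_l.+1 -> B := @catf B 1 l (fun _ => b) g.
have F1 : F (lift ord0 ord0) = f' ord0.
  rewrite /F (_ : lift ord0 ord0 = @rshift 1 k'.+1 ord0) ?catf_rshift //.
  exact: val_inj.
have G0 : G ord0 = b.
  rewrite /G (_ : ord0 = @lshift 1 l ord0) ?catf_lshift //.
  exact: val_inj.
have oF : occ F (F (lift ord0 ord0)) = 1.
  rewrite F1 f'0; have := occ_catf (fun _ : 'I_1 => c) f' a; rewrite f'a.
  by rewrite /occ big_ord_recl big_ord0 eq_sym (negPf ac).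
have oG : occ G (G ord0) = 1.
  rewrite G0; have := occ_catf (fun _ : 'I_1 => b) g b; rewrite gb.
  by rewrite /occ big_ord_recl big_ord0 eqxx.
have := @wtrE (utrap_trap Q) A B k'.+1 l (hcat (tunit : Q 1 1) p') F G (lift ord0 ord0) ord0 oF oG.
rewrite F1 G0 => ->; rewrite (ptr_unitl_in ua) //= pcyc00 invg1.
rewrite (ract1 (trap_bimodule (utrap_ax Q))); congr wof; apply/funext => i /=.
  case: (unliftP ord0 i) => [i'|] ->.
    rewrite (_ : lift (lift ord0 ord0) _ = @rshift 1 k'.+1 (lift ord0 i')); last exact: val_inj.
    rewrite /F catf_rshift ifN //; apply/eqP => /(occ1_inj _).
    by rewrite f'0 => /(_ f'a).
  rewrite (_ : lift (lift ord0 ord0) _ = @lshift 1 k'.+1 ord0); last exact: val_inj.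
  by rewrite /F catf_lshift eqxx.
rewrite (_ : lift ord0 i = @rshift 1 l i); last exact: val_inj.
by rewrite /G catf_rshift.
Qed.

(** The dual of [wtr_unit_in]. *)
Lemma wtr_unit_out (A B : eqType) (a : A) (b d : B) w :
  in_occ w a = 0 -> out_occ w b = 1 -> b != d ->
  wtr a b (wmul (wunit a d) w) = wren id (fun y => if y == b then d else y) w.
Proof.
have [k [l [p [f [g ->]]]]] := wofP w; rewrite in_occE out_occE => fa gb bd.
have [|l' [p' [g' [E g'0]]]] := wof_front_out p f (b := b) (g := g); first by rewrite gb.
have g'b : occ g' b = 1 by rewrite -(out_occE p' f g') -E out_occE.
rewrite E {E gb p g} wmulE wrenE -g'0.
pose F : 'I_k.+1 -> A := @catf A 1 k (fun _ => a) f.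
(* In the product the unit is at position 0, hence the output named b at position 1. *)
pose G : 'I_l'.+2 -> B := @catf B 1 l'.+1 (fun _ => d) g'.
have G1 : G (lift ord0 ord0) = g' ord0.
  rewrite /G (_ : lift ord0 ord0 = @rshift 1 l'.+1 ord0) ?catf_rshift //.
  exact: val_inj.
have F0 : F ord0 = a.
  rewrite /F (_ : ord0 = @lshift 1 k ord0) ?catf_lshift //.
  exact: val_inj.
have oG : occ G (G (lift ord0 ord0)) = 1.
  rewrite G1 g'0; have := occ_catf (fun _ : 'I_1 => d) g' b; rewrite g'b.
  by rewrite /occ big_ord_recl big_ord0 eq_sym (negPf bd).
have oF : occ F (F ord0) = 1.
  rewrite F0; have := occ_catf (fun _ : 'I_1 => a) f a; rewrite fa.
  by rewrite /occ big_ord_recl big_ord0 eqxx.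
have := @wtrE (utrap_trap Q) A B k l'.+1 (hcat (tunit : Q 1 1) p') F G ord0 (lift ord0 ord0) oF oG.
rewrite F0 G1 => ->; rewrite (ptr_unitl_out ua) //= pcyc00.
rewrite (lact1 (trap_bimodule (utrap_ax Q))); congr wof; apply/funext => i /=.
  rewrite (_ : lift ord0 i = @rshift 1 k i); last exact: val_inj.
  by rewrite /F catf_rshift.
case: (unliftP ord0 i) => [i'|] ->.
  rewrite (_ : lift (lift ord0 ord0) _ = @rshift 1 l'.+1 (lift ord0 i')); last exact: val_inj.
  rewrite /G catf_rshift ifN //; apply/eqP => /(occ1_inj _).
  by rewrite g'0 => /(_ g'b).
rewrite (_ : lift (lift ord0 ord0) _ = @lshift 1 l'.+1 ord0); last exact: val_inj.
by rewrite /G catf_lshift eqxx.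
Qed.

End Unit.

(** * The value of the solar part of a graph *)

Lemma port_inj (V : Type) (a : V -> nat) : injective (@port V a).
Proof.
move=> [v i] [v' i']; rewrite /port /= => -[vv' ii'].
by case: v' / vv' i' ii' => i' /val_inj ->.
Qed.

(** Decorations of vertices are compared together with their arities, as in the
    definition of an isomorphism of graphs. *)
Lemma eq_wof_sig (X : nat -> nat -> Type) (Q : trap) (f : forall k l, X k l -> Q k l)
    (A B : Type) k l k' l' (p : X k l) (p' : X k' l') (c : 'I_k -> A) (c' : 'I_k' -> A)
    (d : 'I_l -> B) (d' : 'I_l' -> B) :
  existT (fun a => X a.1 a.2) (k, l) p = existT (fun a => X a.1 a.2) (k', l') p' ->
  (forall (i : 'I_k) (i' : 'I_k'), i = i' :> nat -> c i = c' i') ->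
  (forall (i : 'I_l) (i' : 'I_l'), i = i' :> nat -> d i = d' i') ->
  wof (f _ _ p) c d = wof (f _ _ p') c' d'.
Proof.
move=> E.
have [ek el] : k = k' /\ l = l' by have := congr1 tag E => -[].
case: k' / ek p' E c' => p' E c'; case: l' / el p' E d' => p' E d' cc dd.
have -> : c = c' by apply/funext => i; apply: cc.
have -> : d = d' by apply/funext => i; apply: dd.
suff -> : p = p' by [].
have dec (x y : nat * nat) : {x = y} + {x <> y} by case: (eqVneq x y) => [|/eqP]; [left|right].
exact: (Eqdep_dec.inj_pair2_eq_dec _ dec _ _ _ _ E).
Qed.

Lemma perm_enum_sum (S T : finType) :
  perm_eq (enum {: S + T}) (map inl (enum S) ++ map inr (enum T)).
Proof.
have lI : injective (@inl S T) by move=> x y [].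
have rI : injective (@inr S T) by move=> x y [].
apply: uniq_perm; first exact: enum_uniq.
  rewrite cat_uniq (map_inj_uniq lI) (map_inj_uniq rI) !enum_uniq andbT.
  by apply/hasPn => _ /mapP[t _ ->]; apply/mapP => -[].
move=> x; rewrite mem_enum mem_cat; symmetry; apply/orP.
by case: x => x; [left|right]; apply/map_f; rewrite mem_enum.
Qed.

Lemma perm_enum_option (T : finType) :
  perm_eq (enum {: option T}) (None :: map Some (enum T)).
Proof.
have sI : injective (@Some T) by move=> x y [].
apply: uniq_perm; first exact: enum_uniq.
  by rewrite cons_uniq (map_inj_uniq sI) enum_uniq andbT; apply/mapP => -[].
move=> x; rewrite mem_enum inE; symmetry; apply/orP.
by case: x => [x|]; [right; apply/map_f; rewrite mem_enum|left].
Qed.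

Lemma perm_enum_bij (S T : finType) (h : S -> T) : bijective h ->
  perm_eq (enum T) (map h (enum S)).
Proof.
move=> hB; apply: uniq_perm; first exact: enum_uniq.
  by rewrite (map_inj_uniq (bij_inj hB)) enum_uniq.
move=> x; rewrite mem_enum; symmetry; case: hB => g hK gK.
by rewrite -[x]gK; apply/map_f; rewrite mem_enum.
Qed.

Lemma eq_perm (T : eqType) (r r' : seq T) : r = r' -> perm_eq r r'.
Proof. by move->; apply: perm_refl. Qed.

(** Injective renamings preserve the number of occurrences of each name. *)
Lemma traceable_ren (P : trap) (A B A' B' : eqType) (h : A -> A') (h' : B -> B') r
    (w : wiring P A B) : injective h -> injective h' -> traceable r w ->
  traceable [seq (h ab.1, h' ab.2) | ab <- r] (wren h h' w).
Proof.
move=> hI h'I /and3P[r1 r2 /allP rw]; apply/and3P; split.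
- have -> : unzip1 [seq (h ab.1, h' ab.2) | ab <- r] = map h (unzip1 r).
    by rewrite /unzip1 -!map_comp.
  by rewrite map_inj_uniq.
- have -> : unzip2 [seq (h ab.1, h' ab.2) | ab <- r] = map h' (unzip2 r).
    by rewrite /unzip2 -!map_comp.
  by rewrite map_inj_uniq.
apply/allP => _ /mapP[ab /rw abw ->].
by rewrite /once in_occ_ren_inj // out_occ_ren_inj.
Qed.

Lemma sum_eq_inj (T : finType) (u : T -> nat) n : injective u ->
  \sum_(x : T) (u x == n) = [exists x, u x == n].
Proof.
move=> uI; case: existsP => [[x /eqP <-]|no].
  rewrite (bigD1 x) //= eqxx big1 // => y yx.
  by apply/eqP; rewrite eqb0 (inj_eq uI).
rewrite big1 // => x _; apply/eqP; rewrite eqb0.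
by apply/eqP => xn; case: no; exists x; apply/eqP.
Qed.

Section Core.
Variables (X : nat -> nat -> Type) (Q : trap) (f : forall k l, X k l -> Q k l).

Section OneGraph.
Variables (k l : nat) (G : graph X k l).

(** The name of an incoming port: the edge attached to it. *)
Definition at_in v i : gE G + gI G := bij_inv (tgt_bij G) (existT _ v i).
Definition at_out v j : gE G + gO G := bij_inv (src_bij G) (existT _ v j).

Definition vertex v : wiring Q (gE G + gI G)%type (gE G + gO G)%type :=
  wof (f (dec G v)) (@at_in v) (@at_out v).

Definition vertices := \big[wmul/wone]_(v : gV G) vertex v.

(** Both ends of an internal edge e bear the name e, as an output of its source and
    as an input of its target; the trace of this pair of names joins them. *)
Definition edges : seq ((gE G + gI G) * (gE G + gO G)) :=
  [seq (inl e, inl e) | e <- enum (gE G)].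

(** The value of the solar part of a graph, its inputs and outputs being named by
    the input and output edges themselves. *)
Definition core := wtrs edges vertices.

(** Internal edges have been traced out when this renaming is applied, so their
    value 0 is irrelevant. *)
Definition inlab (x : gE G + gI G) : nat :=
  match x with inl _ => 0 | inr y => ilab G (inl y) end.
Definition outlab (x : gE G + gO G) : nat :=
  match x with inl _ => 0 | inr y => olab G (inl y) end.

(** The value of the solar part of a graph, with the labels of the graph: they need
    not be consecutive. *)
Definition solW : wiring Q nat nat := wren inlab outlab core.

(** A bijection onto the ports sends every edge to exactly one port. *)
Lemma sum_fibre (A : finType) (V : finType) (a : V -> nat) (t : A -> {v : V & 'I_(a v)})
    (tB : bijective t) x :
  \sum_(v : V) \sum_(i < a v) (bij_inv tB (existT _ v i) == x) = 1.
Proof.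
rewrite (sig_big_dep (fun _ => true) (fun _ _ => true)
  (fun v (i : 'I_(a v)) => nat_of_bool (bij_inv tB (existT _ v i) == x))) /=.
rewrite (reindex t) /=; last exact: onW_bij.
rewrite (bigD1 x) //= big1 ?addn0 => [|y yx].
  by apply/eqP; rewrite eqb1; apply/eqP/(bij_inj tB); rewrite bij_invK; case: (t x).
apply/eqP; rewrite eqb0; apply: contra yx => /eqP <-; apply/eqP.
by apply/(bij_inj tB); rewrite bij_invK; case: (t y).
Qed.

Lemma in_occ_vertices x : in_occ vertices x = 1.
Proof.
rewrite in_occ_prod -[RHS](sum_fibre (tgt_bij G) x); apply: eq_bigr => v _.
by rewrite in_occE.
Qed.

Lemma out_occ_vertices x : out_occ vertices x = 1.
Proof.
rewrite out_occ_prod -[RHS](sum_fibre (src_bij G) x); apply: eq_bigr => v _.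
by rewrite out_occE.
Qed.

Lemma unzip1_edges : unzip1 edges = map inl (enum (gE G)).
Proof. by rewrite /unzip1 -map_comp. Qed.

Lemma unzip2_edges : unzip2 edges = map inl (enum (gE G)).
Proof. by rewrite /unzip2 -map_comp. Qed.

(** Each edge is attached to exactly one port on either side. *)
Lemma traceable_edges : traceable edges vertices.
Proof.
rewrite /traceable unzip1_edges unzip2_edges; apply/and3P; split.
- by rewrite map_inj_uniq; [exact: enum_uniq | move=> x y []].
- by rewrite map_inj_uniq; [exact: enum_uniq | move=> x y []].
by apply/allP => _ /mapP[e _ ->]; rewrite /once in_occ_vertices out_occ_vertices.
Qed.

Lemma in_occ_core x : in_occ core x = if x is inr _ then 1 else 0.
Proof.
have [/(_ x)] := count_trs traceable_edges; rewrite in_occ_vertices unzip1_edges.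
case: x => x.
  by rewrite map_f ?mem_enum // => -[->].
by move=> + _; case: mapP => [[e _ //]|_ ->].
Qed.

Lemma out_occ_core x : out_occ core x = if x is inr _ then 1 else 0.
Proof.
have [_ /(_ x)] := count_trs traceable_edges; rewrite out_occ_vertices unzip2_edges.
case: x => x.
  by rewrite map_f ?mem_enum // => -[->].
by case: mapP => [[e _ //]|_ ->].
Qed.

Lemma once_core x y : once (inr x) (inr y) core.
Proof. by rewrite /once in_occ_core out_occ_core. Qed.

Lemma in_occ_core_edge e : 0 < in_occ core (inl e) -> False.
Proof. by rewrite in_occ_core. Qed.

Lemma out_occ_core_edge e : 0 < out_occ core (inl e) -> False.
Proof. by rewrite out_occ_core. Qed.

Lemma in_occ_solW_sum n : in_occ solW n = \sum_(x : gI G) (inlab (inr x) == n).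
Proof.
rewrite in_occ_ren big_sumType /= big1 ?add0n => [|e _]; last by rewrite in_occ_core.
by apply: eq_bigr => x _; rewrite in_occ_core mul1n.
Qed.

Lemma out_occ_solW_sum n : out_occ solW n = \sum_(x : gO G) (outlab (inr x) == n).
Proof.
rewrite out_occ_ren big_sumType /= big1 ?add0n => [|e _]; last by rewrite out_occ_core.
by apply: eq_bigr => x _; rewrite out_occ_core mul1n.
Qed.

Lemma in_occ_solW n : in_occ solW n = [exists x, inlab (inr x) == n].
Proof.
rewrite in_occ_solW_sum sum_eq_inj // => x y /ord_inj.
by move=> /(bij_inj (ilab_bij G)) [].
Qed.

Lemma out_occ_solW n : out_occ solW n = [exists x, outlab (inr x) == n].
Proof.
rewrite out_occ_solW_sum sum_eq_inj // => x y /ord_inj.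
by move=> /(bij_inj (olab_bij G)) [].
Qed.

End OneGraph.

Lemma at_in_eq k l (G : graph X k l) v i x :
  port (tgt G x) = (v, i : nat) -> forall i' : 'I_(ain G v), i = i' :> nat -> at_in i' = x.
Proof.
move=> tx i' ii'; apply: (bij_inj (tgt_bij G)); rewrite bij_invK.
by apply: port_inj; rewrite tx /port /= -ii'.
Qed.

Lemma at_out_eq k l (G : graph X k l) v i x :
  port (src G x) = (v, i : nat) -> forall i' : 'I_(aout G v), i = i' :> nat -> at_out i' = x.
Proof.
move=> tx i' ii'; apply: (bij_inj (src_bij G)); rewrite bij_invK.
by apply: port_inj; rewrite tx /port /= -ii'.
Qed.

(** The product over the vertices only depends on the vertices, their decorations and
    the attachment of the edges to the ports.  Both isomorphisms and the creation of an
    edge by a partial trace are instances. *)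
Lemma vertices_transfer k l (G : graph X k l) k' l' (H : graph X k' l')
    (isoV : gV G -> gV H) (h : gE G + gI G -> gE H + gI H) (h' : gE G + gO G -> gE H + gO H) :
  bijective isoV -> (forall v, tdec (isoV v) = tdec v) ->
  (forall x, port (tgt H (h x)) = (isoV (port (tgt G x)).1, (port (tgt G x)).2)) ->
  (forall x, port (src H (h' x)) = (isoV (port (src G x)).1, (port (src G x)).2)) ->
  vertices H = wren h h' (vertices G).
Proof.
move=> vB vdec ht hs; rewrite /vertices wren_prod (reindex isoV) /=; last exact: onW_bij.
apply: eq_bigr => v _; rewrite wrenE; apply: eq_wof_sig; first exact: vdec.
  move=> i i' ii'; apply: at_in_eq (esym ii').
  by rewrite ht /at_in bij_invK.
move=> i i' ii'; apply: at_out_eq (esym ii').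
by rewrite hs /at_out bij_invK.
Qed.

Lemma core_iso k l (G H : graph X k l) (F : graph_iso G H) :
  core H = wren (sum_map (isoE F) (isoI F)) (sum_map (isoE F) (isoO F)) (core G).
Proof.
have inI := bij_inj (sum_map_bij (isoE_bij F) (isoI_bij F)).
have inO := bij_inj (sum_map_bij (isoE_bij F) (isoO_bij F)).
rewrite /core -wtrs_ren //.
rewrite (vertices_transfer (isoV_bij F) (iso_dec F) (iso_tgt F) (iso_src F)).
apply: wtrs_perm.
have -> : [seq (sum_map (isoE F) (isoI F) ab.1, sum_map (isoE F) (isoO F) ab.2) | ab <- edges G]
    = [seq (inl e, inl e) | e <- [seq isoE F e | e <- enum (gE G)]].
  by rewrite /edges; elim: (enum _) => //= e r ->.
exact/perm_map/perm_enum_bij/isoE_bij.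
Qed.

Lemma solW_iso k l (G H : graph X k l) : isomorphic G H -> solW G = solW H.
Proof.
move=> [F]; rewrite /solW (core_iso F) wren_comp; apply: eq_wren => -[e|x] //= _.
  by have /= -> := iso_ilab F (inl x).
by have /= -> := iso_olab F (inl x).
Qed.

(** The edges of each graph are traced within the factor to which they belong. *)
Lemma core_disj_union k l (G : graph X k l) k' l' (H : graph X k' l') :
  core (disj_union G H) = wmul (wren (sum_map inl inl) (sum_map inl inl) (core G))
                               (wren (sum_map inr inr) (sum_map inr inr) (core H)).
Proof.
have lI A B A' B' : injective (sum_map (@inl A B) (@inl A' B')) by move=> [x|x] [y|y] // [->].
have rI A B A' B' : injective (sum_map (@inr A B) (@inr A' B')) by move=> [x|x] [y|y] // [->].
have -> : core (disj_union G H) =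
  wtrs ([seq (sum_map inl inl ab.1, sum_map inl inl ab.2) | ab <- edges G]
     ++ [seq (sum_map inr inr ab.1, sum_map inr inr ab.2) | ab <- edges H])
    (wmul (wren (sum_map inl inl) (sum_map inl inl) (vertices G))
          (wren (sum_map inr inr) (sum_map inr inr) (vertices H))).
  have <- : vertices (disj_union G H) =
       (wmul (wren (sum_map inl inl) (sum_map inl inl) (vertices G))
          (wren (sum_map inr inr) (sum_map inr inr) (vertices H))).
    rewrite /vertices !wren_prod big_sumType /=; congr wmul; apply: eq_bigr => v _;
      rewrite wrenE; congr wof; apply/funext => i.
    - apply: (@at_in_eq _ _ (disj_union G H) (inl v) i _ _ i) => //.
      rewrite /= /at_in; set y := bij_inv _ _.
      rewrite (_ : swap_sum _ = inl y); last by case: y.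
      by rewrite /= /y bij_invK.
    - apply: (@at_out_eq _ _ (disj_union G H) (inl v) i _ _ i) => //.
      rewrite /= /at_out; set y := bij_inv _ _.
      rewrite (_ : swap_sum _ = inl y); last by case: y.
      by rewrite /= /y bij_invK.
    - apply: (@at_in_eq _ _ (disj_union G H) (inr v) i _ _ i) => //.
      rewrite /= /at_in; set y := bij_inv _ _.
      rewrite (_ : swap_sum _ = inr y); last by case: y.
      by rewrite /= /y bij_invK.
    - apply: (@at_out_eq _ _ (disj_union G H) (inr v) i _ _ i) => //.
      rewrite /= /at_out; set y := bij_inv _ _.
      rewrite (_ : swap_sum _ = inr y); last by case: y.
      by rewrite /= /y bij_invK.
  apply: wtrs_perm; apply: perm_trans (perm_map _ (perm_enum_sum _ _)) _.
  rewrite map_cat /edges; apply: eq_perm.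
  by congr (_ ++ _); [elim: (enum (gE G)) | elim: (enum (gE H))] => //= e r ->.
rewrite wtrs_cat (wmulC (wren _ _ (vertices G))) wtrs_mul; first 1 last.
- by apply: traceable_ren; [exact: rI|exact: rI|exact: traceable_edges].
- move=> _ /mapP[_ /mapP[e _ ->] ->] /=.
  by split; [apply: in_occ_ren0 | apply: out_occ_ren0] => -[].
rewrite (wtrs_ren _ _ (rI _ _ _ _) (rI _ _ _ _)) wmulC wtrs_mul; first 1 last.
- by apply: traceable_ren; [exact: lI|exact: lI|exact: traceable_edges].
- move=> _ /mapP[_ /mapP[e _ ->] ->] /=.
  by split; [apply: in_occ_ren0 | apply: out_occ_ren0] => -[].
by rewrite (wtrs_ren _ _ (lI _ _ _ _) (lI _ _ _ _)).
Qed.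

Lemma solW_disj_union k l (G : graph X k l) k' l' (H : graph X k' l') :
  solW (disj_union G H) = wmul (solW G) (wren (addn k) (addn l) (solW H)).
Proof.
rewrite /solW core_disj_union wren_mul !wren_comp; congr wmul; apply: eq_wren => -[e|x] //=;
  by rewrite ?in_occ_core ?out_occ_core.
Qed.

(** The new internal edge of the partial trace contributes one more trace, which joins
    the output edge g to the input edge e. *)
Lemma core_tr_input_output k l (G : graph X k.+1 l.+1) i j e g
    (ei : ilab G (inl e) = i) (gj : olab G (inl g) = j) :
  wtr (inr e) (inr g) (core G) =
  wren (@absorb _ _ e) (@absorb _ _ g) (core (tr_input_output ei gj)).
Proof.
have aI := bij_inj (@absorb_bij _ _ e); have aO := bij_inj (@absorb_bij _ _ g).
rewrite {2}/core -wtrs_ren //.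
(* The two graphs have the same vertices and ports; only the names of the edges differ. *)
have <- := @vertices_transfer _ _ (tr_input_output ei gj) _ _ G id
  (@absorb _ _ e) (@absorb _ _ g).
- rewrite /core wtr_wtrs.
  have -> : wtrs (edges G) (wtr (inr e) (inr g) (vertices G)) =
     wtrs (rcons (edges G) (inr e, inr g)) (vertices G).
    by rewrite -cats1 wtrs_cat.
  apply: wtrs_perm; rewrite perm_rcons perm_sym.
  apply: perm_trans (perm_map _ (perm_map _ (perm_enum_option _))) _.
  by apply: eq_perm; rewrite /= /edges; congr (_ :: _); elim: (enum (gE G)) => //= x r ->.
- by exists id.
- by [].
- by [].
- by [].
- exact: aI.
- exact: aO.
Qed.

Lemma solW_glact k l (s : 'S_l) (G : graph X k l) (h : nat -> nat) :
  (forall i, h (nat_of_ord i) = s i) -> solW (glact s G) = wren id h (solW G).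
Proof.
move=> hs; rewrite /solW wren_comp; apply: eq_wren => -[e|x] //=.
by rewrite [core _]/(core G) out_occ_core.
Qed.

Lemma solW_gract k l (G : graph X k l) (s : 'S_k) (h : nat -> nat) :
  (forall i, h (nat_of_ord i) = (s^-1)%g i) -> solW (gract G s) = wren h id (solW G).
Proof.
move=> hs; rewrite /solW wren_comp; apply: eq_wren => -[e|x] //=.
by rewrite [core _]/(core G) in_occ_core.
Qed.

Lemma core_no_edge k l (G : graph X k l) : (gE G -> False) -> core G = vertices G.
Proof. by move=> G0; rewrite /core /edges; case: (enum _) => // e; case: (G0 e). Qed.

Lemma solW_gempty : solW (gempty X) = wone.
Proof.
rewrite /solW core_no_edge // /vertices big_pred0 ?wren1 // => -[].
Qed.

Lemma solW_gunit : solW (gunit X) = wone.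
Proof.
rewrite /solW core_no_edge // /vertices big_pred0 ?wren1 // => -[].
Qed.

Lemma solW_iota k l (p : X k l) : solW (iota_graph p) = emb (f p).
Proof.
rewrite /solW core_no_edge // /vertices (bigD1 tt) //= big1 => [|[] //].
rewrite Monoid.mulm1 /vertex wrenE /emb; congr wof; apply/funext => i /=.
  by rewrite (@at_in_eq _ _ (iota_graph p) tt i (inr i) erefl i).
by rewrite (@at_out_eq _ _ (iota_graph p) tt i (inr i) erefl i).
Qed.

Lemma val_relabel_at (S S' : finType) n (lab : S -> 'I_n.+1) i y (labB : bijective lab)
    (laby : lab y = i) (h : S' -> S) (hy : forall x, h x != y) x :
  lab (h x) = bump i (relabel_at labB laby hy x) :> nat.
Proof. by rewrite -(relabelE (inj_avoid (bij_inj labB) laby hy) x). Qed.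

Lemma lab_eq (S : finType) n (lab : S -> 'I_n) i y : bijective lab -> lab y = i ->
  forall x, (lab x == i :> nat) = (x == y).
Proof. by move=> labB <- x; rewrite (inj_eq val_inj) (inj_eq (bij_inj labB)). Qed.

Section Trace.
Variables (k l : nat) (G : graph X k.+1 l.+1) (i : 'I_k.+1) (j : 'I_l.+1).

Lemma solW_tr_input_output e g (ei : ilab G (inl e) = i) (gj : olab G (inl g) = j) :
  solW (tr_input_output ei gj)
  = wren (unbump i) (unbump j) (wtr (nat_of_ord i) (nat_of_ord j) (solW G)).
Proof.
have ui : inlab (inr e) = i :> nat by rewrite /inlab ei.
have uj : outlab (inr g) = j :> nat by rewrite /outlab gj.
rewrite {2}/solW -ui -uj wtr_ren ?once_core //; last first.
  rewrite -/(solW G) /once in_occ_solW out_occ_solW; apply/andP; split; rewrite eqb1; apply/existsP.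
    by exists e.
  by exists g.
rewrite (core_tr_input_output ei gj) /solW !wren_comp; apply: eq_wren; last first.
  move=> [y /out_occ_core_edge []|x _].
  have := val_relabel_at (olab_bij G) gj (@drop_l_neq _ _ g) (inl x).
  by rewrite /= gj => ->; rewrite bumpK.
move=> [y /in_occ_core_edge []|x _].
have := val_relabel_at (ilab_bij G) ei (@drop_l_neq _ _ e) (inl x).
by rewrite /= ei => ->; rewrite bumpK.
Qed.

(** The input edge e takes over the input label of g. *)
Lemma solW_tr_input_io e g (ei : ilab G (inl e) = i) (gj : olab G (inr g) = j) :
  solW (tr_input_io ei gj)
  = wren (fun x : nat => unbump i (if x == i :> nat then ilab G (inr g) : nat else x)) (unbump j) (solW G).
Proof.
rewrite /solW wren_comp; apply: eq_wren => -[y pos|x _ /=];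
  try by [case: (in_occ_core_edge pos) | case: (out_occ_core_edge pos)].
  have := val_relabel_at (ilab_bij G) ei (@redirect_drop_neq _ _ g (inl e) erefl) (inl x).
  rewrite (lab_eq (ilab_bij G) ei (inl x)).
  by rewrite /redirect /=; case: ifP => _ ->; rewrite bumpK.
have := val_relabel_at (olab_bij G) gj (@drop_r_neq _ _ g) (inl x).
by rewrite /= => ->; rewrite bumpK.
Qed.

(** The output edge or input-output edge g takes over the output label of e. *)
Lemma solW_tr_io_other e g (ge : g != inr e) (ei : ilab G (inr e) = i) (gj : olab G g = j) :
  solW (tr_io_other ge ei gj)
  = wren (unbump i) (fun y : nat => unbump j (if y == j :> nat then olab G (inr e) : nat else y)) (solW G).
Proof.
rewrite /solW wren_comp; apply: eq_wren => -[y pos|x _ /=];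
  try by [case: (in_occ_core_edge pos) | case: (out_occ_core_edge pos)].
  have := val_relabel_at (ilab_bij G) ei (@drop_r_neq _ _ e) (inl x).
  by rewrite /= => ->; rewrite bumpK.
have := val_relabel_at (olab_bij G) gj (redirect_drop_neq ge) (inl x).
rewrite (lab_eq (olab_bij G) gj (inl x)).
by rewrite /redirect /=; case: ifP => _ ->; rewrite bumpK.
Qed.

Lemma solW_tr_io_same e (ei : ilab G (inr e) = i) (ej : olab G (inr e) = j) :
  solW (tr_io_same ei ej) = wren (unbump i) (unbump j) (solW G).
Proof.
rewrite /solW wren_comp; apply: eq_wren => -[y pos|x _ /=];
  try by [case: (in_occ_core_edge pos) | case: (out_occ_core_edge pos)].
  have := val_relabel_at (ilab_bij G) ei (@drop_r_neq _ _ e) (inl x).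
  by rewrite /= => ->; rewrite bumpK.
have := val_relabel_at (olab_bij G) ej (@drop_r_neq _ _ e) (inl x).
by rewrite /= => ->; rewrite bumpK.
Qed.

(** The four cases of the partial trace, without reference to the chosen inverses of
    the labellings. *)
Variant gtr_spec : graph X k l -> Type :=
| GtrInputOutput e g (ei : ilab G (inl e) = i) (gj : olab G (inl g) = j) :
    gtr_spec (tr_input_output ei gj)
| GtrInputIO e g (ei : ilab G (inl e) = i) (gj : olab G (inr g) = j) :
    gtr_spec (tr_input_io ei gj)
| GtrIOOther e g (ge : g != inr e) (ei : ilab G (inr e) = i) (gj : olab G g = j) :
    gtr_spec (tr_io_other ge ei gj)
| GtrIOSame e (ei : ilab G (inr e) = i) (ej : olab G (inr e) = j) :
    gtr_spec (tr_io_same ei ej).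

Lemma gtrP : gtr_spec (gtr G i j).
Proof.
rewrite /gtr; move: (bij_invK _ _) (bij_invK _ _).
case: (bij_inv _ i) => e; last first.
  by move=> ei gj /=; case: eqVneq => ge; [apply: GtrIOSame | apply: GtrIOOther].
by case: (bij_inv _ j) => g ei gj; [apply: GtrInputOutput | apply: GtrInputIO].
Qed.

End Trace.
End Core.

(** * Evaluation of graphs, solar and unitary *)

Lemma gcls_rep X k l (G : graph X k l) : isomorphic G (rep (gcls G)).
Proof. by apply: rep_cls => H; apply: isomorphic_refl. Qed.

Section Solar.
Variable P : trap.
Let idval k l (p : P k l) : P k l := p.

Lemma sum_lab (S T : finType) n (lab : S + T -> 'I_n) x : bijective lab ->
  \sum_s (lab (inl s) == x :> nat) + \sum_t (lab (inr t) == x :> nat) = (x < n).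
Proof.
move=> labB; rewrite -(occ_val n x) /occ (reindex lab) /=; last exact: onW_bij.
by rewrite big_sumType.
Qed.

(** Without input-output edges, the labels of the solar part are all the positions. *)
Lemma solar_value k l (G : graph P k l) : solar G -> exists p : P k l, solW idval G = emb p.
Proof.
move=> [noIO _]; apply: embP => x.
  by rewrite -(sum_lab x (ilab_bij G)) in_occ_solW_sum [X in _ + X]big1 ?addn0.
by rewrite -(sum_lab x (olab_bij G)) out_occ_solW_sum [X in _ + X]big1 ?addn0.
Qed.

Definition phi k l (x : solCGr_trap P k l) : P k l :=
  sval (cid (solar_value (solar_rep (svalP x)))).

Lemma emb_phi k l (x : solCGr_trap P k l) : emb (phi x) = solW idval (rep (sval x)).
Proof. by rewrite /phi; case: cid. Qed.

Lemma solW_rep k l (G : graph P k l) : solW idval (rep (gcls G)) = solW idval G.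
Proof. by rewrite -(solW_iso idval (gcls_rep G)). Qed.

(** The value 0 beyond n is arbitrary. *)
Definition pext n (s : 'S_n) (x : nat) : nat := oapp (fun i => nat_of_ord (s i)) 0 (insub x).

Lemma pextE n (s : 'S_n) (i : 'I_n) : pext s (nat_of_ord i) = s i.
Proof. by rewrite /pext valK. Qed.

(** Each operation on graphs is matched by an operation on elements with names; the
    partial trace of a solar graph always joins an input edge to an output edge. *)
Lemma phi_evaluation : is_evaluation phi.
Proof.
split=> [|k l p]; last first.
  by apply: emb_inj; rewrite emb_phi /= solW_rep solW_iota.
split.
- move=> k l s x; apply: emb_inj; rewrite emb_phi /= solW_rep (solW_glact _ _ (pextE s)).
  by rewrite (emb_lact _ (pextE s)) emb_phi.
- move=> k l x s; apply: emb_inj; rewrite emb_phi /= solW_rep (solW_gract _ _ (pextE s^-1)).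
  by rewrite (emb_ract _ (pextE s^-1)) emb_phi.
- by apply: emb_inj; rewrite emb_phi /= solW_rep solW_gempty emb_hunit.
- move=> k l k' l' x y; apply: emb_inj.
  by rewrite emb_phi /= solW_rep solW_disj_union emb_hcat !emb_phi.
- move=> k l i j x; apply: emb_inj; rewrite emb_phi /= solW_rep emb_ptr emb_phi.
  have [noIO _] := solar_rep (svalP x).
  case: gtrP => [e g ei gj|e g ei gj|e g ge ei gj|e ei ej]; first exact: solW_tr_input_output.
  - by case: (noIO g).
  - by case: (noIO e).
  - by case: (noIO e).
Qed.

End Solar.

Lemma big_sub_neq (R : Type) (idx : R) (op : Monoid.com_law idx) (T : finType) (g : T)
    (F : T -> R) :
  \big[op/idx]_(x : {x : T | x != g}) F (val x) = \big[op/idx]_(x | x != g) F x.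
Proof. by rewrite (big_sub (predC1 g)). Qed.

Section Unitary.
Variables (X : nat -> nat -> Type) (Q : utrap) (f : forall k l, X k l -> Q k l).
Let T := utrap_trap Q.
Let fT : forall k l, X k l -> T k l := f.

Definition wloop (A B : Type) : wiring T A B :=
  wof (ptr ord0 ord0 (tunit : T 1 1)) (@no_name A) (@no_name B).

Lemma wren_loop A B A' B' (h : A -> A') (h' : B -> B') : wren h h' (wloop A B) = wloop A' B'.
Proof. by rewrite wrenE; congr wof; apply: no_nameE. Qed.

Lemma wtr_unit_loop (A B : eqType) (a : A) (b : B) : wtr a b (wunit Q a b) = wloop A B.
Proof.
pose F := fun _ : 'I_1 => a; pose G := fun _ : 'I_1 => b.
have -> : wtr a b = @wtr T A B (F ord0) (G ord0) by [].
rewrite wtrE ?/occ ?big_ord_recl ?big_ord0 ?eqxx //.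
by congr wof; apply: no_nameE.
Qed.

Section OneGraph.
Variables (k l : nat) (G : graph X k l).

Definition ioW : wiring T nat nat :=
  \big[wmul/wone]_(e : gIO G) wunit Q (nat_of_ord (ilab G (inr e))) (nat_of_ord (olab G (inr e))).

Definition loopW : wiring T nat nat := \big[wmul/wone]_(e : gL G) wloop nat nat.

(** The value of a graph in a unitary TRAP: each input-output edge contributes a unit
    with its two labels, each loop a traced unit. *)
Definition evW : wiring T nat nat := wmul (solW fT G) (wmul ioW loopW).

Lemma in_occ_loopW n : in_occ loopW n = 0.
Proof. by rewrite in_occ_prod big1 // => e _; rewrite in_occE /occ big_ord0. Qed.

Lemma out_occ_loopW n : out_occ loopW n = 0.
Proof. by rewrite out_occ_prod big1 // => e _; rewrite out_occE /occ big_ord0. Qed.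

Lemma in_occ_evW n : in_occ evW n = (n < k).
Proof.
rewrite !in_occ_mul in_occ_loopW addn0 in_occ_solW_sum in_occ_prod -(sum_lab n (ilab_bij G)).
by congr (_ + _); apply: eq_bigr => e _; rewrite in_occ_unit.
Qed.

Lemma out_occ_evW n : out_occ evW n = (n < l).
Proof.
rewrite !out_occ_mul out_occ_loopW addn0 out_occ_solW_sum out_occ_prod -(sum_lab n (olab_bij G)).
by congr (_ + _); apply: eq_bigr => e _; rewrite out_occ_unit.
Qed.

Definition ev : Q k l := sval (cid (embP in_occ_evW out_occ_evW)).

Lemma emb_ev : emb (ev : T k l) = evW.
Proof. by rewrite /ev; case: cid. Qed.

End OneGraph.

Lemma ev_eq k l (G : graph X k l) (q : Q k l) : evW G = emb (q : T k l) -> ev G = q.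
Proof. by move=> Gq; apply: (@emb_inj T); rewrite emb_ev. Qed.

Lemma wren_loopW k l (G : graph X k l) h h' : wren h h' (loopW G) = loopW G.
Proof. by rewrite wren_prod; apply: eq_bigr => e _; rewrite wren_loop. Qed.

Lemma wren_ioW k l (G : graph X k l) (h h' : nat -> nat) : wren h h' (ioW G) =
  \big[wmul/wone]_(e : gIO G) wunit Q (h (ilab G (inr e))) (h' (olab G (inr e))).
Proof. by rewrite wren_prod; apply: eq_bigr => e _; rewrite wren_unit. Qed.

Lemma evW_iso k l (G H : graph X k l) : isomorphic G H -> evW G = evW H.
Proof.
move=> GH; rewrite /evW (solW_iso fT GH); case: GH => F; congr (wmul _ (wmul _ _)).
  rewrite [RHS](reindex (isoIO F)) /=; last exact/onW_bij/isoIO_bij.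
  apply: eq_bigr => e _.
  by have /= -> := iso_ilab F (inr e); have /= -> := iso_olab F (inr e).
by rewrite [RHS](reindex (isoL F)) //; apply/onW_bij/isoL_bij.
Qed.

Lemma evW_glact k l (s : 'S_l) (G : graph X k l) (h : nat -> nat) :
  (forall i, h (nat_of_ord i) = s i) -> evW (glact s G) = wren id h (evW G).
Proof.
move=> hs; rewrite /evW (solW_glact fT G hs) !wren_mul wren_loopW wren_ioW.
by congr (wmul _ (wmul _ _)); apply: eq_bigr => e _; rewrite hs.
Qed.

Lemma evW_gract k l (G : graph X k l) (s : 'S_k) (h : nat -> nat) :
  (forall i, h (nat_of_ord i) = (s^-1)%g i) -> evW (gract G s) = wren h id (evW G).
Proof.
move=> hs; rewrite /evW (solW_gract fT G hs) !wren_mul wren_loopW wren_ioW.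
by congr (wmul _ (wmul _ _)); apply: eq_bigr => e _; rewrite hs.
Qed.

Lemma evW_solar k l (G : graph X k l) : solar G -> evW G = solW fT G.
Proof.
move=> [noIO noL]; rewrite /evW /ioW /loopW big_pred0; last by move=> e; case: (noIO e).
by rewrite big_pred0 ?Monoid.mulm1 // => e; case: (noL e).
Qed.

Lemma ev_gempty : ev (gempty X) = hunit.
Proof. by apply: ev_eq; rewrite evW_solar ?solW_gempty -?(emb_hunit T) //; split; case. Qed.

Lemma ev_iota k l (p : X k l) : ev (iota_graph p) = f p.
Proof. by apply: ev_eq; rewrite evW_solar ?solW_iota //; split; case. Qed.

Lemma ev_gunit : ev (gunit X) = tunit.
Proof.
apply: ev_eq; rewrite /evW solW_gunit wmul1w.
have -> : loopW (gunit X) = wone by apply: big_pred0 => -[].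
rewrite wmulC wmul1w /ioW (bigD1 tt) //= big1 => [|[]//]; rewrite wmulC wmul1w.
by congr wof; apply/funext => i; rewrite [i]ord1.
Qed.

Lemma ev_disj_union k l (G : graph X k l) k' l' (H : graph X k' l') :
  ev (disj_union G H) = hcat (ev G) (ev H).
Proof.
apply: ev_eq; rewrite (emb_hcat (P := T)) !emb_ev /evW solW_disj_union !wren_mul.
rewrite wren_loopW wren_ioW.
have -> : ioW (disj_union G H) = wmul (ioW G) (wren (addn k) (addn l) (ioW H)).
  by rewrite wren_ioW /ioW big_sumType.
have -> : loopW (disj_union G H) = wmul (loopW G) (loopW H) by rewrite /loopW big_sumType.
by rewrite -wren_ioW (wmulACA (ioW G)) (wmulACA (solW fT G)).
Qed.

Section Trace.
Variables (k l : nat) (G : graph X k.+1 l.+1) (i : 'I_k.+1) (j : 'I_l.+1).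

Lemma in_occ_ioW n : in_occ (ioW G) n = [exists e, ilab G (inr e) == n :> nat].
Proof.
rewrite in_occ_prod -sum_eq_inj => [|e e' /ord_inj /(bij_inj (ilab_bij G))[->] //].
by apply: eq_bigr => e _; rewrite in_occ_unit.
Qed.

Lemma out_occ_ioW n : out_occ (ioW G) n = [exists e, olab G (inr e) == n :> nat].
Proof.
rewrite out_occ_prod -sum_eq_inj => [|e e' /ord_inj /(bij_inj (olab_bij G))[->] //].
by apply: eq_bigr => e _; rewrite out_occ_unit.
Qed.

(** At an input-output edge, the corresponding unit is split off, and tracing against it
    is a renaming. *)
Lemma evW_gtr : evW (gtr G i j)
  = wren (unbump i) (unbump j) (wtr (nat_of_ord i) (nat_of_ord j) (evW G)).
Proof.
have wi : in_occ (evW G) i = 1 by rewrite in_occ_evW ltn_ord.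
have wo : out_occ (evW G) j = 1 by rewrite out_occ_evW ltn_ord.
have outer e : ioW G = wmul (wunit Q (nat_of_ord (ilab G (inr e))) (nat_of_ord (olab G (inr e))))
   (\big[wmul/wone]_(x : {x : gIO G | x != e})
       wunit Q (nat_of_ord (ilab G (inr (val x)))) (nat_of_ord (olab G (inr (val x))))).
  rewrite /ioW (bigD1 e) //=; congr wmul; symmetry.
  exact: (big_sub_neq _ e (fun x => wunit Q (nat_of_ord (ilab G (inr x))) (nat_of_ord (olab G (inr x))))).
have mul_out (a b c d : wiring T nat nat) : wmul a (wmul (wmul b c) d) = wmul b (wmul a (wmul c d)).
  by rewrite -[in LHS]wmulA wmulA (wmulC a b) -wmulA.
case: gtrP => [e g ei gj|e g ei gj|e g ge ei gj|e ei ej].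
- rewrite /evW solW_tr_input_output wtr_mul; first 1 last.
  + rewrite /once in_occ_solW out_occ_solW; apply/andP; split; rewrite eqb1; apply/existsP.
      by exists e; rewrite /inlab ei.
    by exists g; rewrite /outlab gj.
  + rewrite in_occ_mul in_occ_loopW addn0 in_occ_ioW; apply/eqP; rewrite eqb0.
    by apply/existsP => -[e']; rewrite (lab_eq (ilab_bij G) ei).
  + rewrite out_occ_mul out_occ_loopW addn0 out_occ_ioW; apply/eqP; rewrite eqb0.
    by apply/existsP => -[e']; rewrite (lab_eq (olab_bij G) gj).
  rewrite !wren_mul wren_loopW; congr (wmul _ (wmul _ _)).
  rewrite wren_ioW; apply: eq_bigr => x _.
  have := val_relabel_at (ilab_bij G) ei (@drop_l_neq _ _ e) (inr x); rewrite /= => ->.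
  have := val_relabel_at (olab_bij G) gj (@drop_l_neq _ _ g) (inr x); rewrite /= => ->.
  by rewrite !bumpK.
- have ig : (i : nat) != ilab G (inr g).
    by rewrite eq_sym (lab_eq (ilab_bij G) ei).
  move: wi wo; rewrite /evW (outer g) gj mul_out in_occ_mul out_occ_mul in_occ_unit out_occ_unit.
  rewrite eqxx eq_sym (negPf ig) add0n add1n => wi [wo].
  rewrite wtr_unit_in // wren_comp !wren_mul; congr (wmul _ (wmul _ _)).
  + rewrite solW_tr_input_io; exact: eq_wren.
  + rewrite wren_prod; apply: eq_bigr => x _; rewrite wren_unit /=.
    rewrite (lab_eq (ilab_bij G) ei) /=.
    have := val_relabel_at (ilab_bij G) ei (@redirect_drop_neq _ _ g (inl e) erefl) (inr x).
    rewrite /= => ->.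
    have := val_relabel_at (olab_bij G) gj (@drop_r_neq _ _ g) (inr x); rewrite /= => ->.
    by rewrite !bumpK.
  + by rewrite wren_loopW.
- have jg : (j : nat) != olab G (inr e).
    by rewrite eq_sym (lab_eq (olab_bij G) gj) eq_sym.
  move: wi wo; rewrite /evW (outer e) ei mul_out in_occ_mul out_occ_mul in_occ_unit out_occ_unit.
  rewrite eqxx [_ == j :> nat]eq_sym (negPf jg) add0n add1n => -[wi] wo.
  rewrite wtr_unit_out // wren_comp !wren_mul; congr (wmul _ (wmul _ _)).
  + rewrite solW_tr_io_other; exact: eq_wren.
  + rewrite wren_prod; apply: eq_bigr => x _; rewrite wren_unit /=.
    have := val_relabel_at (ilab_bij G) ei (@drop_r_neq _ _ e) (inr x); rewrite /= => ->.
    have := val_relabel_at (olab_bij G) gj (redirect_drop_neq ge) (inr x).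
    rewrite (lab_eq (olab_bij G) gj) /redirect /= eq_sym.
    by case: ifP => _ ->; rewrite !bumpK.
  + by rewrite wren_loopW.
- move: wi wo; rewrite /evW (outer e) ei ej mul_out in_occ_mul out_occ_mul in_occ_unit out_occ_unit.
  rewrite !eqxx !add1n => -[wi] [wo].
  rewrite wtr_mul //; last by rewrite /once in_occ_unit out_occ_unit !eqxx.
  rewrite wtr_unit_loop !wren_mul wren_loop wren_loopW solW_tr_io_same.
  have -> : loopW (tr_io_same ei ej) = wmul (wloop nat nat) (loopW G).
    by rewrite /loopW !big_const card_option iterS.
  have -> : ioW (tr_io_same ei ej) = wren (unbump i) (unbump j)
    (\big[wmul/wone]_(x : {x : gIO G | x != e})
       wunit Q (nat_of_ord (ilab G (inr (val x)))) (nat_of_ord (olab G (inr (val x))))).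
    rewrite wren_prod; apply: eq_bigr => x _; rewrite wren_unit.
    have := val_relabel_at (ilab_bij G) ei (@drop_r_neq _ _ e) (inr x); rewrite /= => ->.
    have := val_relabel_at (olab_bij G) ej (@drop_r_neq _ _ e) (inr x); rewrite /= => ->.
    by rewrite !bumpK.
  by rewrite !wmulA [wmul (wloop _ _) _]wmulC -!wmulA [wmul (wloop _ _) (wmul _ _)]wmulA
     [wmul (wloop _ _) (wren _ _ _)]wmulC -wmulA.
Qed.

End Trace.

Lemma ev_gtr k l (G : graph X k.+1 l.+1) i j : ev (gtr G i j) = ptr i j (ev G).
Proof. by apply: ev_eq; rewrite (emb_ptr (P := T)) emb_ev evW_gtr. Qed.

Lemma ev_glact k l (s : 'S_l) (G : graph X k l) : ev (glact s G) = lact s (ev G).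
Proof.
by apply: ev_eq; rewrite (evW_glact _ (pextE s)) (emb_lact (P := T) _ (pextE s)) emb_ev.
Qed.

Lemma ev_gract k l (G : graph X k l) (s : 'S_k) : ev (gract G s) = ract (ev G) s.
Proof.
apply: ev_eq; rewrite (evW_gract _ (pextE s^-1)) (emb_ract (P := T) _ (pextE s^-1)).
by rewrite emb_ev.
Qed.

End Unitary.

(** * Isomorphisms of graphs *)

Lemma sum_map_comp (A A' A'' B B' B'' : Type) (f : A -> A') (g : B -> B')
    (f' : A' -> A'') (g' : B' -> B'') x :
  sum_map f' g' (sum_map f g x) = sum_map (f' \o f) (g' \o g) x.
Proof. by case: x. Qed.

Section Isomorphisms.
Variable X : nat -> nat -> Type.

Lemma isomorphic_trans k l (G H K : graph X k l) :
  isomorphic G H -> isomorphic H K -> isomorphic G K.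
Proof.
move=> [F] [F']; split.
apply: (@GraphIso _ _ _ G K (isoV F' \o isoV F) (isoE F' \o isoE F) (isoI F' \o isoI F)
  (isoO F' \o isoO F) (isoIO F' \o isoIO F) (isoL F' \o isoL F)).
1-6: by apply: bij_comp; case: F => *; case: F' => *.
- by move=> v /=; rewrite !iso_dec.
- by move=> x; rewrite -sum_map_comp !iso_tgt.
- by move=> x; rewrite -sum_map_comp !iso_src.
- by move=> x; rewrite -sum_map_comp !iso_ilab.
- by move=> x; rewrite -sum_map_comp !iso_olab.
Qed.

Lemma bij_inv_bij (S T : finType) (f : S -> T) (fB : bijective f) :
  bijective (bij_inv fB).
Proof.
by exists f => x; [apply: bij_invK | apply: (bij_inj fB); rewrite bij_invK].
Qed.

Lemma sum_map_invK (S T S' T' : finType) (f : S -> T) (fB : bijective f)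
    (f' : S' -> T') (fB' : bijective f') x :
  sum_map f f' (sum_map (bij_inv fB) (bij_inv fB') x) = x.
Proof. by case: x => x /=; rewrite bij_invK. Qed.

Lemma isomorphic_sym k l (G H : graph X k l) : isomorphic G H -> isomorphic H G.
Proof.
move=> [F]; split.
have tK (x : gE H + gI H) : port (tgt H x) =
   (isoV F (port (tgt G (sum_map (bij_inv (isoE_bij F)) (bij_inv (isoI_bij F)) x))).1,
    (port (tgt G (sum_map (bij_inv (isoE_bij F)) (bij_inv (isoI_bij F)) x))).2).
  by rewrite -iso_tgt sum_map_invK.
have sK (x : gE H + gO H) : port (src H x) =
   (isoV F (port (src G (sum_map (bij_inv (isoE_bij F)) (bij_inv (isoO_bij F)) x))).1,
    (port (src G (sum_map (bij_inv (isoE_bij F)) (bij_inv (isoO_bij F)) x))).2).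
  by rewrite -iso_src sum_map_invK.
have vK v : bij_inv (isoV_bij F) (isoV F v) = v.
  by apply: (bij_inj (isoV_bij F)); rewrite bij_invK.
apply: (@GraphIso _ _ _ H G (bij_inv (isoV_bij F)) (bij_inv (isoE_bij F))
  (bij_inv (isoI_bij F)) (bij_inv (isoO_bij F)) (bij_inv (isoIO_bij F)) (bij_inv (isoL_bij F)));
  try exact: bij_inv_bij.
- by move=> v; rewrite -{2}[v](bij_invK (isoV_bij F)) iso_dec.
- by move=> x; rewrite tK vK; case: port.
- by move=> x; rewrite sK vK; case: port.
- by move=> x; rewrite -{2}[x](sum_map_invK (isoI_bij F) (isoIO_bij F)) iso_ilab.
- by move=> x; rewrite -{2}[x](sum_map_invK (isoO_bij F) (isoIO_bij F)) iso_olab.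
Qed.

(** Isomorphism is an equivalence relation, hence isomorphic graphs have equal classes. *)
Lemma eq_gcls k l (G H : graph X k l) : isomorphic G H -> gcls G = gcls H.
Proof.
move=> GH; apply: eq_exist; apply/funext => K; apply/propext; split.
  exact/isomorphic_trans/isomorphic_sym.
exact: isomorphic_trans.
Qed.

Lemma glact_iso k l (s : 'S_l) (G H : graph X k l) :
  isomorphic G H -> isomorphic (glact s G) (glact s H).
Proof.
case=> F; split.
apply: (@GraphIso _ _ _ (glact s G) (glact s H) (isoV F) (isoE F) (isoI F) (isoO F) (isoIO F) (isoL F));
  try by case: F.
by move=> x; rewrite /= iso_olab.
Qed.

Lemma gract_iso k l (s : 'S_k) (G H : graph X k l) :
  isomorphic G H -> isomorphic (gract G s) (gract H s).
Proof.
case=> F; split.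
apply: (@GraphIso _ _ _ (gract G s) (gract H s) (isoV F) (isoE F) (isoI F) (isoO F) (isoIO F) (isoL F));
  try by case: F.
by move=> x; rewrite /= iso_ilab.
Qed.

Lemma disj_union_iso k l (G G' : graph X k l) k' l' (H H' : graph X k' l') :
  isomorphic G G' -> isomorphic H H' -> isomorphic (disj_union G H) (disj_union G' H').
Proof.
case=> F [F']; split.
apply: (@GraphIso _ _ _ (disj_union G H) (disj_union G' H')
  (sum_map (isoV F) (isoV F')) (sum_map (isoE F) (isoE F')) (sum_map (isoI F) (isoI F'))
  (sum_map (isoO F) (isoO F')) (sum_map (isoIO F) (isoIO F')) (sum_map (isoL F) (isoL F'))).
1-6: by apply: sum_map_bij; case: F => *; case: F' => *.
- by case=> v /=; [have := iso_dec F v | have := iso_dec F' v].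
- case=> -[] x; rewrite /port /=.
  + by have [] := iso_tgt F (inl x); rewrite /port /= => e1 ->; rewrite e1.
  + by have [] := iso_tgt F' (inl x); rewrite /port /= => e1 ->; rewrite e1.
  + by have [] := iso_tgt F (inr x); rewrite /port /= => e1 ->; rewrite e1.
  + by have [] := iso_tgt F' (inr x); rewrite /port /= => e1 ->; rewrite e1.
- case=> -[] x; rewrite /port /=.
  + by have [] := iso_src F (inl x); rewrite /port /= => e1 ->; rewrite e1.
  + by have [] := iso_src F' (inl x); rewrite /port /= => e1 ->; rewrite e1.
  + by have [] := iso_src F (inr x); rewrite /port /= => e1 ->; rewrite e1.
  + by have [] := iso_src F' (inr x); rewrite /port /= => e1 ->; rewrite e1.
- case=> -[] x /=.
  + by have /= -> := iso_ilab F (inl x).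
  + by have /= -> := iso_ilab F' (inl x).
  + by have /= -> := iso_ilab F (inr x).
  + by have /= -> := iso_ilab F' (inr x).
- case=> -[] x /=.
  + by have /= -> := iso_olab F (inl x).
  + by have /= -> := iso_olab F' (inl x).
  + by have /= -> := iso_olab F (inr x).
  + by have /= -> := iso_olab F' (inr x).
Qed.

Section SubMap.
Variables (S T : finType) (h : S -> T) (hB : bijective h) (e : S).

Lemma sub_map_proof (x : {x : S | x != e}) : h (val x) != h e.
Proof. by rewrite (inj_eq (bij_inj hB)) (valP x). Qed.

Definition sub_map (x : {x : S | x != e}) : {y : T | y != h e} :=
  exist _ (h (val x)) (sub_map_proof x).

Lemma sub_map_bij : bijective sub_map.
Proof.
apply: inj_surj_bij => [x y /(congr1 val) /= /(bij_inj hB) /val_inj //|[y yn]].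
have [g _ gK] := hB.
have ge : g y != e by apply: contraNneq yn => <-; rewrite gK.
by exists (exist _ (g y) ge); apply: val_inj; rewrite /= gK.
Qed.
End SubMap.

Lemma omap_bij (S T : Type) (h : S -> T) : bijective h -> bijective (omap h).
Proof. by case=> g hK gK; exists (omap g) => -[x|] //=; rewrite ?hK ?gK. Qed.

Lemma relabel_at_eq (S S' T T' : finType) n (lab : S -> 'I_n.+1) (lab2 : T -> 'I_n.+1) i y z
    (labB : bijective lab) (laby : lab y = i) (lab2B : bijective lab2) (lab2z : lab2 z = i)
    (h : S' -> S) (hy : forall x, h x != y) (h2 : T' -> T) (h2z : forall x, h2 x != z) x x' :
  lab (h x) = lab2 (h2 x') -> relabel_at labB laby hy x = relabel_at lab2B lab2z h2z x'.
Proof. by move=> E; apply: (@lift_inj _ i); rewrite !relabelE. Qed.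

(** An isomorphism carries the edges joined by the trace to the edges joined by the
    trace, since it preserves labels.  In a solar graph these are an input edge and an
    output edge. *)
Lemma gtr_iso_solar k l (G H : graph X k.+1 l.+1) i j :
  solar G -> isomorphic G H -> isomorphic (gtr G i j) (gtr H i j).
Proof.
move=> Gs [F]; have [noIO _] := Gs.
have noIO' (x : gIO H) : False by case: (isoIO_bij F) => f _ _; apply: noIO (f x).
case: (gtrP G i j) => [e g ei gj|e g ei gj|e g ge ei gj|e ei ej];
  try by [case: (noIO g) | case: (noIO e)].
case: (gtrP H i j) => [e' g' ei' gj'|e' g' ei' gj'|e' g' ge' ei' gj'|e' ei' ej'];
  try by [case: (noIO' g') | case: (noIO' e')].
have ee : e' = isoI F e.
  have [//] : inl e' = inl (isoI F e) :> gI H + gIO H.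
  by apply: (bij_inj (ilab_bij H)); rewrite ei' -ei -(iso_ilab F).
have gg : g' = isoO F g.
  have [//] : inl g' = inl (isoO F g) :> gO H + gIO H.
  by apply: (bij_inj (olab_bij H)); rewrite gj' -gj -(iso_olab F).
subst e' g'; split.
apply: (@GraphIso _ _ _ (tr_input_output ei gj) (tr_input_output ei' gj')
  (isoV F) (omap (isoE F)) (sub_map (isoI_bij F) (e:=e)) (sub_map (isoO_bij F) (e:=g))
  (isoIO F) (isoL F)).
- exact: (isoV_bij F).
- exact: omap_bij (isoE_bij F).
- exact: sub_map_bij.
- exact: sub_map_bij.
- exact: (isoIO_bij F).
- exact: (isoL_bij F).
- exact: (iso_dec F).
- case=> [[x|]|x] /=.
  + exact: (iso_tgt F (inl x)).
  + exact: (iso_tgt F (inr e)).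
  + exact: (iso_tgt F (inr (val x))).
- case=> [[x|]|x] /=.
  + exact: (iso_src F (inl x)).
  + exact: (iso_src F (inr g)).
  + exact: (iso_src F (inr (val x))).
- case=> x /=; apply: relabel_at_eq; first exact: (iso_ilab F (inl (val x))).
  exact: (iso_ilab F (inr x)).
- case=> x /=; apply: relabel_at_eq; first exact: (iso_olab F (inl (val x))).
  exact: (iso_olab F (inr x)).
Qed.

End Isomorphisms.

(** * Solar graphs are generated by corollas *)

Section Cut.
Variables (X : nat -> nat -> Type) (k l : nat) (G : graph X k l) (e0 : gE G).

Definition cut_ends (A : finType) (x : {e : gE G | e != e0} + option A) : gE G + A :=
  match x with
  | inl e => inl (val e)
  | inr None => inl e0
  | inr (Some a) => inr a
  end.

Lemma cut_ends_bij (A : finType) : bijective (@cut_ends A).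
Proof.
apply: inj_surj_bij => [[x|[x|]] [y|[y|]]|[y|y]] //=.
- by move=> [/val_inj ->].
- by move=> [e]; case/eqP: (valP x).
- by move=> [->].
- by move=> [e]; case/eqP: (valP y).
- have [->|ye] := eqVneq y e0; first by exists (inr None).
  by exists (inl (exist _ y ye)).
- by exists (inr (Some y)).
Qed.

Definition cut_lab (A B : finType) n (lab : A + B -> 'I_n) (x : option A + B) : 'I_n.+1 :=
  match x with
  | inl None => ord0
  | inl (Some a) => lift ord0 (lab (inl a))
  | inr b => lift ord0 (lab (inr b))
  end.

Lemma cut_lab_bij (A B : finType) n (lab : A + B -> 'I_n) :
  bijective lab -> bijective (cut_lab lab).
Proof.
move=> labB; apply: inj_surj_bij => [[[x|]|x] [[y|]|y]|y] //=;
  try by [move=> /(@lift_inj _ ord0) /(bij_inj labB) [->]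
    | move=> /(@lift_inj _ ord0) /(bij_inj labB) | move=> /(congr1 val)].
case: (unliftP ord0 y) => [z ->|->]; last by exists (inl None).
have [g _ gK] := labB; rewrite -(gK z); case: (g z) => a.
  by exists (inl (Some a)).
by exists (inr a).
Qed.

(** The graph G with the internal edge e0 cut: its two halves, represented by None,
    become the input and the output of label 0. *)
Definition cut : graph X k.+1 l.+1 :=
  @Graph X k.+1 l.+1 (gV G) {e : gE G | e != e0} (option (gI G)) (option (gO G))
    (gIO G) (gL G) (ain G) (aout G) (dec G) (tgt G \o @cut_ends _) (src G \o @cut_ends _)
    (cut_lab (ilab G)) (cut_lab (olab G))
    (bij_comp (tgt_bij G) (@cut_ends_bij _)) (bij_comp (src_bij G) (@cut_ends_bij _))
    (cut_lab_bij (ilab_bij G)) (cut_lab_bij (olab_bij G)).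

Lemma insub_bij (T : finType) (x0 : T) :
  bijective (insub : T -> option {x : T | x != x0}).
Proof.
apply: inj_surj_bij => [x y|[y|]].
- case: insubP => [u _ <-|]; case: insubP => [v _ <-|] //; first by move=> [->].
  by rewrite !negbK => /eqP -> /eqP ->.
- by exists (val y); rewrite valK.
- by exists x0; case: insubP => // u; rewrite eqxx.
Qed.

Definition some_neq (T : eqType) (x : T) : {y : option T | y != None} :=
  exist _ (Some x) isT.

Lemma some_neq_bij (T : finType) : bijective (@some_neq T).
Proof.
by apply: inj_surj_bij => [x y [->] //|[[y|] //= yn]]; exists y; apply: val_inj.
Qed.

(** Joining the two halves restores the edge. *)
Lemma gtr_cut : isomorphic G (gtr cut ord0 ord0).
Proof.
case: (gtrP cut ord0 ord0) => [[e|] [g|] ei gj|e g ei gj|e [g|g] ge ei gj|e ei ej] //; split.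
apply: (@GraphIso _ _ _ G (tr_input_output ei gj) id insub (@some_neq _) (@some_neq _) id id).
- by exists id.
- exact: insub_bij.
- exact: some_neq_bij.
- exact: some_neq_bij.
- by exists id.
- by exists id.
- by [].
- case=> x /=; last by [].
  case: insubP => [u _ <-|] /=; first by [].
  by rewrite negbK => /eqP ->.
- case=> x /=; last by [].
  case: insubP => [u _ <-|] /=; first by [].
  by rewrite negbK => /eqP ->.
- by case=> x; apply: (@lift_inj _ ord0); rewrite relabelE.
- by case=> x; apply: (@lift_inj _ ord0); rewrite relabelE.
Qed.

End Cut.

Section Ports.
Variables (V E A : finType) (a : V -> nat) (t : E + A -> {v : V & 'I_(a v)}).
Hypotheses (tB : bijective t) (noE : E -> False).
Variable v0 : V.

Definition away : finType := {x : A | tag (t (inr x)) != v0}.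

Definition away_port (x : void + away) :
    {v : {v : V | v != v0} & 'I_(a (val v))} :=
  match x with
  | inl y => match y with end
  | inr x => existT (fun v : {v : V | v != v0} => 'I_(a (val v)))
               (exist _ (tag (t (inr (val x)))) (valP x)) (tagged (t (inr (val x))))
  end.

Lemma away_port_bij : bijective away_port.
Proof.
apply: inj_surj_bij => [[[]|x] [[]|y]|[v i]].
  move=> /(congr1 (fun p : {v : {v : V | v != v0} & 'I_(a (val v))} =>
    (val (tag p), tagged p : nat))) /= pq; congr inr; apply: val_inj.
  have : port (t (inr (val x))) = port (t (inr (val y))) by [].
  by move=> /port_inj /(bij_inj tB) [].
case def_x: (bij_inv tB (existT _ (val v) i)) => [e|x]; first by case: (noE e).
have tx : t (inr x) = existT _ (val v) i by rewrite -def_x bij_invK.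
have xv : tag (t (inr x)) != v0 by rewrite tx; exact: (valP v).
exists (inr (exist _ x xv)); apply: port_inj; rewrite /port /=.
have := congr1 (@port _ _) tx; rewrite /port /= => -[e1 e2].
congr (_, _) => //; case: v i {def_x} tx e1 e2 => v vn i /= tx e1 e2; exact: eq_exist.
Qed.

Definition strip_edge (x : E + A) : A :=
  match x with inl e => match noE e with end | inr x => x end.

(** The input (or output) edges are those at v0, indexed by the ports of v0, together
    with those away from v0. *)
Definition join_port (y : 'I_(a v0) + away) : A :=
  match y with
  | inl i => strip_edge (bij_inv tB (existT _ v0 i))
  | inr x => val x
  end.

Lemma join_portE i : t (inr (join_port (inl i))) = existT _ v0 i.
Proof.
rewrite /=; have := bij_invK tB (existT (fun v => 'I_(a v)) v0 i).
by case: (bij_inv tB _) => [e|x /=]; [case: (noE e)|].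
Qed.

Lemma join_port_bij : bijective join_port.
Proof.
apply: inj_surj_bij => [[i|x] [j|y]|y].
- move=> ij; have := congr1 (@port _ _) (join_portE i); rewrite ij join_portE.
  by case=> /val_inj ->.
- by move=> iy; have := valP y; rewrite -[val y]iy join_portE eqxx.
- by move=> xj; have := valP x; rewrite -[val x]/(join_port (inr x)) xj join_portE eqxx.
- by move=> /val_inj ->.
case: (boolP (tag (t (inr y)) == v0)) => [/eqP yv|yn]; last by exists (inr (exist _ y yn)).
have [i ti] : exists i, t (inr y) = existT _ v0 i.
  by case: (t (inr y)) yv => v i /= e; move: i; rewrite e => i; exists i.
exists (inl i); have := join_portE i; rewrite -ti.
by move=> /(bij_inj tB) [].
Qed.
End Ports.

Definition away_lab (A : finType) (x : A + void) : 'I_#|A| :=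
  match x with inl a => enum_rank a | inr y => match y with end end.

Lemma away_lab_bij (A : finType) : bijective (@away_lab A).
Proof.
by exists (inl \o enum_val) => [[x|[]]|x] /=; rewrite ?enum_rankK ?enum_valK.
Qed.

Definition put_back (T : eqType) (t0 : T) (x : unit + {x : T | x != t0}) : T :=
  match x with inl _ => t0 | inr y => val y end.

Lemma put_back_bij (T : finType) (t0 : T) : bijective (@put_back T t0).
Proof.
apply: inj_surj_bij => [[[]|x] [[]|y]|y] //=.
- by move=> e0; case/eqP: (valP y).
- by move=> e0; case/eqP: (valP x).
- by move=> /val_inj ->.
have [->|yn] := eqVneq y t0; first by exists (inl tt).
by exists (inr (exist _ y yn)).
Qed.

Section Remove.
Variables (X : nat -> nat -> Type) (k l : nat) (G : graph X k l).
Hypothesis noE : gE G -> False.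
Variable v0 : gV G.

(** For a solar graph G without internal edges: the rest of G once v0 is taken away.  The
    new labels are arbitrary. *)
Definition remove : graph X #|away (tgt G) v0| #|away (src G) v0| :=
  @Graph X _ _ {v : gV G | v != v0} void (away (tgt G) v0) (away (src G) v0) void void
    (fun v => ain G (val v)) (fun v => aout G (val v)) (fun v => dec G (val v))
    (@away_port _ _ _ _ (tgt G) v0) (@away_port _ _ _ _ (src G) v0)
    (@away_lab _) (@away_lab _)
    (away_port_bij (tgt_bij G) noE v0) (away_port_bij (src_bij G) noE v0)
    (@away_lab_bij _) (@away_lab_bij _).

End Remove.

Lemma card_neq (T : finType) (x0 : T) : #|{: {x : T | x != x0}}| = #|T|.-1.
Proof. by rewrite card_sig -(cardC1 x0); apply: eq_card. Qed.

Lemma from_void_bij (T : Type) (f : void -> T) : (T -> False) -> bijective f.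
Proof. by move=> T0; exists (fun x => match T0 x with end) => [[]|x]; case: (T0 x). Qed.

Section SolarInduction.
Variables (X : nat -> nat -> Type) (C : forall k l, graph X k l -> Prop).
Hypothesis C_iso : forall k l (G H : graph X k l), isomorphic G H -> C H -> C G.
Hypothesis C_lact : forall k l (s : 'S_l) (G : graph X k l),
  solar G -> C G -> C (glact s G).
Hypothesis C_ract : forall k l (G : graph X k l) (s : 'S_k),
  solar G -> C G -> C (gract G s).
Hypothesis C_empty : C (gempty X).
Hypothesis C_iota : forall k l (p : X k l), C (iota_graph p).
Hypothesis C_union : forall k l (G : graph X k l) k' l' (H : graph X k' l'),
  solar G -> solar H -> C G -> C H -> C (disj_union G H).
Hypothesis C_tr : forall k l i j (G : graph X k.+1 l.+1), solar G -> C G -> C (gtr G i j).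

(** Labels are irrelevant for a property stable under the symmetric groups.  The
    numbers of inputs and outputs of G and H agree only propositionally. *)
Lemma solar_ind_relabel k l (G : graph X k l) k' l' (H : graph X k' l')
    (fV : gV H -> gV G) (fE : gE H -> gE G) (fI : gI H -> gI G) (fO : gO H -> gO G)
    (fIO : gIO H -> gIO G) (fL : gL H -> gL G) :
  bijective fV -> bijective fE -> bijective fI -> bijective fO -> bijective fIO ->
  bijective fL -> (forall v, tdec (fV v) = tdec v) ->
  (forall x, port (tgt G (sum_map fE fI x)) = (fV (port (tgt H x)).1, (port (tgt H x)).2)) ->
  (forall x, port (src G (sum_map fE fO x)) = (fV (port (src H x)).1, (port (src H x)).2)) ->
  solar H -> C H -> C G.
Proof.
move=> fVB fEB fIB fOB fIOB fLB fdec ft fs sH CH.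
have iB := sum_map_bij fIB fIOB; have oB := sum_map_bij fOB fIOB.
have ek : k' = k.
  rewrite -(card_ord k') -(card_ord k) -(bij_eq_card (ilab_bij G)) -(bij_eq_card (ilab_bij H)).
  exact: bij_eq_card iB.
have el : l' = l.
  rewrite -(card_ord l') -(card_ord l) -(bij_eq_card (olab_bij G)) -(bij_eq_card (olab_bij H)).
  exact: bij_eq_card oB.
case: k / ek G fV fE fI fO fIO fL fVB fEB fIB fOB fIOB fLB fdec ft fs iB oB.
case: l / el => G fV fE fI fO fIO fL fVB fEB fIB fOB fIOB fLB fdec ft fs iB oB.
have [s sE] : exists s : 'S_k', forall x, s (ilab G (sum_map fI fIO x)) = ilab H x.
  have uB : bijective (ilab H \o bij_inv (bij_comp (ilab_bij G) iB)).
    exact: bij_comp (ilab_bij H) (bij_inv_bij _).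
  exists (perm (bij_inj uB)) => x; rewrite permE /=; congr ilab.
  by apply: (bij_inj (bij_comp (ilab_bij G) iB)); rewrite bij_invK.
have [t tE] : exists t : 'S_l', forall x, t (olab H x) = olab G (sum_map fO fIO x).
  have uB : bijective (olab G \o sum_map fO fIO \o bij_inv (olab_bij H)).
    exact: bij_comp (bij_comp (olab_bij G) oB) (bij_inv_bij _).
  exists (perm (bij_inj uB)) => x; rewrite permE /=; congr (olab G (sum_map _ _ _)).
  by apply: (bij_inj (olab_bij H)); rewrite bij_invK.
apply: (C_iso _ (C_lact t (sH : solar (gract H s)) (C_ract s sH CH))); apply: isomorphic_sym; split.
apply: (@GraphIso _ _ _ (glact t (gract H s)) G fV fE fI fO fIO fL) => // x.
  by apply: (@perm_inj _ s); rewrite /= permKV sE.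
by rewrite /= tE.
Qed.

(** Induction on the number of internal edges and vertices: a graph with an internal
    edge is a partial trace of the graph with this edge cut; a graph without internal
    edges is, up to labels, the disjoint union of a corolla and a smaller graph. *)
Lemma solar_ind k l (G : graph X k l) : solar G -> C G.
Proof.
have [n] := ubnP (#|gE G| + #|gV G|); elim: n => // n IH in k l G *.
rewrite ltnS => Gn [noIO noL].
have [e0|noE] : gE G + (gE G -> False).
  by case: (pickP (fun _ : gE G => true)) => [e _|noE]; [left|right=> e; have := noE e].
  apply: (C_iso (gtr_cut e0)); apply: C_tr; first by split.
  apply: IH; last by split.
  rewrite [gE _]/({e : gE G | e != e0} : finType) card_neq.
  by apply: leq_trans Gn; rewrite ltn_add2r prednK //; apply/card_gt0P; exists e0.
have [v0|noV] : gV G + (gV G -> False).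
  by case: (pickP (fun _ : gV G => true)) => [v _|noV]; [left|right=> v; have := noV v].
  apply: (@solar_ind_relabel _ _ G _ _ (disj_union (iota_graph (dec G v0)) (remove noE v0))
    (@put_back (gV G) v0) (@void_map _) (join_port (tgt_bij G) noE (v0 := v0))
    (join_port (src_bij G) noE (v0 := v0)) (@void_map _) (@void_map _)).
  - exact: put_back_bij.
  - exact: void_bij.
  - exact: join_port_bij.
  - exact: join_port_bij.
  - exact: void_bij.
  - exact: void_bij.
  - by case=> [[]|v].
  - case=> [[[]|[]]|[i|x]] //.
    have /(congr1 (@port _ _)) e := join_portE (tgt_bij G) noE i; exact: e.
  - case=> [[[]|[]]|[i|x]] //.
    have /(congr1 (@port _ _)) e := join_portE (src_bij G) noE i; exact: e.
  - by split; case=> -[].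
  apply: C_union; [by split; case | by split; case | exact: C_iota | ].
  apply: IH; last by split; case.
  rewrite card_void add0n [gV _]/({v : gV G | v != v0} : finType) card_neq.
  have V0 : 0 < #|gV G| by apply/card_gt0P; exists v0.
  apply: leq_trans Gn; rewrite -ltnS prednK // ltnS; exact: leq_addl.
have noI (x : gI G) : False := noV (tag (tgt G (inr x))).
have noO (x : gO G) : False := noV (tag (src G (inr x))).
by apply: (@solar_ind_relabel _ _ G _ _ (gempty X) (fun v => match v with end)
    (fun v => match v with end) (fun v => match v with end) (fun v => match v with end)
    (fun v => match v with end) (fun v => match v with end)) => //;
  try exact: from_void_bij; first [by split; case | case=> [[]|[]]].
Qed.

End SolarInduction.

(** * Uniqueness of the evaluation; patterns *)

Lemma sval_inj (T : Type) (R : T -> Prop) (x y : {x : T | R x}) : sval x = sval y -> x = y.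
Proof. by case: x y => [x Rx] [y Ry] /= xy; apply: eq_exist. Qed.

Section Uniqueness.
Variable P : trap.

Definition scls k l (G : graph P k l) (sG : solar G) : solCGr_trap P k l :=
  exist _ (gcls G) (ex_intro2 _ _ G sG erefl).

(** Solar graphs are generated by corollas, where both morphisms take the same value. *)
Lemma evaluation_unique (f g : forall k l, solCGr_trap P k l -> P k l) :
  is_evaluation f -> is_evaluation g -> forall k l (x : solCGr_trap P k l), f k l x = g k l x.
Proof.
move=> [fM fi] [gM gi] k l x.
pose C k l (G : graph P k l) := forall x : solCGr_trap P k l, sval x = gcls G -> f _ _ x = g _ _ x.
suff CG : C k l (rep (sval x)) by apply: CG; rewrite /gcls repK.
apply: (@solar_ind P C); last exact: solar_rep (svalP x).
- by move=> {}k {}l G H GH CH {}x; rewrite (eq_gcls GH); apply: CH.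
- move=> {}k {}l s G sG CG {}x xG.
  have -> : x = lact s (scls sG).
    by apply: sval_inj; rewrite xG; apply: eq_gcls; apply: glact_iso; apply: gcls_rep.
  by rewrite (morph_lact fM) (morph_lact gM) CG.
- move=> {}k {}l G s sG CG {}x xG.
  have -> : x = ract (scls sG) s.
    by apply: sval_inj; rewrite xG; apply: eq_gcls; apply: gract_iso; apply: gcls_rep.
  by rewrite (morph_ract fM) (morph_ract gM) CG.
- move=> {}x xG; have -> : x = hunit by apply: sval_inj.
  by rewrite (morph_hunit fM) (morph_hunit gM).
- move=> {}k {}l p {}x xG; have -> : x = siota p by apply: sval_inj.
  by rewrite fi gi.
- move=> {}k {}l G k' l' H sG sH CG CH {}x xG.
  have -> : x = hcat (scls sG) (scls sH).
    apply: sval_inj; rewrite xG; apply: eq_gcls.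
    by apply: disj_union_iso; apply: gcls_rep.
  by rewrite (morph_hcat fM) (morph_hcat gM) CG // CH.
- move=> {}k {}l i j G sG CG {}x xG.
  have -> : x = ptr i j (scls sG).
    apply: sval_inj; rewrite xG; apply: eq_gcls.
    by apply: gtr_iso_solar => //; apply: gcls_rep.
  by rewrite (morph_ptr fM) (morph_ptr gM) CG.
Qed.

Lemma evaluationE k l (x : solCGr_trap P k l) : evaluation x = Some (phi x).
Proof.
rewrite /evaluation; case: pselect => [ex|[]]; last by exists (@phi P); apply: phi_evaluation.
by congr Some; apply: (evaluation_unique (svalP (cid ex)) (phi_evaluation P)).
Qed.

End Uniqueness.

Section Pattern.
Variable P : trap.
Let idval k l (p : P k l) : P k l := p.
Let solP k l (G : graph P k l) := solW idval G.

Definition io_rel k l (G : graph P k l) (x y : nat) : Prop :=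
  exists e, ilab G (inr e) = x :> nat /\ olab G (inr e) = y :> nat.

(** The data on which equivalent graphs agree. *)
Definition pattern : Type := (wiring P nat nat * (nat -> nat -> Prop) * nat)%type.

Definition pat k l (G : graph P k l) : pattern := (solP G, io_rel G, #|gL G|).

Lemma eq_rel (R S : nat -> nat -> Prop) : (forall x y, R x y <-> S x y) -> R = S.
Proof. by move=> RS; apply/funext => x; apply/funext => y; apply/propext. Qed.

Lemma pat_iso k l (G H : graph P k l) : isomorphic G H -> pat G = pat H.
Proof.
move=> GH; rewrite /pat /solP (solW_iso idval GH); case: GH => F.
rewrite (bij_eq_card (isoL_bij F)); congr (_, _, _); apply: eq_rel => x y; split.
  move=> [e [<- <-]]; exists (isoIO F e).
  by have /= -> := iso_ilab F (inr e); have /= -> := iso_olab F (inr e).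
move=> [e' [<- <-]]; have [h _ hK] := isoIO_bij F; exists (h e').
by have /= <- := iso_ilab F (inr (h e')); have /= <- := iso_olab F (inr (h e')); rewrite hK.
Qed.

Definition pat_lact l (s : 'S_l) (a : pattern) : pattern :=
  (wren id (pext s) a.1.1, fun x y => exists2 y0, a.1.2 x y0 & y = pext s y0, a.2).

Lemma pat_glact k l (s : 'S_l) (G : graph P k l) : pat (glact s G) = pat_lact s (pat G).
Proof.
rewrite /pat /pat_lact /solP (solW_glact idval G (pextE s)); congr (_, _, _).
apply: eq_rel => x y; split; first by move=> [e [<- <-]]; exists (olab G (inr e)); [exists e | rewrite pextE].
by move=> [_ [e [<- <-]] ->]; exists e; rewrite pextE.
Qed.

Definition pat_ract k (s : 'S_k) (a : pattern) : pattern :=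
  (wren (pext s^-1) id a.1.1, fun x y => exists2 x0, a.1.2 x0 y & x = pext s^-1 x0, a.2).

Lemma pat_gract k l (G : graph P k l) (s : 'S_k) : pat (gract G s) = pat_ract s (pat G).
Proof.
rewrite /pat /pat_ract /solP (solW_gract idval G (pextE s^-1)); congr (_, _, _).
apply: eq_rel => x y; split; first by move=> [e [<- <-]]; exists (ilab G (inr e)); [exists e | rewrite pextE].
by move=> [_ [e [<- <-]] ->]; exists e; rewrite pextE.
Qed.

Definition pat_union k l (a b : pattern) : pattern :=
  (wmul a.1.1 (wren (addn k) (addn l) b.1.1),
   fun x y => a.1.2 x y \/ exists x0 y0, [/\ b.1.2 x0 y0, x = k + x0 & y = l + y0],
   a.2 + b.2).

Lemma pat_disj_union k l (G : graph P k l) k' l' (H : graph P k' l') :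
  pat (disj_union G H) = pat_union k l (pat G) (pat H).
Proof.
rewrite /pat /pat_union /solP solW_disj_union card_sum; congr (_, _, _).
apply: eq_rel => x y; split.
  move=> [[e|e] [<- <-]] /=; first by left; exists e.
  by right; exists (ilab H (inr e)), (olab H (inr e)); split=> //; exists e.
move=> [[e [<- <-]]|[_ [_ [[e [<- <-]] -> ->]]]]; first by exists (inl e).
by exists (inr e).
Qed.

(** The effect of a partial trace on patterns.  The case of the definition is decided by
    whether i and j belong to input-output edges; the partner of i or j is then unique.
    The new input-output edges are the old ones away from i and j, together with the
    composition of the edges ending at j and starting at i, if these are distinct. *)
Definition pat_tr (i j : nat) (a : pattern) : pattern :=
  let: (w, io, n) := a in
  (if pselect (io i j) then wren (unbump i) (unbump j) w
   else if pselect (exists y, io i y) is left h then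
     wren (unbump i) (fun y => unbump j (if y == j then sval (cid h) else y)) w
   else if pselect (exists x, io x j) is left h then
     wren (fun x => unbump i (if x == i then sval (cid h) else x)) (unbump j) w
   else wren (unbump i) (unbump j) (wtr i j w),
   fun x y => io (bump i x) (bump j y) \/ (io (bump i x) j /\ io i (bump j y)),
   n + `[< io i j >]).

(** The four cases of the partial trace; the input-output relation of the result is given
    by the same formula in all of them. *)
Lemma pat_gtr k l (G : graph P k.+1 l.+1) (i : 'I_k.+1) (j : 'I_l.+1) :
  pat (gtr G i j) = pat_tr i j (pat G).
Proof.
have inI := bij_inj (ilab_bij G); have outI := bij_inj (olab_bij G).
have bump_neq h n : bump h n <> h by rewrite /bump; lia.
have noin e : ilab G (inl e) = i -> forall y, ~ io_rel G i y.
  by move=> <- y [e' [/ord_inj /inI]].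
have noout e : olab G (inl e) = j -> forall x, ~ io_rel G x j.
  by move=> <- y [e' [_ /ord_inj /outI]].
have bumpE h n m : bump h n = bump h m -> n = m by move=> E; rewrite -(bumpK h n) E bumpK.
case: gtrP => [e g ei gj|e g ei gj|e g ge ei gj|e ei ej]; rewrite /pat /pat_tr /solP.
- rewrite solW_tr_input_output; have ni := noin _ ei; have nj := noout _ gj.
  case: pselect => [/ni //|?]; case: pselect => [[y /ni] //|?]; case: pselect => [[x /nj] //|?].
  rewrite asboolF ?addn0; last exact: ni.
  congr (_, _, _); apply: eq_rel => x y.
  have hi e' := val_relabel_at (ilab_bij G) ei (@drop_l_neq _ _ e) (inr e').
  have ho e' := val_relabel_at (olab_bij G) gj (@drop_l_neq _ _ g) (inr e').
  split=> [[e' [<- <-]]|[[e' [hx hy]]|[_ /ni] //]]; first by left; exists e'; rewrite -hi -ho.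
  by exists e'; split; [apply: (bumpE i) | apply: (bumpE j)]; rewrite -?hi -?ho.
- rewrite solW_tr_input_io; have ni := noin _ ei.
  case: pselect => [/ni //|?]; case: pselect => [[y /ni] //|?].
  case: pselect => [ex|[]]; last by exists (ilab G (inr g)), g; rewrite gj.
  have -> : sval (cid ex) = ilab G (inr g).
    by have [g' [<- /ord_inj]] := svalP (cid ex); rewrite -gj => /outI [->].
  rewrite asboolF ?addn0; last exact: ni.
  congr (_, _, _); apply: eq_rel => x y.
  have hi e' := val_relabel_at (ilab_bij G) ei (@redirect_drop_neq _ _ g (inl e) erefl) (inr e').
  have ho e' := val_relabel_at (olab_bij G) gj (@drop_r_neq _ _ g) (inr e').
  split=> [[e' [<- <-]]|[[e' [hx hy]]|[_ /ni] //]]; first by left; exists (val e'); rewrite -hi -ho.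
  have e'g : e' != g by apply/eqP => E; apply: (bump_neq j y); rewrite -hy E gj.
  by exists (exist _ e' e'g); split; [apply: (bumpE i) | apply: (bumpE j)]; rewrite -?hi -?ho.
- rewrite solW_tr_io_other.
  have nij : ~ io_rel G i j.
    case=> e' [/ord_inj]; rewrite -ei => /inI [->] /ord_inj; rewrite -gj => /outI E.
    by rewrite E eqxx in ge.
  case: pselect => [/nij //|?]; case: pselect => [ex|[]]; last by exists (olab G (inr e)), e; rewrite ei.
  have -> : sval (cid ex) = olab G (inr e).
    by have [e' [/ord_inj + <-]] := svalP (cid ex); rewrite -ei => /inI [->].
  rewrite asboolF ?addn0 //.
  congr (_, _, _); apply: eq_rel => x y.
  have hi e' := val_relabel_at (ilab_bij G) ei (@drop_r_neq _ _ e) (inr e').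
  have ho e' := val_relabel_at (olab_bij G) gj (redirect_drop_neq ge) (inr e').
  split.
    move=> [e' [<- <-]]; rewrite -hi -ho /redirect /=.
    case: eqP => [e'g|_]; last by left; exists (val e').
    by right; split; [exists (val e'); rewrite e'g gj | exists e; rewrite ei].
  case=> [[e' [hx hy]]|[[e1 [hx /ord_inj e1j]] [e2 [/ord_inj e2i hy]]]].
    have e'e : e' != e by apply/eqP => E; apply: (bump_neq i x); rewrite -hx E ei.
    exists (exist _ e' e'e); split; [apply: (bumpE i) | apply: (bumpE j)]; rewrite -?hi -?ho //.
    rewrite /redirect /= ifN //; apply/eqP => E; apply: (bump_neq j y).
    by rewrite -hy E gj.
  have e1e : e1 != e by apply/eqP => E; apply: (bump_neq i x); rewrite -hx E ei.
  exists (exist _ e1 e1e); split; [apply: (bumpE i) | apply: (bumpE j)]; rewrite -?hi -?ho //.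
  rewrite /redirect /= ifT; last by apply/eqP/outI; rewrite e1j gj.
  by have [<-] := inI _ _ (etrans e2i (esym ei)).
- rewrite solW_tr_io_same; have ij : io_rel G i j by exists e; rewrite ei ej.
  case: pselect => // ?; rewrite asboolT // card_option addn1.
  congr (_, _, _); apply: eq_rel => x y.
  have hi e' := val_relabel_at (ilab_bij G) ei (@drop_r_neq _ _ e) (inr e').
  have ho e' := val_relabel_at (olab_bij G) ej (@drop_r_neq _ _ e) (inr e').
  split=> [[e' [<- <-]]|[[e' [hx hy]]|[[e' [hx /ord_inj]]]]].
  + by left; exists (val e'); rewrite -hi -ho.
  + have e'e : e' != e by apply/eqP => E; apply: (bump_neq i x); rewrite -hx E ei.
    by exists (exist _ e' e'e); split; [apply: (bumpE i) | apply: (bumpE j)]; rewrite -?hi -?ho.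
  by move=> e'j; have [E] := outI _ _ (etrans e'j (esym ej)); case: (bump_neq i x); rewrite -hx E ei.
Qed.

End Pattern.

(** * The quotient by equality of patterns *)

Section Ranks.
Variables (n : nat) (D : {set 'I_n}).

Definition set_rank (x : nat) : nat := #|[set y in D | y < x]|.

(** The inverse of [set_rank] on D, expressed in terms of D only. *)
Definition elt_of_rank (r : nat) : nat :=
  if [pick x in D | set_rank x == r] is Some x then nat_of_ord x else 0.

Variables (A : finType) (u : A -> 'I_n).
Hypotheses (uI : injective u) (uD : D = [set u a | a : A]).

Lemma rank_set_rank a : rank (fun b => u b : nat) a = set_rank (u a) :> nat.
Proof.
rewrite /= /set_rank -(card_imset _ uI); apply: eq_card => y; rewrite !inE uD.
apply/imsetP/andP => [[b + ->]|[/imsetP[b _ ->] yx]].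
  by rewrite inE => ba; split; first exact: imset_f.
by exists b.
Qed.

Lemma elt_of_rankK a : elt_of_rank (rank (fun b => u b : nat) a) = u a.
Proof.
rewrite /elt_of_rank; case: pickP => [x|/(_ (u a))]; last first.
  by rewrite -rank_set_rank eqxx andbT uD imset_f.
case/andP; rewrite {1}uD => /imsetP[b _ ->]; rewrite -rank_set_rank => /eqP /ord_inj.
have /bij_inj rI : bijective (rank (fun b => u b : nat)).
  by apply: rank_bij => c d /ord_inj /uI.
by move=> /rI ->.
Qed.

End Ranks.

Section SamePattern.
Variable P : trap.
Let idval k l (p : P k l) : P k l := p.

(** The input labels not used by input-output edges are those of the solar part. *)
Definition free_in k l (S : {set 'I_k * 'I_l}) : {set 'I_k} :=
  [set x | [forall y, (x, y) \notin S]].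
Definition free_out k l (S : {set 'I_k * 'I_l}) : {set 'I_l} :=
  [set y | [forall x, (x, y) \notin S]].

Lemma free_inE k l (G : graph P k l) :
  free_in (gio_pairs G) = [set ilab G (inl x) | x : gI G].
Proof.
apply/setP => x; rewrite inE; apply/forallP/imsetP => [free|[e _ ->] y].
  have := bij_invK (ilab_bij G) x; case: (bij_inv (ilab_bij G) x) => e ex; first by exists e.
  by have /imsetP[] := free (olab G (inr e)); exists e; rewrite ?ex.
by apply/imsetP => -[e' _ [/(bij_inj (ilab_bij G))]].
Qed.

Lemma free_outE k l (G : graph P k l) :
  free_out (gio_pairs G) = [set olab G (inl x) | x : gO G].
Proof.
apply/setP => y; rewrite inE; apply/forallP/imsetP => [free|[e _ ->] x].
  have := bij_invK (olab_bij G) y; case: (bij_inv (olab_bij G) y) => e ey; first by exists e.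
  by have /imsetP[] := free (ilab G (inr e)); exists e; rewrite ?ey.
by apply/imsetP => -[e' _ [_ /(bij_inj (olab_bij G))]].
Qed.

Lemma ilab_inl_inj k l (G : graph P k l) : injective (fun x => ilab G (inl x)).
Proof. by move=> x y /(bij_inj (ilab_bij G)) []. Qed.

Lemma olab_inl_inj k l (G : graph P k l) : injective (fun x => olab G (inl x)).
Proof. by move=> x y /(bij_inj (olab_bij G)) []. Qed.

Lemma solW_gsol k l (G : graph P k l) : solW idval (gsol G) =
  wren (set_rank (free_in (gio_pairs G))) (set_rank (free_out (gio_pairs G))) (solW idval G).
Proof.
rewrite /solW wren_comp; apply: eq_wren.
  move=> [e /in_occ_core_edge []|x _] /=.
  by rewrite -(rank_set_rank (@ilab_inl_inj _ _ G) (free_inE G)).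
move=> [e /out_occ_core_edge []|x _] /=.
by rewrite -(rank_set_rank (@olab_inl_inj _ _ G) (free_outE G)).
Qed.

(** The solar part with consecutive labels and the set of pairs of labels of the
    input-output edges together determine the solar part with its original labels. *)
Lemma solW_of_gsol k l (G : graph P k l) : solW idval G =
  wren (elt_of_rank (free_in (gio_pairs G))) (elt_of_rank (free_out (gio_pairs G)))
    (solW idval (gsol G)).
Proof.
rewrite /solW wren_comp; apply: eq_wren.
  move=> [e /in_occ_core_edge []|x _] /=.
  by rewrite -(elt_of_rankK (@ilab_inl_inj _ _ G) (free_inE G)).
move=> [e /out_occ_core_edge []|x _] /=.
by rewrite -(elt_of_rankK (@olab_inl_inj _ _ G) (free_outE G)).
Qed.

Lemma io_pairsP k l (G : graph P k l) x y :
  (x, y) \in gio_pairs G <-> io_rel G x y.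
Proof.
split=> [/imsetP[e _ [-> ->]]|[e [/ord_inj <- /ord_inj <-]]]; first by exists e.
exact: imset_f.
Qed.

Lemma gio_pairs_rel k l (G H : graph P k l) :
  gio_pairs G = gio_pairs H <-> io_rel G = io_rel H.
Proof.
split=> E.
  have sub (K K' : graph P k l) : gio_pairs K = gio_pairs K' ->
      forall x y, io_rel K x y -> io_rel K' x y.
    by move=> KK' _ _ [e [<- <-]]; apply/io_pairsP; rewrite -KK'; apply: imset_f.
  by apply: eq_rel => x y; split; apply: sub.
by apply/setP => -[x y]; apply/idP/idP => /io_pairsP xy; apply/io_pairsP; rewrite ?E // -E.
Qed.

Lemma emb_phi_sol k l (x : CGr P k l) : emb (phi (sol x)) = solW idval (gsol (rep x)).
Proof. by rewrite emb_phi solW_rep. Qed.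

(** The labels of the solar part can be made consecutive and restored by means of the
    input-output pairs alone, and elements of the TRAP are determined by their images
    under [emb], including the numbers of inputs and outputs. *)
Lemma same_patternP k l (x y : CGr P k l) : same_pattern x y <-> pat (rep x) = pat (rep y).
Proof.
split=> [[Exy /gio_pairs_rel ioE nE]|E].
  rewrite /pat ioE -/(nloops x) nE; congr (_, _, _).
  rewrite (solW_of_gsol (rep x)) (solW_of_gsol (rep y)).
  have -> : gio_pairs (rep x) = gio_pairs (rep y) by exact/gio_pairs_rel.
  congr (wren _ _ _).
  pose F (s : {a : nat * nat & option (P a.1 a.2)}) :=
    if tagged s is Some p then emb p else wone.
  by have := congr1 F Exy; rewrite /F /= !evaluationE !emb_phi_sol.
have sE : solW idval (rep x) = solW idval (rep y) := congr1 (fun a => a.1.1) E.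
have /gio_pairs_rel ioE : io_rel (rep x) = io_rel (rep y) := congr1 (fun a => a.1.2) E.
split=> //; last exact: (congr1 snd E).
rewrite /tevaluation !evaluationE.
have {}E : emb (phi (sol x)) = emb (phi (sol y)).
  rewrite !emb_phi_sol !solW_gsol; by rewrite ioE sE.
exact: (congr1 (fun s : {a : nat * nat & P a.1 a.2} =>
  existT (fun a => option (P a.1 a.2)) (tag s) (Some (tagged s))) (emb_sig_inj E)).
Qed.

Definition up k l (G : graph P k l) : uPGr_utrap P k l := pcls (gcls G).

Lemma eq_up k l (G H : graph P k l) : pat G = pat H -> up G = up H.
Proof.
move=> GH; apply: eq_exist; apply/funext => x; apply/propext.
have GE : pat (rep (gcls G)) = pat G by rewrite -(pat_iso (gcls_rep G)).
have HE : pat (rep (gcls H)) = pat H by rewrite -(pat_iso (gcls_rep H)).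
by rewrite !same_patternP GE HE GH.
Qed.

Definition urep k l (a : uPGr_utrap P k l) : graph P k l := rep (prep a).

Lemma urepK k l (a : uPGr_utrap P k l) : up (urep a) = a.
Proof. by rewrite /up /gcls repK /pcls /prep repK. Qed.

(** The representative chosen for a class has the right pattern, so that operations
    defined through representatives can be computed on any graph of the class. *)
Lemma pat_up k l (G : graph P k l) : pat (urep (up G)) = pat G.
Proof.
have /same_patternP : same_pattern (gcls G) (prep (up G)).
  by apply: rep_cls => x; apply/same_patternP.
by rewrite -(pat_iso (gcls_rep G)) => ->.
Qed.

Lemma up_iso k l (G H : graph P k l) : isomorphic G H -> up G = up H.
Proof. by move=> GH; apply/eq_up/pat_iso. Qed.

Lemma up_glact k l (s : 'S_l) (G : graph P k l) : up (glact s G) = lact s (up G).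
Proof. by apply: eq_up; rewrite !pat_glact pat_up. Qed.

Lemma up_gract k l (G : graph P k l) (s : 'S_k) : up (gract G s) = ract (up G) s.
Proof. by apply: eq_up; rewrite !pat_gract pat_up. Qed.

Lemma up_disj_union k l (G : graph P k l) k' l' (H : graph P k' l') :
  up (disj_union G H) = hcat (up G) (up H).
Proof. by apply: eq_up; rewrite !pat_disj_union !pat_up.
Qed.

Lemma up_gtr k l (G : graph P k.+1 l.+1) i j : up (gtr G i j) = ptr i j (up G).
Proof. by apply: eq_up; rewrite !pat_gtr pat_up. Qed.

End SamePattern.

(** * The universal property *)

Section Reduce.
Variables (X : nat -> nat -> Type).

Definition drop_loop k l (G : graph X k l) (e : gL G) : graph X k l :=
  Graph ({x : gL G | x != e} : finType) (dec G) (tgt G) (src G) (ilab G) (olab G)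
    (tgt_bij G) (src_bij G) (ilab_bij G) (olab_bij G).

Variables (k l : nat) (G : graph X k.+1 l.+1) (e : gIO G).

Definition drop_io : graph X k l :=
  @Graph X k l (gV G) (gE G) (gI G) (gO G) {x : gIO G | x != e} (gL G)
    (ain G) (aout G) (dec G) (tgt G) (src G)
    (relabel_at (ilab_bij G) erefl (@drop_r_neq _ _ e))
    (relabel_at (olab_bij G) erefl (@drop_r_neq _ _ e))
    (tgt_bij G) (src_bij G)
    (relabel_at_bij _ _ _ (@drop_r_inj _ _ e) (@drop_r_surj _ _ e))
    (relabel_at_bij _ _ _ (@drop_r_inj _ _ e) (@drop_r_surj _ _ e)).

Definition void_plus (T : Type) (x : void + T) : T :=
  match x with inl y => match y with end | inr t => t end.

Lemma void_plus_bij (T : Type) : bijective (@void_plus T).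
Proof. by exists inr => [[[]|]|]. Qed.

(** An input-output edge splits off as a unit.  The permutations bring its labels, which
    are 0 in the disjoint union, to their original places. *)
Lemma drop_io_iso : isomorphic
  (glact (lift_perm ord0 (olab G (inr e)) 1)
    (gract (disj_union (gunit X) drop_io) (lift_perm ord0 (ilab G (inr e)) 1)^-1)) G.
Proof.
set H := glact _ _; split.
apply: (@GraphIso _ _ _ H G (@void_plus (gV G)) (@void_plus (gE G)) (@void_plus (gI G))
  (@void_plus (gO G)) (@put_back (gIO G) e) (@void_plus (gL G))).
- exact: void_plus_bij.
- exact: void_plus_bij.
- exact: void_plus_bij.
- exact: void_plus_bij.
- exact: put_back_bij.
- exact: void_plus_bij.
- by case=> [[]|v].
- by case=> [[[]|x]|[[]|x]].
- by case=> [[[]|x]|[[]|x]].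
- have liftE y : @rshift 1 k y = lift ord0 y by apply: val_inj.
  have zeroE : @lshift 1 k ord0 = ord0 by apply: val_inj.
  case=> [[[]|x]|[[]|x]] /=; rewrite invgK.
  + by rewrite liftE lift_perm_lift perm1 relabelE.
  + by rewrite zeroE lift_perm_id.
  + by rewrite liftE lift_perm_lift perm1 relabelE.
- have liftE y : @rshift 1 l y = lift ord0 y by apply: val_inj.
  have zeroE : @lshift 1 l ord0 = ord0 by apply: val_inj.
  case=> [[[]|x]|[[]|x]] /=.
  + by rewrite liftE lift_perm_lift perm1 relabelE.
  + by rewrite zeroE lift_perm_id.
  + by rewrite liftE lift_perm_lift perm1 relabelE.
Qed.

End Reduce.

Section Extension.
Variables (P : trap) (Q : utrap) (theta : forall k l, P k l -> Q k l).
Hypothesis thetaM : trap_morphism theta.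
Let T := utrap_trap Q.
Let thetaT : forall k l, P k l -> T k l := theta.
Let idval k l (p : P k l) : P k l := p.

(** Values are built from products, renamings and traces, which morphisms preserve. *)
Lemma solW_map k l (G : graph P k l) : solW thetaT G = wmap thetaT (solW idval G).
Proof.
have thetaTM : trap_morphism thetaT by [].
rewrite /solW (wmap_ren thetaTM) /core (wmap_trs thetaTM) (wmap_prod thetaTM).
by congr (wren _ _ (wtrs _ _)); apply: eq_bigr => v _; rewrite (wmapE thetaTM).
Qed.

(** Distinct input-output edges have distinct pairs of labels. *)
Lemma ioW_pairs k l (G : graph P k l) : ioW Q G =
  \big[wmul/wone]_(xy in gio_pairs G) wunit Q (nat_of_ord xy.1) (nat_of_ord xy.2).
Proof.
rewrite /gio_pairs big_imset //= => e e' _ _ [/(bij_inj (ilab_bij G))].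
by case.
Qed.

(** Compatibility with the equivalence relation defining uPGr(P). *)
Lemma ev_pat k l (G H : graph P k l) : pat G = pat H -> ev theta G = ev theta H.
Proof.
move=> E; have sE : solW idval G = solW idval H := congr1 (fun a => a.1.1) E.
have /gio_pairs_rel ioE : io_rel G = io_rel H := congr1 (fun a => a.1.2) E.
have nE : #|gL G| = #|gL H| := congr1 snd E.
apply: ev_eq; rewrite emb_ev /evW !solW_map sE !ioW_pairs ioE.
by congr (wmul _ (wmul _ _)); rewrite /loopW !big_const nE.
Qed.

Definition extension k l (a : uPGr_utrap P k l) : Q k l := ev theta (urep a).

Lemma extension_up k l (G : graph P k l) : extension (up G) = ev theta G.
Proof. exact/ev_pat/pat_up. Qed.

Lemma extension_morphism : utrap_morphism extension.
Proof.
split; last by apply: etrans (extension_up _) _; apply: ev_gunit.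
split.
- by move=> k l s a; apply: etrans (extension_up _) _; apply: ev_glact.
- by move=> k l a s; apply: etrans (extension_up _) _; apply: ev_gract.
- by apply: etrans (extension_up _) _; apply: ev_gempty.
- by move=> k l k' l' a b; apply: etrans (extension_up _) _; apply: ev_disj_union.
- by move=> k l i j a; apply: etrans (extension_up _) _; apply: ev_gtr.
Qed.

Lemma extension_iota k l (p : P k l) : extension (iota' p) = theta p.
Proof. by apply: etrans (extension_up _) _; apply: ev_iota. Qed.

End Extension.

(** Induction on the number of input-output edges and loops.  A loop splits off as the
    trace of a unit, an input-output edge as a unit; a solar graph has the same pattern
    as the corolla decorated by its value. *)
Lemma extension_unique (P : trap) (Q : utrap) (f g : forall k l, uPGr_utrap P k l -> Q k l) :
  utrap_morphism f -> utrap_morphism g ->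
  (forall k l (p : P k l), f k l (iota' p) = g k l (iota' p)) ->
  forall k l a, f k l a = g k l a.
Proof.
move=> [fM fu] [gM gu] fg k l a; rewrite -(urepK a); move: (urep a) => {a} G.
have unitE : up (gunit P) = tunit by [].
have [n] := ubnP (#|gIO G| + #|gL G|); elim: n => // n IH in k l G *; rewrite ltnS => Gn.
have [e|noL] : gL G + (gL G -> False).
  by case: (pickP (fun _ : gL G => true)) => [e _|no]; [left|right=> e; have := no e].
  (* The graph with a single loop is a partial trace of the unit graph. *)
  pose U : graph P 0 0 := gtr (gunit P) ord0 ord0.
  have patU : pat U = (wone, (fun _ _ => False), 1).
    have io00 : io_rel (gunit P) 0 0 by exists tt.
    rewrite /U pat_gtr /pat_tr /pat /=; case: pselect => // ?.
    rewrite solW_gunit wren1 card_void asboolT //; congr (_, _, _).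
    by apply: eq_rel => x y; split=> // -[[e' []]|[[e' []]]].
  have cL : #|gL (drop_loop e)| = #|gL G|.-1 := card_neq e.
  have L0 : 0 < #|gL G| by apply/card_gt0P; exists e.
  have -> : up G = hcat (up U) (up (drop_loop e)).
    rewrite -up_disj_union; apply: eq_up.
    apply: etrans _ (esym (pat_disj_union U (drop_loop e))).
    rewrite patU /pat_union /= wmul1w; congr (_, _, _).
    - by rewrite -[LHS]wren_id.
    - apply: eq_rel => x y; split=> [xy|[//|[x0 [y0 [xy -> ->]]]]]; last exact: xy.
      by right; exists x, y.
    - by rewrite cL add1n prednK.
  apply: etrans (morph_hcat fM (up U) (up (drop_loop e))) _.
  apply: etrans _ (esym (morph_hcat gM (up U) (up (drop_loop e)))).
  rewrite [up U]up_gtr (morph_ptr fM) (morph_ptr gM) unitE fu gu IH //; apply: leq_trans Gn.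
  by rewrite cL -addnS prednK.
have [e|noIO] : gIO G + (gIO G -> False).
  by case: (pickP (fun _ : gIO G => true)) => [e _|no]; [left|right=> e; have := no e].
  case: k l G {noL} e Gn => [|k] [|l] G e Gn; try by [case: (ilab G (inr e)) | case: (olab G (inr e))].
  rewrite -(up_iso (drop_io_iso e)) up_glact up_gract.
  rewrite (morph_lact fM) (morph_ract fM) (morph_lact gM) (morph_ract gM).
  have uE : up (disj_union (gunit P) (drop_io e)) = hcat tunit (up (drop_io e)).
    exact: up_disj_union.
  congr (lact _ (ract _ _)).
  apply: etrans (congr1 (f _ _) uE) _; apply: etrans _ (esym (congr1 (g _ _) uE)).
  apply: etrans (morph_hcat fM _ _) _; apply: etrans _ (esym (morph_hcat gM _ _)).
  rewrite fu gu IH //; apply: leq_trans Gn.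
  rewrite (card_neq e : #|gIO (drop_io e)| = #|gIO G|.-1).
  have IO0 : 0 < #|gIO G| by apply/card_gt0P; exists e.
  by rewrite -addSn prednK.
(* No loops and input-output edges are left. *)
have [p pE] : exists p, solW (fun k l (p : P k l) => p) G = emb (p : P k l).
  by apply: solar_value; split.
have -> : up G = iota' p; last exact: fg.
apply: eq_up; rewrite /pat pE solW_iota card_void; congr (_, _, _).
  by apply: eq_rel => x y; split=> -[e]; [case: (noIO e) | case: e].
by apply: eq_card0 => e; case: (noL e).
Qed.

Theorem proposition3p5p1 (P : trap) (Q : utrap)
    (theta : forall k l : nat, P k l -> Q k l)
    (theta_morph : trap_morphism theta) :
  exists! Theta : forall k l : nat, uPGr_utrap P k l -> Q k l,
    utrap_morphism Theta /\
    forall (k l : nat) (p : P k l), Theta k l (iota' p) = theta k l p.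
Proof.
exists (@extension P Q theta); split.
  split=> [|k l p]; first exact: extension_morphism.
  exact: extension_iota.
move=> Theta [ThetaM Theta_iota].
apply/functional_extensionality_dep => k; apply/functional_extensionality_dep => l.
apply/funext => a; apply: extension_unique => // [|k' l' p]; first exact: extension_morphism.
by rewrite extension_iota // Theta_iota.
Qed.
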